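(* Let $\mathcal D_0 \subseteq \operatorname{BUC}(\mathbb C^n)$ be a closed, translation-invariant and $U$-invariant linear subspace. Then the following are equivalent: (i) $\mathcal D_0$ is a $C^\ast$ algebra with respect to the standard (pointwise) operations and the $L^\infty$ norm; (ii) $\mathcal T_{lin}^{2,t}(\mathcal D_0) = \mathcal T_\ast^{2,t}(\mathcal D_0)$ for all $t > 0$. If these equivalent conditions are fulfilled, then $\mathcal T_{lin}^{p,t}(\mathcal D_0) = \mathcal T^{p,t}(\mathcal D_0)$ for all $1 < p < \infty$ and $t > 0$. If further $\mathcal D_0$ is a closed, translation-invariant and $U$-invariant $C^\ast$ subalgebra of $\operatorname{BUC}(\mathbb C^n)$ and $\mathcal I \subseteq \mathcal D_0$ is a closed and translation-invariant linear subspace, then the following are equivalent: (i* ) $\mathcal I$ is an ideal in $\mathcal D_0$; (ii* ) $\mathcal T_{lin}^{2,t}(\mathcal I)$ is a one-sided (i.e. left or right) ideal in $\mathcal T_{lin}^{2,t}(\mathcal D_0)$ for all $t > 0$; (iii* ) $\mathcal T_{lin}^{2,t}(\mathcal I)$ is a two-sided ideal in $\mathcal T_{lin}^{2,t}(\mathcal D_0)$ for all $t > 0$. If (i* )–(iii* ) hold, then $\mathcal T_{lin}^{p,t}(\mathcal I) = \mathcal T^{p,t}(\mathcal I)$ is a closed two-sided ideal in $\mathcal T_{lin}^{p,t}(\mathcal D_0)$ for all $1 < p < \infty$ and $t > 0$.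
   Context: Fix $n \ge 1$. $V$ is Lebesgue measure on $\mathbb C^n$, $z\cdot\overline w = \sum_j z_j\overline{w_j}$, and for $s>0$, $d\mu_s(z) = \frac{1}{(\pi s)^n} e^{-|z|^2/s}\,dV(z)$. For $1<p<\infty$, $t>0$, the $p$-Fock space is $F_t^p := L^p(\mathbb C^n,\mu_{2t/p}) \cap \operatorname{Hol}(\mathbb C^n)$ with the norm of $L^p(\mathbb C^n,\mu_{2t/p})$. The bounded projection $P_t: L^p(\mathbb C^n,\mu_{2t/p}) \to F_t^p$ is $P_t(h)(z) = \int_{\mathbb C^n} e^{z\cdot\overline w/t} h(w)\,d\mu_t(w)$. For $f \in L^\infty(\mathbb C^n)$ the Toeplitz operator $T_f^t \in \mathcal L(F_t^p)$ is $T_f^t g = P_t(fg)$. For $S \subseteq L^\infty(\mathbb C^n)$: $\mathcal T_{lin}^{p,t}(S) \subseteq \mathcal L(F_t^p)$ is the norm closed linear span of $\{T_f^t : f\in S\}$; $\mathcal T^{p,t}(S)$ is the Banach algebra (norm closed subalgebra of $\mathcal L(F_t^p)$) generated by $\{T_f^t: f \in S\}$; and $\mathcal T_\ast^{2,t}(S)\subseteq \mathcal L(F_t^2)$ is the $C^\ast$ algebra generated by $\{T_f^t: f\in S\}$ (here $F_t^2$ is a Hilbert space with the $L^2(\mu_t)$ inner product). $\operatorname{BUC}(\mathbb C^n)$ is the space of bounded uniformly continuous complex-valued functions on $\mathbb C^n$ with the sup norm. A set $\mathcal D_0$ of functions is translation-invariant if $f(\cdot - z)\in\mathcal D_0$ for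 all $f \in \mathcal D_0$, $z\in\mathbb C^n$, and $U$-invariant if $Uf\in\mathcal D_0$ for all $f\in\mathcal D_0$, where $Uf(z) = f(-z)$. *)

(* Defs.v *)
From HB Require Import structures.
From mathcomp Require Import all_boot all_order all_algebra.
From mathcomp Require Import complex.
From mathcomp Require Import all_classical all_reals all_analysis.
From mathcomp Require Import measurable_realfun lra.

Set Implicit Arguments.
Unset Strict Implicit.
Unset Printing Implicit Defensive.

Import Order.TTheory GRing.Theory Num.Theory.
Import numFieldNormedType.Exports.

Local Open Scope classical_set_scope.
Local Open Scope ring_scope.
Local Open Scope complex_scope.

Notation Re := (@complex.Re _).
Notation Im := (@complex.Im _).
Notation normc := (@Normc.normc _).

(* R[i] as a normed space over itself; C^n is 'rV[R[i]]_n, whose topology and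
   uniformity (those of the max norm) are the usual ones. *)
HB.instance Definition _ (R : realType) := PseudoPointedMetric.copy R[i] R[i]^o.
HB.instance Definition _ (R : realType) := NormedModule.copy R[i] R[i]^o.

Lemma product_sigma_finite d1 d2 (T1 : measurableType d1)
    (T2 : measurableType d2) (R : realType)
    (m1 : {sigma_finite_measure set T1 -> \bar R})
    (m2 : {sigma_finite_measure set T2 -> \bar R}) :
  sigma_finite [set: T1 * T2] (m1 \x m2)%E.
Proof.
have /sigma_finiteP[F [TF ndF Foo]] := sigma_finiteT m1.
have /sigma_finiteP[G [TG ndG Goo]] := sigma_finiteT m2.
exists (fun n => F n `*` G n).
  rewrite -setXTT TF TG predeqE => -[x y]; split.
    move=> [/= [n _ Fnx] [k _ Gky]]; exists (maxn n k) => //; split.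
    - by move: x Fnx; exact/subsetPset/ndF/leq_maxl.
    - by move: y Gky; exact/subsetPset/ndG/leq_maxr.
  by move=> [n _ []/= ? ?]; split; exists n.
move=> k; have [? ?] := Foo k; have [? ?] := Goo k.
split; first exact: measurableX.
by rewrite product_measure1E// lte_mul_pinfty// ge0_fin_numE.
Qed.

Section LebesgueCn.
Variable R : realType.

Local Notation R2 := (measurableTypeR R * measurableTypeR R)%type.

Definition recoord n (j : 'I_n) (z : 'rV[R[i]]_n) : R2 :=
  (Re (z 0 j), Im (z 0 j)).

Section structure.
Variable n : nat.

Let C0 : g_sigma_preimage (@recoord n) set0.
Proof. exact: sigma_algebra0. Qed.

Let CC A :
  g_sigma_preimage (@recoord n) A -> g_sigma_preimage (@recoord n) (~` A).
Proof. exact: sigma_algebraC. Qed.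

Let Cbigcup (F : (set 'rV[R[i]]_n)^nat) :
  (forall i, g_sigma_preimage (@recoord n) (F i)) ->
  g_sigma_preimage (@recoord n) (\bigcup_i F i).
Proof. exact: sigma_algebra_bigcup. Qed.

(* The sigma-algebra generated by the real coordinates Re z_j, Im z_j, i.e. the
   Borel sigma-algebra of C^n = R^2n. *)
HB.instance Definition _ := @isMeasurable.Build default_measure_display
  'rV[R[i]]_n (g_sigma_preimage (@recoord n)) C0 CC Cbigcup.

End structure.

Lemma measurable_recoord n (j : 'I_n) : measurable_fun [set: _] (@recoord n j).
Proof.
move=> _ Y mY; rewrite setTI; apply: sub_sigma_algebra => /=.
rewrite -bigcup_seq/=; exists j => /=; first by rewrite mem_index_enum.
by exists Y => //; rewrite setTI.
Qed.

Lemma measurable_recoordP d (T : measurableType d) n (f : T -> 'rV[R[i]]_n) :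
  measurable_fun [set: T] f <->
  forall j, measurable_fun [set: T] (recoord j \o f).
Proof.
split=> [mf j|mf].
  by apply: measurableT_comp => //; exact: measurable_recoord.
suff : g_sigma_preimage (fun j => recoord j \o f) `<=` measurable.
  rewrite g_sigma_preimage_comp => prefS _ A mA.
  by apply: prefS; exists A.
apply: smallest_sub; first exact: sigma_algebra_measurable.
rewrite -bigcup_seq => A [j _ [B mB <-]].
exact: mf.
Qed.

Definition cons_Cn n (xz : R2 * 'rV[R[i]]_n) : 'rV[R[i]]_n.+1 :=
  \row_j if unlift ord0 j is Some k then xz.2 0 k else xz.1.1 +i* xz.1.2.

Lemma measurable_cons_Cn n : measurable_fun [set: _] (@cons_Cn n).
Proof.
apply/measurable_recoordP => j.
have [k|] := unliftP ord0 j.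
  move=> ->; rewrite (_ : _ \o _ = recoord k \o snd).
    by apply: measurableT_comp => //; exact: measurable_recoord.
  by apply/funext => x; rewrite /recoord /cons_Cn /= mxE liftK.
move=> ->; rewrite (_ : _ \o _ = fst) //.
by apply/funext => -[[x y] z]; rewrite /recoord /cons_Cn /= mxE unlift_none.
Qed.

Definition uncons_Cn n (z : 'rV[R[i]]_n.+1) : R2 * 'rV[R[i]]_n :=
  (recoord ord0 z, \row_k z 0 (lift ord0 k)).

Lemma measurable_uncons_Cn n : measurable_fun [set: _] (@uncons_Cn n).
Proof.
apply/measurable_fun_pairP; split; first exact: measurable_recoord.
apply/measurable_recoordP => j.
rewrite (_ : _ \o _ = recoord (lift ord0 j)); first exact: measurable_recoord.
by apply/funext => z; rewrite /recoord /= mxE.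
Qed.

Lemma cons_CnK n : cancel (@cons_Cn n) (@uncons_Cn n).
Proof.
case=> -[x y] z; rewrite /uncons_Cn /recoord /cons_Cn /= mxE unlift_none /=.
by congr pair; apply/rowP => k; rewrite !mxE liftK.
Qed.

Local Open Scope ereal_scope.

Definition lebesgue2 : set R2 -> \bar R :=
  @lebesgue_measure R \x @lebesgue_measure R.
HB.instance Definition _ := Measure.on lebesgue2.
HB.instance Definition _ := Measure_isSigmaFinite.Build _ _ _
  lebesgue2 (@product_sigma_finite _ _ _ _ R _ _).

Section step.
Variables (n : nat) (V : {sigma_finite_measure set 'rV[R[i]]_n -> \bar R}).

Definition lebesgue_step : set 'rV[R[i]]_n.+1 -> \bar R :=
  pushforward (lebesgue2 \x V) (@cons_Cn n).

Let step0 : lebesgue_step set0 = 0.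
Proof. by rewrite /lebesgue_step /pushforward preimage_set0 measure0. Qed.

Let step_ge0 A : 0 <= lebesgue_step A.
Proof. by rewrite /lebesgue_step /pushforward; exact: measure_ge0. Qed.

Let step_sigma_additive : semi_sigma_additive lebesgue_step.
Proof.
move=> F mF tF mUF.
rewrite /lebesgue_step /pushforward preimage_bigcup.
have mcons A : measurable A -> measurable (@cons_Cn n @^-1` A).
  by move=> mA; rewrite -[X in measurable X]setTI; exact: measurable_cons_Cn.
apply: measure_semi_sigma_additive.
- by move=> k; exact: mcons.
- apply/trivIsetP => i j _ _ ij; rewrite -preimage_setI.
  by move/trivIsetP : tF => /(_ _ _ _ _ ij) ->//; rewrite preimage_set0.
- by rewrite -preimage_bigcup; exact: mcons.
Qed.

HB.instance Definition _ := isMeasure.Build _ _ _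
  lebesgue_step step0 step_ge0 step_sigma_additive.

Let step_sigma_finite : sigma_finite setT lebesgue_step.
Proof.
have [F TF mF] := product_sigma_finite lebesgue2 V.
exists (fun k => @uncons_Cn n @^-1` F k).
  by rewrite -preimage_bigcup -TF preimage_setT.
move=> k; have [mFk Fkoo] := mF k; split.
  by rewrite -[X in measurable X]setTI; exact: measurable_uncons_Cn.
rewrite /lebesgue_step /pushforward -comp_preimage.
by rewrite (_ : _ \o _ = id) //; apply/funext => x; exact: cons_CnK.
Qed.

HB.instance Definition _ := Measure_isSigmaFinite.Build _ _ _
  lebesgue_step step_sigma_finite.

End step.

(* Lebesgue measure on C^n = (R x R)^n, as an iterated product. *)
Fixpoint lebesgue_Cn n : {sigma_finite_measure set 'rV[R[i]]_n -> \bar R} :=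
  match n with
  | 0 => dirac (0%R : 'rV[R[i]]_0)
  | n'.+1 => lebesgue_step (lebesgue_Cn n')
  end.

End LebesgueCn.

Section Gaussian.
Variables (R : realType) (n : nat).
Implicit Types z w : 'rV[R[i]]_n.

Definition cdot z w : R[i] := \sum_j z 0 j * (w 0 j)^*.

Definition sqnorm z : R := \sum_j (Re (z 0 j) ^+ 2 + Im (z 0 j) ^+ 2).

Definition gauss_density (s : {posnum R}) z : R :=
  (pi * s%:num) ^- n * expR (- sqnorm z / s%:num).

Lemma gauss_density_ge0 s z : 0 <= gauss_density s z.
Proof.
by rewrite /gauss_density mulr_ge0 ?expR_ge0// invr_ge0 exprn_ge0// mulr_ge0//
  pi_ge0.
Qed.

Lemma measurable_gauss_density s : measurable_fun [set: _] (gauss_density s).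
Proof.
apply: measurable_funM; first exact: measurable_cst.
apply: measurableT_comp; first exact: measurable_expR.
apply: measurable_funM; last exact: measurable_cst.
apply: measurableT_comp => //.
rewrite /sqnorm; apply: measurable_sum => j.
have := @measurable_recoord R n j => /measurable_fun_pairP[mRe mIm].
by apply: measurable_funD; exact: measurable_funX.
Qed.

Definition gauss (s : {posnum R}) (A : set 'rV[R[i]]_n) : \bar R :=
  (\int[lebesgue_Cn R n]_(z in A) (gauss_density s z)%:E)%E.

Section measure.
Variable s : {posnum R}.

Let gauss0 : gauss s set0 = 0%E.
Proof. by rewrite /gauss integral_set0. Qed.

Let gauss_ge0 A : (0 <= gauss s A)%E.
Proof. by apply: integral_ge0 => z _; rewrite lee_fin gauss_density_ge0. Qed.

Let gauss_sigma_additive : semi_sigma_additive (gauss s).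
Proof.
move=> F mF tF mUF; rewrite /gauss ge0_integral_bigcup//.
- by apply: is_cvg_ereal_nneg_natsum => k _; exact: gauss_ge0.
- apply: measurable_funTS; apply/measurable_EFinP.
  exact: measurable_gauss_density.
- by move=> z _; rewrite lee_fin gauss_density_ge0.
Qed.

HB.instance Definition _ := isMeasure.Build _ _ _
  (gauss s) gauss0 gauss_ge0 gauss_sigma_additive.

End measure.

End Gaussian.

Definition pos2 (R : realType) : {posnum R} := 2%:pos.
Arguments pos2 {R}.

Section Fock.
Variables (R : realType) (n : nat).
Local Notation Cn := ('rV[R[i]]_n).
Implicit Types (f g h : Cn -> R[i]) (p t : {posnum R}).

Definition cmeasurable f :=
  measurable_fun [set: Cn] (Re \o f) /\ measurable_fun [set: Cn] (Im \o f).

Definition Lp_norm (mu : {measure set Cn -> \bar R}) (p : R) f : \bar R :=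
  Lnorm mu p%:E (EFin \o (normc \o f)).

Definition Lp (mu : {measure set Cn -> \bar R}) (p : R) : set (Cn -> R[i]) :=
  [set f | cmeasurable f /\ (Lp_norm mu p f < +oo)%E].

Definition cintegral (mu : {measure set Cn -> \bar R}) f : R[i] :=
  Rintegral mu setT (Re \o f) +i* Rintegral mu setT (Im \o f).

(* Complex differentiability: the scalar field of both normed spaces is R[i]. *)
Definition Hol : set (Cn -> R[i]) := [set f | forall z, differentiable f z].

Definition fock_measure p t : {measure set Cn -> \bar R} :=
  gauss (n := n) (2 * t%:num / p%:num)%:pos.

Definition fock_pred p t : {pred Cn -> R[i]} :=
  mem (Lp (fock_measure p t) p%:num `&` Hol).

Lemma cmeasurable_normc f : cmeasurable f ->
  measurable_fun [set: Cn] (normc \o f).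
Proof.
move=> [mRe mIm].
rewrite (_ : _ \o _ =
  (@Num.sqrt R) \o (fun z => (Re \o f) z ^+ 2 + (Im \o f) z ^+ 2)); last first.
  by apply/funext => z /=; case: (f z).
apply: measurableT_comp.
  by apply: continuous_measurable_fun => x; exact: sqrt_continuous.
by apply: measurable_funD; exact: measurable_funX.
Qed.

Lemma Lp_norm_fin (mu : {measure set Cn -> \bar R}) (p : {posnum R}) f :
  (Lp_norm mu p%:num f < +oo)%E =
  (\int[mu]_z (normc (f z) `^ p%:num)%:E < +oo)%E.
Proof.
rewrite /Lp_norm unlock.
have -> : (\int[mu]_x `|(EFin \o (normc \o f)) x| `^ p%:num)%E =
          (\int[mu]_z (normc (f z) `^ p%:num)%:E)%E.
  apply: eq_integral => z _; rewrite /= ger0_norm//; last first.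
  by case: (f z) => a b; exact: sqrtr_ge0.
have : (0 <= \int[mu]_z (normc (f z) `^ p%:num)%:E)%E.
  by apply: integral_ge0 => z _; rewrite lee_fin powR_ge0.
case: (\int[mu]_z _)%E => [r| |] //= _.
  by rewrite !ltry.
by rewrite gt_eqF ?invr_gt0.
Qed.

Lemma fock_submod_closed p t : submod_closed (fock_pred p t).
Proof.
have normc_ge0 (a : R[i]) : 0 <= normc a by case: a => ? ?; exact: sqrtr_ge0.
split.
  rewrite inE; split; last by move=> z; exact: differentiable_cst.
  split; first by split; exact: measurable_cst.
  rewrite Lp_norm_fin integral0_eq// => z _.
  by rewrite Normc.normc0 powR0// gt_eqF.
move=> a f g; rewrite !inE => -[[mf fp] hf] [[mg gp] hg].
have mafg : cmeasurable (a *: f + g).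
  case: mf mg => [mRf mIf] [mRg mIg].
  have aE z : (a *: f + g) z = (Re a * Re (f z) - Im a * Im (f z) + Re (g z)) +i*
                     (Re a * Im (f z) + Im a * Re (f z) + Im (g z)).
    rewrite [LHS]/(a * f z + g z).
    by case: a (f z) (g z) => [? ?] [? ?] [? ?].
  split.
    rewrite (_ : _ \o _ = (fun z => Re a * (Re \o f) z - Im a * (Im \o f) z +
      (Re \o g) z)); last by apply/funext => z /=; rewrite aE.
    apply: measurable_funD => //; apply: measurable_funB;
    by apply: measurable_funM => //; exact: measurable_cst.
  rewrite (_ : _ \o _ = (fun z => Re a * (Im \o f) z + Im a * (Re \o f) z +
    (Im \o g) z)); last by apply/funext => z /=; rewrite aE.
  apply: measurable_funD => //; apply: measurable_funD;
  by apply: measurable_funM => //; exact: measurable_cst.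
split; last first.
  move=> z; apply: differentiableD; last exact: hg.
  by apply: differentiableZ; exact: hf.
split=> //.
move: fp gp; rewrite !Lp_norm_fin => fp gp.
have mpow h : cmeasurable h ->
    measurable_fun [set: Cn] (fun z => (normc (h z) `^ p%:num)%:E).
  move=> /cmeasurable_normc mh; apply/measurable_EFinP.
  exact: (measurableT_comp (measurable_powR _) mh).
apply: (@le_lt_trans _ _ (\int[fock_measure p t]_z
  (((2 * (normc a + 1)) `^ p%:num)%:E *
   ((normc (f z) `^ p%:num)%:E + (normc (g z) `^ p%:num)%:E)))%E).
  apply: ge0_le_integral => //.
  - by move=> z _; rewrite lee_fin powR_ge0.
  - exact: mpow.
  - by apply: measurable_funeM; apply: emeasurable_funD; exact: mpow.
  move=> z _; rewrite -EFinD -EFinM lee_fin.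
  set u := normc (f z); set v := normc (g z).
  have u0 : 0 <= u by exact: normc_ge0.
  have v0 : 0 <= v by exact: normc_ge0.
  have a0 := normc_ge0 a.
  have le1 : normc ((a *: f + g) z) <= 2 * (normc a + 1) * Num.max u v.
    apply: le_trans (le_normcD _ _) _.
    rewrite [X in normc X + _]/(a * f z) Normc.normcM -/u -/v.
    have um : u <= Num.max u v by rewrite le_max lexx.
    have vm : v <= Num.max u v by rewrite le_max lexx orbT.
    by clear -a0 u0 v0 um vm; nra.
  have p0 : 0 <= p%:num by exact: ltW.
  apply: (@le_trans _ _ ((2 * (normc a + 1) * Num.max u v) `^ p%:num)).
    apply: ge0_ler_powR => //; rewrite nnegrE; first exact: normc_ge0.
    exact: le_trans (normc_ge0 _) le1.
  have m0 : 0 <= Num.max u v by rewrite le_max u0.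
  have c0 : 0 <= 2 * (normc a + 1) by rewrite mulr_ge0// addr_ge0.
  rewrite powRM// ler_wpM2l ?powR_ge0//.
  by have [] := leP u v; rewrite ?lerDl ?lerDr ?powR_ge0.
have mfp := mpow f mf; have mgp := mpow g mg.
rewrite ge0_integralZl//; last 3 first.
- exact: emeasurable_funD.
- by move=> z _; rewrite adde_ge0 ?lee_fin ?powR_ge0.
- by rewrite lee_fin powR_ge0.
rewrite ge0_integralD//.
- by rewrite lte_mul_pinfty ?lee_fin ?powR_ge0// lte_add_pinfty.
- by move=> z _; rewrite lee_fin powR_ge0.
- by move=> z _; rewrite lee_fin powR_ge0.
Qed.

HB.instance Definition _ p t := GRing.isSubmodClosed.Build _ _ (fock_pred p t)
  (fock_submod_closed p t).

Record fock p t : Type :=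
  Fock { fock_val :> Cn -> R[i] ; _ : fock_val \in fock_pred p t }.

HB.instance Definition _ p t := [isSub for @fock_val p t].
Arguments fock_val {p t} _.
HB.instance Definition _ p t := [Choice of fock p t by <:].
HB.instance Definition _ p t := [SubChoice_isSubLmodule of fock p t by <:].

Definition fock_norm p t (g : fock p t) : R :=
  fine (Lp_norm (fock_measure p t) p%:num g).

Definition cexp (z : R[i]) : R[i] :=
  (expR (Re z))%:C * (cos (Im z) +i* sin (Im z)).

Definition proj t h : Cn -> R[i] := fun z =>
  cintegral (gauss t) (fun w => cexp (cdot z w / (t%:num)%:C) * h w).

(* proj t maps L^p(fock_measure p t) into the Fock space, so for bounded
   measurable f the default value 0 of insubd is never used. *)
Definition toeplitz p t f : fock p t -> fock p t :=
  fun u : fock p t => insubd 0 (proj t (f \* u)).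

(* fock_measure pos2 t is gauss t, up to the rewriting of 2 * t / 2 into t. *)
Definition fock_dot t (u v : fock pos2 t) : R[i] :=
  cintegral (gauss t) (fun z => u z * (v z)^*).

End Fock.

Section NormedSpace.
Variables (R : realType) (V : lmodType R[i]).

Definition subspace (A : set V) :=
  A 0 /\ forall (a : R[i]) x y, A x -> A y -> A (a *: x + y).

Definition span (S : set V) : set V := smallest subspace S.

(* Norm closure of A inside a subspace E of V normed by N. *)
Definition norm_closure (N : V -> R) (E A : set V) : set V :=
  [set x | E x /\ forall e, 0 < e -> exists2 y, A y & N (x - y) < e].

Definition norm_closed (N : V -> R) (E A : set V) :=
  norm_closure N E A `<=` A.

End NormedSpace.

Section Operators.
Variables (R : realType) (V : lmodType R[i]) (N : V -> R).

Definition bounded_operator : set (V -> V) :=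
  [set A | linear A /\ exists M, forall x, N (A x) <= M * N x].

Definition opnorm (A : V -> V) : R :=
  sup [set N (A x) | x in [set x | N x <= 1]].

Definition closed_subalgebra (A : set (V -> V)) :=
  [/\ A `<=` bounded_operator, subspace A,
      (forall S T, A S -> A T -> A (S \o T)) &
      norm_closed opnorm bounded_operator A].

Definition left_ideal (J A : set (V -> V)) :=
  [/\ J `<=` A, subspace J & forall S T, A S -> J T -> J (S \o T)].

Definition right_ideal (J A : set (V -> V)) :=
  [/\ J `<=` A, subspace J & forall S T, A S -> J T -> J (T \o S)].

Definition two_sided_ideal (J A : set (V -> V)) :=
  left_ideal J A /\ right_ideal J A.

Variable dot : V -> V -> R[i].

Definition adjoint (S T : V -> V) := forall x y, dot (S x) y = dot x (T y).

Definition Cstar_subalgebra (A : set (V -> V)) :=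
  closed_subalgebra A /\
  forall S T, A S -> bounded_operator T -> adjoint S T -> A T.

End Operators.

Section ToeplitzAlgebras.
Variables (R : realType) (n : nat).
Local Notation Cn := ('rV[R[i]]_n).
Implicit Types (p t : {posnum R}) (S : set (Cn -> R[i])).

Definition fock_operator p t : set (fock n p t -> fock n p t) :=
  bounded_operator (@fock_norm R n p t).

Definition fock_opnorm p t : (fock n p t -> fock n p t) -> R :=
  opnorm (@fock_norm R n p t).

Definition toeplitz_ops p t S : set (fock n p t -> fock n p t) :=
  @toeplitz R n p t @` S.
Arguments toeplitz_ops : clear implicits.

Definition toeplitz_lin p t S : set (fock n p t -> fock n p t) :=
  norm_closure (@fock_opnorm p t) (@fock_operator p t)
    (span (toeplitz_ops p t S)).

Definition toeplitz_alg p t S : set (fock n p t -> fock n p t) :=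
  smallest (closed_subalgebra (@fock_norm R n p t)) (toeplitz_ops p t S).

Definition toeplitz_Cstar t S : set (fock n pos2 t -> fock n pos2 t) :=
  smallest (Cstar_subalgebra (@fock_norm R n pos2 t) (@fock_dot R n t))
    (toeplitz_ops pos2 t S).

End ToeplitzAlgebras.
Arguments fock_operator {R} n p t.
Arguments fock_opnorm {R} n p t A.
Arguments toeplitz_ops {R n} p t S.
Arguments toeplitz_lin {R n} p t S.
Arguments toeplitz_alg {R n} p t S.
Arguments toeplitz_Cstar {R n} t S.

Section Functions.
Variables (R : realType) (n : nat).
Local Notation Cn := ('rV[R[i]]_n).
Implicit Types (f g : Cn -> R[i]) (D I : set (Cn -> R[i])).

Definition BUC : set (Cn -> R[i]) :=
  [set f | (exists M, forall z, normc (f z) <= M) /\ unif_continuous f].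

Definition supnorm f : R := sup (range (normc \o f)).

Definition translation_invariant D :=
  forall f (z : Cn), D f -> D (fun w => f (w - z)).

Definition U_invariant D := forall f, D f -> D (fun w => f (- w)).

Definition closed_subspace_BUC D :=
  [/\ D `<=` BUC, subspace D & norm_closed supnorm BUC D].

(* Completeness and the C^*-identity for the sup norm are inherited from BUC. *)
Definition Cstar_algebra_fun D :=
  [/\ closed_subspace_BUC D,
      (forall f g, D f -> D g -> D (f \* g)) &
      (forall f, D f -> D (fun z => (f z)^*))].

Definition ideal_fun I D :=
  [/\ I `<=` D, subspace I & forall f g, D f -> I g -> I (f \* g)].

End Functions.

(* Main.v *)
(* Write e_b for the Gaussian exp(-b|z|^2).  For symbols that are translates
   e_b1(. - x) and e_b2(. - y), both Toeplitz operators are computed by the mean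
   value property of holomorphic functions against Gaussians, and their product
   is again a Toeplitz operator, with an explicit symbol G(. - x, . - y)
   ([pkern]).  By Fubini, for f, g bounded and b1, b2 <= 1/t,
     T_(e_b1 * f) T_(e_b2 * g) = T_h,
     h = int int G(x, y) f(. - x) g(. - y) dx dy,
   so that h lies in J as soon as J is closed and contains the products of
   translates of f and g.  The symbols e_b * f with f in D and b <= 1/t span a
   dense subspace of D: the narrow Gaussians form an approximate identity, and
   they are recovered from wide ones because (2 - e^{y/m})^m tends to e^{-y}.
   Hence T_f T_g is in T_lin(J) whenever D D' is contained in J, f is in D and g
   in D'.  This gives every implication from functions to operators; for p = 2,
   T_lin(D) is moreover closed under adjoints if D is closed under conjugation.

   Conversely, the Berezin transform is bounded from operators to functions,
   maps T_lin(J) into J (on T_f it is convolution of f with a Gaussian), and the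
   Berezin transform of T_f T_g tends uniformly to f g as t tends to 0. *)

Require Import Defs.
From HB Require Import structures.
From mathcomp Require Import all_boot all_order all_algebra.
From mathcomp Require Import complex.
From mathcomp Require Import all_classical all_reals all_analysis.
From mathcomp Require Import measurable_realfun ring lra.

Set Implicit Arguments.
Unset Strict Implicit.
Unset Printing Implicit Defensive.

Import Order.TTheory GRing.Theory Num.Theory.
Import numFieldNormedType.Exports.

Local Open Scope classical_set_scope.
Local Open Scope ring_scope.
Local Open Scope complex_scope.

(** The bound b <= 1/t controls the cross term t b1 b2 <y, x> in the exponent of G: it then costs at
    most half of each of the two squares. For narrow Gaussians, as soon as t^2 b1 b2 > 4, the cross
    term wins and G is no longer integrable; hence the detour that recovers narrow Gaussians from
    wide ones. The formula for G has a simple origin. Up to a constant, T with symbol e_b(. - x)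
    evaluates u at an affine image of z and multiplies by an exponential. Such operators compose
    explicitly, and G is the exponential whose coefficients reproduce the composite; the identity c
    + 1/t = t (b1 + 1/t) (b2 + 1/t) decides its cross term. All p are treated alike: conjugated by
    the weight e^{-|z|^2/(2t)}, the modulus of the kernel of P_t is 2^n times a convolution density,
    and Jensen's inequality bounds P_t by 2^n on each L^p. The limit t -> 0 rests on a pointwise
    estimate of T_g K_z, with K_z the reproducing kernel. It gives up a quarter of the Gaussian
    decay, and the remaining e^{-3|z-w|^2/(4t)} is still an approximate identity. *)

Local Notation Re := (@complex.Re _).
Local Notation Im := (@complex.Im _).
Local Notation normc := (@Normc.normc _).
(* [all_analysis] exports homonyms of the next two constants. *)
Local Notation proj := Defs.proj.
Local Notation subspace := Defs.subspace.

(** * Complex numbers and integrals *)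

Section ComplexNumbers.
Variable R : realType.
Implicit Types (z w : R[i]) (a b : R).

Lemma normc_ge0 z : 0 <= normc z.
Proof. by case: z => a b; exact: sqrtr_ge0. Qed.

Lemma normcE z : `|z| = (normc z)%:C.
Proof. by rewrite normc_def; case: z. Qed.

Lemma normc_real a : normc a%:C = `|a|.
Proof. by rewrite /= expr0n addr0 sqrtr_sqr. Qed.

Lemma normc_eq0 z : (normc z == 0) = (z == 0).
Proof.
apply/eqP/eqP; first exact: Normc.eq0_normc.
by move=> ->; exact: Normc.normc0.
Qed.

Lemma le_normcB z w : normc (z - w) <= normc z + normc w.
Proof. by apply: le_trans (le_normcD _ _) _; rewrite normcN. Qed.

Lemma conjcE z : (z^*)%R = (z^*)%C.
Proof. by []. Qed.

Lemma normc_conj z : normc (z^*)%R = normc z.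
Proof. by rewrite conjcE; case: z => a b /=; rewrite sqrrN. Qed.

Lemma Re_le_normc z : `|Re z| <= normc z.
Proof.
case: z => a b /=; rewrite -sqrtr_sqr ler_sqrt ?addr_ge0 ?sqr_ge0//.
by rewrite lerDl sqr_ge0.
Qed.

Lemma Im_le_normc z : `|Im z| <= normc z.
Proof.
case: z => a b /=; rewrite -sqrtr_sqr ler_sqrt ?addr_ge0 ?sqr_ge0//.
by rewrite lerDr sqr_ge0.
Qed.

Lemma normc_leD z : normc z <= `|Re z| + `|Im z|.
Proof.
case: z => a b /=; rewrite -[leRHS]ger0_norm ?addr_ge0// -sqrtr_sqr ler_sqrt ?sqr_ge0//.
rewrite sqrrD !real_normK ?num_real// lerD2r lerDl mulrn_wge0//.
Qed.

Lemma normc_sqr z : normc z ^+ 2 = Re z ^+ 2 + Im z ^+ 2.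
Proof. by case: z => a b /=; rewrite sqr_sqrtr// addr_ge0 ?sqr_ge0. Qed.

Lemma complex_eta z : z = Re z +i* Im z. Proof. by case: z. Qed.

Lemma ReD z w : Re (z + w) = Re z + Re w. Proof. by case: z w => ? ? []. Qed.
Lemma ImD z w : Im (z + w) = Im z + Im w. Proof. by case: z w => ? ? []. Qed.
Lemma ReN z : Re (- z) = - Re z. Proof. by case: z. Qed.
Lemma ImN z : Im (- z) = - Im z. Proof. by case: z. Qed.
Lemma ReB z w : Re (z - w) = Re z - Re w. Proof. by rewrite ReD ReN. Qed.
Lemma ImB z w : Im (z - w) = Im z - Im w. Proof. by rewrite ImD ImN. Qed.
Lemma ReM z w : Re (z * w) = Re z * Re w - Im z * Im w.
Proof. by case: z w => ? ? []. Qed.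
Lemma ImM z w : Im (z * w) = Re z * Im w + Im z * Re w.
Proof. by case: z w => ? ? []. Qed.
Lemma Re_conj z : Re (z^*)%R = Re z. Proof. by rewrite conjcE; case: z. Qed.
Lemma Im_conj z : Im (z^*)%R = - Im z. Proof. by rewrite conjcE; case: z. Qed.
Lemma Re_mulr a z : Re (a%:C * z) = a * Re z.
Proof. by rewrite ReM /= mul0r subr0. Qed.
Lemma Im_mulr a z : Im (a%:C * z) = a * Im z.
Proof. by rewrite ImM /= mul0r addr0. Qed.

Lemma normc_sum I (r : seq I) (P : pred I) (F : I -> R[i]) :
  normc (\sum_(i <- r | P i) F i) <= \sum_(i <- r | P i) normc (F i).
Proof.
elim/big_ind2 : _ => //; first by rewrite Normc.normc0.
move=> x u y v xu yv; apply: le_trans (le_normcD _ _) _; exact: lerD.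
Qed.

Lemma le_normc_sub z w : normc z <= normc w + normc (z - w).
Proof. by have := le_normcD w (z - w); rewrite addrC subrK. Qed.

Lemma cexpD z w : cexp (z + w) = cexp z * cexp w.
Proof.
rewrite /cexp ReD ImD expRD cosD sinD rmorphM /=.
set a := (expR (Re z))%:C; set b := (expR (Re w))%:C.
rewrite -[a * b * _]mulrA [RHS]mulrACA -[RHS]mulrA; congr (a * (b * _)).
by congr (_ +i* _); rewrite addrC.
Qed.

Lemma cexp0 : cexp 0 = 1 :> R[i].
Proof. by rewrite /cexp /= expR0 cos0 sin0 mul1r. Qed.

Lemma normc_cexp z : normc (cexp z) = expR (Re z).
Proof.
rewrite /cexp Normc.normcM normc_real ger0_norm ?expR_ge0// /=.
by rewrite cos2Dsin2 sqrtr1 mulr1.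
Qed.

Lemma cexp_neq0 z : cexp z != 0.
Proof. by rewrite -normc_eq0 normc_cexp gt_eqF ?expR_gt0. Qed.

Lemma cexp_real a : cexp a%:C = (expR a)%:C.
Proof. by rewrite /cexp /= cos0 sin0 mulr1. Qed.

Lemma cexp_conj z : (cexp z)^*%R = cexp (z^*)%R.
Proof.
rewrite /cexp Re_conj Im_conj cosN sinN rmorphM /= !conjcE.
by congr (_ * _); rewrite conjc_real.
Qed.

Lemma ReE_cexp z : Re (cexp z) = expR (Re z) * cos (Im z).
Proof. by rewrite /cexp Re_mulr. Qed.
Lemma ImE_cexp z : Im (cexp z) = expR (Re z) * sin (Im z).
Proof. by rewrite /cexp Im_mulr. Qed.

End ComplexNumbers.

Section ComplexMeasurable.
Variable R : realType.

Section one.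
Context d (T : measurableType d).
Implicit Types f g : T -> R[i].

(** Agrees with [cmeasurable] on C^n, but over any measurable domain: Fubini is used on products of
    copies of C^n. *)
Definition cmeas f :=
  measurable_fun setT (Re \o f) /\ measurable_fun setT (Im \o f).

Lemma cmeas_cst (a : R[i]) : cmeas (cst a).
Proof. by split; exact: measurable_cst. Qed.

Lemma cmeasD f g : cmeas f -> cmeas g -> cmeas (fun x => f x + g x).
Proof.
move=> [? ?] [? ?]; split.
  by rewrite (_ : _ \o _ = (Re \o f) \+ (Re \o g));
    [exact: measurable_funD|apply/funext => x /=; rewrite ReD].
by rewrite (_ : _ \o _ = (Im \o f) \+ (Im \o g));
    [exact: measurable_funD|apply/funext => x /=; rewrite ImD].
Qed.

Lemma cmeasM f g : cmeas f -> cmeas g -> cmeas (fun x => f x * g x).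
Proof.
move=> [? ?] [? ?]; split.
  rewrite (_ : _ \o _ = (fun x => (Re \o f) x * (Re \o g) x - (Im \o f) x * (Im \o g) x)).
    by apply: measurable_funB; exact: measurable_funM.
  by apply/funext => x /=; rewrite ReM.
rewrite (_ : _ \o _ = (fun x => (Re \o f) x * (Im \o g) x + (Im \o f) x * (Re \o g) x)).
  by apply: measurable_funD; exact: measurable_funM.
by apply/funext => x /=; rewrite ImM.
Qed.

Lemma cmeas_real (h : T -> R) : measurable_fun setT h -> cmeas (fun x => (h x)%:C).
Proof. by move=> mh; split => //; exact: measurable_cst. Qed.

Lemma cmeasZ (a : R[i]) f : cmeas f -> cmeas (fun x => a * f x).
Proof. by move=> mf; apply: cmeasM => //; exact: cmeas_cst. Qed.

Lemma cmeasN f : cmeas f -> cmeas (fun x => - f x).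
Proof.
move=> mf; rewrite (_ : (fun _ => _) = (fun x => -1 * f x)); first exact: cmeasZ.
by apply/funext => x; rewrite mulN1r.
Qed.

Lemma cmeasB f g : cmeas f -> cmeas g -> cmeas (fun x => f x - g x).
Proof. by move=> mf mg; apply: cmeasD => //; exact: cmeasN. Qed.

Lemma cmeas_conj f : cmeas f -> cmeas (fun x => (f x)^*%R).
Proof.
move=> [? ?]; split.
  by rewrite (_ : _ \o _ = Re \o f)//; apply/funext => x /=; rewrite Re_conj.
rewrite (_ : _ \o _ = \- (Im \o f)); first exact: measurable_funN.
by apply/funext => x /=; rewrite Im_conj.
Qed.

Lemma cmeas_sum I (r : seq I) (F : I -> T -> R[i]) :
  (forall i, cmeas (F i)) -> cmeas (fun x => \sum_(i <- r) F i x).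
Proof.
move=> mF; elim: r => [|i r ih].
  rewrite (_ : (fun _ => _) = cst 0); first exact: cmeas_cst.
  by apply/funext => x; rewrite big_nil.
rewrite (_ : (fun _ => _) = (fun x => F i x + \sum_(j <- r) F j x)); first exact: cmeasD.
by apply/funext => x; rewrite big_cons.
Qed.

Lemma cmeas_cexp f : cmeas f -> cmeas (fun x => cexp (f x)).
Proof.
move=> [mRe mIm]; rewrite /cexp; apply: cmeasM.
  by apply: cmeas_real; exact: (measurableT_comp (@measurable_expR R)).
split.
  apply: (measurableT_comp _ mIm).
  by apply: continuous_measurable_fun; exact: continuous_cos.
apply: (measurableT_comp _ mIm).
by apply: continuous_measurable_fun; exact: continuous_sin.
Qed.

Lemma measurable_normc f : cmeas f -> measurable_fun setT (fun x => normc (f x)).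
Proof.
move=> [mRe mIm].
rewrite (_ : (fun _ => _) =
  (@Num.sqrt R) \o (fun x => (Re \o f) x ^+ 2 + (Im \o f) x ^+ 2)); last first.
  by apply/funext => x /=; case: (f x).
apply: measurableT_comp.
  by apply: continuous_measurable_fun => x; exact: sqrt_continuous.
by apply: measurable_funD; exact: measurable_funX.
Qed.

Lemma measurable_enormc f : cmeas f -> measurable_fun setT (fun x => (normc (f x))%:E).
Proof. by move=> mf; apply/measurable_EFinP; exact: measurable_normc. Qed.

End one.

Lemma cmeas_comp d1 d2 (T1 : measurableType d1) (T2 : measurableType d2)
  (f : T2 -> R[i]) (h : T1 -> T2) :
  cmeas f -> measurable_fun setT h -> cmeas (fun x => f (h x)).
Proof. by move=> [? ?] mh; split; rewrite compA; exact: measurableT_comp. Qed.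

End ComplexMeasurable.

Section ComplexIntegral.
Variable R : realType.

Section one.
Context d (T : measurableType d) (mu : {measure set T -> \bar R}).
Implicit Types f g : T -> R[i].

(** The formula of [cintegral], over any measure space, and locked so that simplification does not
    expand it into its real and imaginary parts. *)
Definition cint f : R[i] :=
  locked (Rintegral mu setT (Re \o f) +i* Rintegral mu setT (Im \o f)).

Lemma cintE f : cint f =
  Rintegral mu setT (Re \o f) +i* Rintegral mu setT (Im \o f).
Proof. by rewrite /cint -lock. Qed.

Lemma Re_cint f : Re (cint f) = Rintegral mu setT (Re \o f).
Proof. by rewrite cintE. Qed.

Lemma Im_cint f : Im (cint f) = Rintegral mu setT (Im \o f).
Proof. by rewrite cintE. Qed.

Definition cintble f := cmeas f /\ (\int[mu]_x (normc (f x))%:E < +oo)%E.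

Lemma cintble_Re f : cintble f -> mu.-integrable setT (EFin \o (Re \o f)).
Proof.
move=> [[mRe mIm] foo]; apply/integrableP; split; first exact/measurable_EFinP.
apply: le_lt_trans foo; apply: ge0_le_integral => //.
- by apply: measurableT_comp => //; exact/measurable_EFinP.
- exact: measurable_enormc.
- by move=> x _; rewrite /= lee_fin Re_le_normc.
Qed.

Lemma cintble_Im f : cintble f -> mu.-integrable setT (EFin \o (Im \o f)).
Proof.
move=> [[mRe mIm] foo]; apply/integrableP; split; first exact/measurable_EFinP.
apply: le_lt_trans foo; apply: ge0_le_integral => //.
- by apply: measurableT_comp => //; exact/measurable_EFinP.
- exact: measurable_enormc.
- by move=> x _; rewrite /= lee_fin Im_le_normc.
Qed.

Lemma eq_cint f g : f =1 g -> cint f = cint g.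
Proof. by move=> fg; congr cint; apply/funext. Qed.

Lemma le_cintble f g : cmeas f -> cintble g ->
  (forall x, normc (f x) <= normc (g x)) -> cintble f.
Proof.
move=> mf [mg goo] fg; split => //; apply: le_lt_trans goo.
apply: ge0_le_integral => //.
- by move=> x _; rewrite lee_fin normc_ge0.
- exact: measurable_enormc.
- exact: measurable_enormc.
- by move=> x _; rewrite lee_fin.
Qed.

Lemma cintbleD f g : cintble f -> cintble g -> cintble (fun x => f x + g x).
Proof.
move=> [mf foo] [mg goo]; split; first exact: cmeasD.
apply: (@le_lt_trans _ _ (\int[mu]_x ((normc (f x))%:E + (normc (g x))%:E))%E).
  apply: ge0_le_integral => //.
  - by move=> x _; rewrite lee_fin normc_ge0.
  - by apply: measurable_enormc; exact: cmeasD.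
  - by apply: emeasurable_funD; exact: measurable_enormc.
  - by move=> x _; rewrite -EFinD lee_fin; exact: le_normcD.
rewrite ge0_integralD//; first exact: lte_add_pinfty.
- by move=> x _; rewrite lee_fin normc_ge0.
- exact: measurable_enormc.
- by move=> x _; rewrite lee_fin normc_ge0.
- exact: measurable_enormc.
Qed.

Lemma cintbleZ (a : R[i]) f : cintble f -> cintble (fun x => a * f x).
Proof.
move=> [mf foo]; split; first exact: cmeasZ.
under eq_integral do rewrite Normc.normcM EFinM.
rewrite ge0_integralZl//; first by rewrite lte_mul_pinfty ?lee_fin ?normc_ge0.
- exact: measurable_enormc.
- by move=> x _; rewrite lee_fin normc_ge0.
- by rewrite lee_fin normc_ge0.
Qed.

Lemma cintbleN f : cintble f -> cintble (fun x => - f x).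
Proof.
move=> /(cintbleZ (-1)); congr cintble; apply/funext => x.
by rewrite mulN1r.
Qed.

Lemma cintbleB f g : cintble f -> cintble g -> cintble (fun x => f x - g x).
Proof. by move=> fi gi; apply: cintbleD => //; exact: cintbleN. Qed.

Lemma cint0 : cint (cst 0) = 0.
Proof.
by rewrite !cintE; congr (_ +i* _); rewrite /Rintegral integral0.
Qed.

Lemma cintD f g : cintble f -> cintble g ->
  cint (fun x => f x + g x) = cint f + cint g.
Proof.
move=> fi gi; rewrite !cintE; congr (_ +i* _).
  rewrite -RintegralD//; try exact: cintble_Re.
  by apply: eq_Rintegral => x _; rewrite /= ReD.
rewrite -RintegralD//; try exact: cintble_Im.
by apply: eq_Rintegral => x _; rewrite /= ImD.
Qed.

Lemma cintZ (a : R[i]) f : cintble f -> cint (fun x => a * f x) = a * cint f.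
Proof.
move=> fi; have fRe := cintble_Re fi; have fIm := cintble_Im fi.
have E (b c : R) : Rintegral mu setT (fun x => b * (Re \o f) x + c * (Im \o f) x) =
    b * Rintegral mu setT (Re \o f) + c * Rintegral mu setT (Im \o f).
  rewrite RintegralD//.
  - by rewrite !RintegralZl.
  - by have := integrableZl measurableT b fRe.
  - by have := integrableZl measurableT c fIm.
rewrite [RHS]complex_eta ReM ImM !Re_cint !Im_cint -mulNr -E [_ + Im a * _]addrC -E [LHS]cintE.
congr (_ +i* _); apply: eq_Rintegral => x _ /=; first by rewrite ReM mulNr.
by rewrite ImM addrC.
Qed.

Lemma cintN f : cintble f -> cint (fun x => - f x) = - cint f.
Proof.
move=> fi; rewrite -mulN1r -cintZ//; apply: eq_cint => x.
by rewrite mulN1r.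
Qed.

Lemma cintB f g : cintble f -> cintble g ->
  cint (fun x => f x - g x) = cint f - cint g.
Proof. by move=> fi gi; rewrite cintD ?cintN//; exact: cintbleN. Qed.

Lemma cintble0 : cintble (fun=> 0).
Proof.
split; first exact: cmeas_cst.
by rewrite integral0_eq// => x _; rewrite Normc.normc0.
Qed.

Lemma cintble_sum I (r : seq I) (F : I -> T -> R[i]) :
  (forall i, cintble (F i)) -> cintble (fun x => \sum_(i <- r) F i x).
Proof.
move=> Fi; elim: r => [|i r ih].
  rewrite (_ : (fun _ => _) = (fun=> 0)); first exact: cintble0.
  by apply/funext => x; rewrite big_nil.
rewrite (_ : (fun _ => _) = (fun x => F i x + \sum_(j <- r) F j x)); first exact: cintbleD.
by apply/funext => x; rewrite big_cons.
Qed.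

Lemma cint_sum I (r : seq I) (F : I -> T -> R[i]) : (forall i, cintble (F i)) ->
  cint (fun x => \sum_(i <- r) F i x) = \sum_(i <- r) cint (F i).
Proof.
move=> Fi; elim: r => [|i r ih].
  rewrite big_nil -[RHS]cint0.
  by apply: eq_cint => x; rewrite big_nil.
rewrite big_cons -ih -cintD//; last exact: cintble_sum.
by apply: eq_cint => x; rewrite big_cons.
Qed.

Lemma cint_conj f : cintble f -> cint (fun x => (f x)^*%R) = (cint f)^*%R.
Proof.
move=> fi; rewrite [RHS]complex_eta Re_conj Im_conj Re_cint Im_cint.
rewrite -mulN1r -RintegralZl//; last exact: cintble_Im.
rewrite !cintE; congr (_ +i* _); apply: eq_Rintegral => x _ /=.
  by rewrite Re_conj.
by rewrite Im_conj mulN1r.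
Qed.

Lemma cintble_conj f : cintble f -> cintble (fun x => (f x)^*%R).
Proof.
move=> fi; apply: (le_cintble _ fi); first by apply: cmeas_conj; case: fi.
by move=> x; rewrite normc_conj.
Qed.

(* Rotating by the unimodular number conj(I)/|I|, where I is the integral. *)
Lemma cint_norm_le f : cintble f ->
  ((normc (cint f))%:E <= \int[mu]_x (normc (f x))%:E)%E.
Proof.
move=> fi; have [->|I0] := eqVneq (cint f) 0.
  by rewrite Normc.normc0 integral_ge0// => x _; rewrite lee_fin normc_ge0.
set c := (cint f)^*%R / (normc (cint f))%:C.
have nI0 : normc (cint f) != 0 by rewrite normc_eq0.
have c1 : normc c = 1.
  rewrite /c Normc.normcM Normc.normcV normc_conj normc_real ger0_norm ?normc_ge0//.
  by rewrite divff.
have cI : c * cint f = (normc (cint f))%:C.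
  rewrite /c mulrAC [_ * cint f]mulrC -sqr_normc normcE expr2 mulfK//.
  by apply: contra nI0 => /eqP[->].
have -> : normc (cint f) = Re (cint (fun x => c * f x)) by rewrite cintZ// cI.
have cfi := cintbleZ c fi.
have -> : (Re (cint (fun x => c * f x)))%:E =
    (\int[mu]_x (Re (c * f x))%:E)%E.
  rewrite Re_cint /Rintegral fineK//.
  by apply: integrable_fin_num => //; exact: cintble_Re.
apply: le_trans (_ : (\int[mu]_x `|(Re (c * f x))%:E| <= _)%E).
  apply: le_trans (lee_abs _) _.
  apply: le_abse_integral => //.
  by have /integrableP[] := cintble_Re cfi.
apply: ge0_le_integral => //.
- by apply: measurableT_comp => //; have /integrableP[] := cintble_Re cfi.
- by apply: measurable_enormc; case: fi.
- move=> x _; rewrite /= lee_fin; apply: le_trans (Re_le_normc _) _.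
  by rewrite Normc.normcM c1 mul1r.
Qed.

Lemma cint_norm_le_fin f (B : R) : cintble f ->
  (\int[mu]_x (normc (f x))%:E <= B%:E)%E -> normc (cint f) <= B.
Proof. by move=> fi fB; rewrite -lee_fin; exact: le_trans (cint_norm_le fi) _. Qed.

End one.

Section fubini.
Context d1 d2 (T1 : measurableType d1) (T2 : measurableType d2).
Variables (m1 : {sigma_finite_measure set T1 -> \bar R})
          (m2 : {sigma_finite_measure set T2 -> \bar R}).
Variable f : T1 * T2 -> R[i].
Hypothesis fi : cintble (m1 \x m2)%E f.

Let mRe : (m1 \x m2)%E.-integrable setT (EFin \o (Re \o f)).
Proof. exact: cintble_Re. Qed.
Let mIm : (m1 \x m2)%E.-integrable setT (EFin \o (Im \o f)).
Proof. exact: cintble_Im. Qed.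

(** [Rintegral] takes [fine] of the inner integral, which is known to be finite only almost
    everywhere. On the exceptional null set [fine] may alter the value, without effect on the outer
    integral. *)
Let fine_F (h : T1 * T2 -> R) (hi : (m1 \x m2)%E.-integrable setT (EFin \o h)) :
  measurable_fun setT (fun x => Rintegral m2 setT (fun y => h (x, y))) /\
  (\int[m1]_x (Rintegral m2 setT (fun y => h (x, y)))%:E =
   \int[m1 \x m2]_z (h z)%:E)%E.
Proof.
have mF : measurable_fun setT (fun x => \int[m2]_y (h (x, y))%:E)%E.
  exact: (measurable_fubini_F hi).
split; first by apply: (measurableT_comp _ mF).
rewrite -(integral12_prod_meas1 hi); apply: ae_eq_integral => //.
- by apply/measurable_EFinP; exact: (measurableT_comp _ mF).
- apply: filterS (ae_integrable1 hi) => x xi _.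
  by rewrite /Rintegral fineK//; exact: integrable_fin_num xi.
Qed.

Let fine_G (h : T1 * T2 -> R) (hi : (m1 \x m2)%E.-integrable setT (EFin \o h)) :
  measurable_fun setT (fun y => Rintegral m1 setT (fun x => h (x, y))) /\
  (\int[m2]_y (Rintegral m1 setT (fun x => h (x, y)))%:E =
   \int[m1 \x m2]_z (h z)%:E)%E.
Proof.
have mG : measurable_fun setT (fun y => \int[m1]_x (h (x, y))%:E)%E.
  exact: (measurable_fubini_G hi).
split; first by apply: (measurableT_comp _ mG).
rewrite -(integral21_prod_meas1 hi); apply: ae_eq_integral => //.
- by apply/measurable_EFinP; exact: (measurableT_comp _ mG).
- apply: filterS (ae_integrable2 hi) => x xi _.
  by rewrite /Rintegral fineK//; exact: integrable_fin_num xi.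
Qed.

Lemma cmeas_cint2 : cmeas (fun y => cint m1 (fun x => f (x, y))).
Proof.
split; rewrite /comp; first by under eq_fun do rewrite Re_cint; exact: (fine_G mRe).1.
by under eq_fun do rewrite Im_cint; exact: (fine_G mIm).1.
Qed.

Lemma cint_fubini1 : cint m1 (fun x => cint m2 (fun y => f (x, y))) = cint (m1 \x m2)%E f.
Proof.
rewrite [LHS]cintE [RHS]cintE; congr (_ +i* _); rewrite /Rintegral; congr fine.
  by rewrite -(fine_F mRe).2; apply: eq_integral => x _; rewrite /= Re_cint.
by rewrite -(fine_F mIm).2; apply: eq_integral => x _; rewrite /= Im_cint.
Qed.

Lemma cint_fubini2 : cint m2 (fun y => cint m1 (fun x => f (x, y))) = cint (m1 \x m2)%E f.
Proof.
rewrite [LHS]cintE [RHS]cintE; congr (_ +i* _); rewrite /Rintegral; congr fine.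
  by rewrite -(fine_G mRe).2; apply: eq_integral => x _; rewrite /= Re_cint.
by rewrite -(fine_G mIm).2; apply: eq_integral => x _; rewrite /= Im_cint.
Qed.

Lemma cint_fubini : cint m1 (fun x => cint m2 (fun y => f (x, y))) =
  cint m2 (fun y => cint m1 (fun x => f (x, y))).
Proof. by rewrite cint_fubini1 cint_fubini2. Qed.

End fubini.

Lemma cintble_prod d1 d2 (T1 : measurableType d1) (T2 : measurableType d2)
  (m1 : {sigma_finite_measure set T1 -> \bar R})
  (m2 : {sigma_finite_measure set T2 -> \bar R}) (f : T1 * T2 -> R[i]) :
  cmeas f -> (\int[m1]_x \int[m2]_y (normc (f (x, y)))%:E < +oo)%E ->
  cintble (m1 \x m2)%E f.
Proof.
move=> mf foo; split => //.
rewrite (@fubini_tonelli1 _ _ _ _ _ m1 m2 (fun z => (normc (f z))%:E))//.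
- exact: measurable_enormc.
- by move=> x; rewrite lee_fin normc_ge0.
Qed.

Lemma cintble_prod2 d1 d2 (T1 : measurableType d1) (T2 : measurableType d2)
  (m1 : {sigma_finite_measure set T1 -> \bar R})
  (m2 : {sigma_finite_measure set T2 -> \bar R}) (f : T1 * T2 -> R[i]) :
  cmeas f -> (\int[m2]_y \int[m1]_x (normc (f (x, y)))%:E < +oo)%E ->
  cintble (m1 \x m2)%E f.
Proof.
move=> mf foo; split => //.
rewrite (@fubini_tonelli2 _ _ _ _ _ m1 m2 (fun z => (normc (f z))%:E))//.
- exact: measurable_enormc.
- by move=> x; rewrite lee_fin normc_ge0.
Qed.

End ComplexIntegral.

(** * Cauchy's theorem on squares and the mean value on circles *)

Section Goursat.
Variable R : realType.
Local Notation mu := (@lebesgue_measure R).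

Section square_additive.
Variable J : R -> R -> R -> R[i].
Hypothesis Jadd : forall a c l, 0 < l ->
  J a c (l + l) = J a c l + J (a + l) c l + J a (c + l) l + J (a + l) (c + l) l.
Hypothesis Jsmall : forall a0 c0 e, 0 < e -> exists2 d, 0 < d &
  forall a c l, 0 < l < d -> a <= a0 <= a + l -> c <= c0 <= c + l ->
    normc (J a c l) <= e * l ^+ 2.

(** The booleans select the right half and the upper half of the square. *)
Let quarter a c l : 0 < l -> exists s : bool * bool,
  normc (J a c l) / 4 <= normc (J (if s.1 then a + l / 2 else a)
                                 (if s.2 then c + l / 2 else c) (l / 2)).
Proof.
move=> l0; have l20 : 0 < l / 2 by rewrite divr_gt0.
have := @Jadd a c _ l20; rewrite -splitr => E.
apply: contrapT => /forallNP h.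
have h1 := h (false, false); have h2 := h (true, false).
have h3 := h (false, true); have h4 := h (true, true).
move: h1 h2 h3 h4 => /= /negP + /negP + /negP + /negP; rewrite -!ltNge => h1 h2 h3 h4.
have : normc (J a c l) < normc (J a c l).
  rewrite {1}E; apply: le_lt_trans (le_normcD _ _) _.
  have := le_normcD (J a c (l / 2) + J (a + l / 2) c (l / 2)) (J a (c + l / 2) (l / 2)).
  have := le_normcD (J a c (l / 2)) (J (a + l / 2) c (l / 2)).
  set n1 := normc (J a c (l/2)) in h1 *; set n2 := normc (J (a + _) c _) in h2 *.
  set n3 := normc (J a (c + _) _) in h3 *; set n4 := normc (J (a + _) (c + _) _) in h4 *.
  move=> ? ?; lra.
by rewrite ltxx.
Qed.

(** Goursat's argument, with [J a c l] a quantity attached to the square of side l and lower left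
    corner (a, c). Some quarter carries at least a quarter of the value, so |J| / side^2 does not
    decrease along nested squares; near their common point [Jsmall] makes the same ratio arbitrarily
    small. *)
Lemma square_additive_eq0 a c l : 0 < l -> J a c l = 0.
Proof.
move=> l0; apply/eqP/negPn/negP; rewrite -normc_eq0 => N0.
have {}N0 : 0 < normc (J a c l) by rewrite lt_neqAle eq_sym N0 normc_ge0.
have L0 k : 0 < l / 2 ^+ k by rewrite divr_gt0// exprn_gt0.
have LS k : l / 2 ^+ k.+1 = l / 2 ^+ k / 2 by rewrite exprS invfM mulrCA mulrC -mulrA.
have /choice[step stepP] : forall x : R * R * nat, exists s : bool * bool,
    normc (J x.1.1 x.1.2 (l / 2 ^+ x.2)) / 4 <=
    normc (J (if s.1 then x.1.1 + l / 2 ^+ x.2 / 2 else x.1.1)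
             (if s.2 then x.1.2 + l / 2 ^+ x.2 / 2 else x.1.2) (l / 2 ^+ x.2 / 2)).
  by move=> x; exact: quarter.
(* Lower left corners of the nested squares; after k steps the side is l / 2^k. *)
pose fix s (k : nat) : R * R := match k with
  | 0 => (a, c)
  | k'.+1 => let x := (s k', k') in
     (if (step x).1 then x.1.1 + l / 2 ^+ k' / 2 else x.1.1,
      if (step x).2 then x.1.2 + l / 2 ^+ k' / 2 else x.1.2) end.
have sJ k : normc (J a c l) / l ^+ 2 * (l / 2 ^+ k) ^+ 2 <=
            normc (J (s k).1 (s k).2 (l / 2 ^+ k)).
  elim: k => [|k ih] /=.
    by rewrite expr0 divr1 mulfVK// expf_neq0// gt_eqF.
  have := stepP (s k, k); rewrite /= -LS; apply: le_trans.
  rewrite LS expr_div_n mulrA [2 ^+ 2]expr2 (_ : 2 * 2 = 4 :> R); last by lra.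
  by rewrite ler_pM2r// invr_gt0.
have s1 k : (s k).1 <= (s k.+1).1 /\ (s k.+1).1 + l / 2 ^+ k.+1 <= (s k).1 + l / 2 ^+ k.
  by rewrite LS /=; have := L0 k; case: ifP => _ ?; split; lra.
have s2 k : (s k).2 <= (s k.+1).2 /\ (s k.+1).2 + l / 2 ^+ k.+1 <= (s k).2 + l / 2 ^+ k.
  by rewrite LS /=; have := L0 k; case: ifP => _ ?; split; lra.
(* One coordinate at a time: left ends increase, right ends decrease, and the supremum of the left
   ends lies in every interval. *)
have nested (u : nat -> R) : (forall k, u k <= u k.+1 /\
    u k.+1 + l / 2 ^+ k.+1 <= u k + l / 2 ^+ k) ->
    exists x, forall k, u k <= x <= u k + l / 2 ^+ k.
  move=> uP.
  have nd : {homo u : m n / (m <= n)%N >-> m <= n}.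
    by apply: homo_leq => // [x y z xy yz|k]; [exact: le_trans yz|case: (uP k)].
  have ni k m : u (k + m)%N + l / 2 ^+ (k + m) <= u k + l / 2 ^+ k.
    elim: m => [|m ih]; first by rewrite addn0.
    by rewrite addnS; apply: le_trans ih; case: (uP (k + m)%N).
  have ub k m : u m <= u k + l / 2 ^+ k.
    have [km|/ltnW mk] := leqP k m.
      by have := ni k (m - k)%N; rewrite subnKC//; have := L0 m => ? ?; lra.
    by apply: (le_trans (nd _ _ mk)); rewrite lerDl ltW.
  exists (sup (range u)) => k; apply/andP; split.
    apply: ub_le_sup; last by exists k.
    by exists (u 0%N + l / 2 ^+ 0) => _ [m _ <-]; exact: ub.
  apply: ge_sup; first by exists (u 0%N); exists 0%N.
  by move=> _ [m _ <-]; exact: ub.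
have [a0 a0P] := nested (fun k => (s k).1) s1.
have [c0 c0P] := nested (fun k => (s k).2) s2.
(* Half of the ratio that [sJ] propagates to all the nested squares, hence the contradiction. *)
have e0 : 0 < normc (J a c l) / l ^+ 2 / 2 by rewrite !divr_gt0// exprn_gt0.
have [d d0 dP] := Jsmall a0 c0 e0.
have [k kd] : exists k, l / 2 ^+ k < d.
  have /cvgrPdist_lt/(_ _ d0) : (l * 2^-1 ^+ k @[k --> \oo] --> (0 : R)).
    rewrite -[X in _ --> X](mulr0 l); apply: cvgMl_tmp; apply: cvg_expr.
    by rewrite ger0_norm ?invf_lt1 ?ltr1n// invr_ge0.
  move=> [k _ /(_ k (leqnn k))] /=; rewrite sub0r normrN ger0_norm.
    by rewrite exprVn => ?; exists k.
  by rewrite mulr_ge0 ?exprn_ge0 ?invr_ge0// ltW.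
have := dP (s k).1 (s k).2 (l / 2 ^+ k); rewrite L0 kd a0P c0P => /(_ isT isT isT).
move/(le_trans (sJ k)); rewrite -subr_ge0 -mulrBl => h.
have l2 : 0 < (l / 2 ^+ k) ^+ 2 by rewrite exprn_gt0.
by move: h; rewrite pmulr_lge0//; lra.
Qed.

End square_additive.

Section interval_integral.
Implicit Types (g : R -> R[i]) (a b c : R).

Definition ccont g := continuous (Re \o g) /\ continuous (Im \o g).

(** With half-open intervals the indicators of adjacent intervals add up exactly, which makes
    [itvint_split] a pointwise identity. *)
Definition itvint a b g : R[i] :=
  cint mu (fun x => (\1_(`[a, b[%classic) x : R)%:C * g x).

Lemma ccont_cmeas g : ccont g -> @cmeas R _ (measurableTypeR R) g.
Proof. by move=> [? ?]; split; exact: continuous_measurable_fun. Qed.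

Lemma ccont_bounded g a b : ccont g -> exists M, forall x, a <= x <= b -> normc (g x) <= M.
Proof.
move=> [cRe cIm].
have bnd (h : R -> R) : continuous h -> exists M, forall x, a <= x <= b -> `|h x| <= M.
  move=> ch; have [ab|ba] := leP a b; last first.
    by exists 0 => x /andP[ax xb]; have := le_lt_trans (le_trans ax xb) ba; rewrite ltxx.
  have cn : {within `[a, b], continuous (fun x => `|h x|)}.
    apply: continuous_subspaceT => x; apply: continuous_comp; first exact: ch.
    exact: norm_continuous.
  have [c _ cP] := EVT_max ab cn; exists `|h c| => x xab.
  by apply: cP; rewrite in_itv.
have [M1 M1P] := bnd _ cRe; have [M2 M2P] := bnd _ cIm.
exists (M1 + M2) => x xab; apply: le_trans (normc_leD _) _.
by apply: lerD; [exact: M1P|exact: M2P].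
Qed.

Let cmeas_itv g a b : ccont g ->
  @cmeas R _ (measurableTypeR R) (fun x => (\1_(`[a, b[%classic) x : R)%:C * g x).
Proof.
move=> cg; apply: cmeasM; last exact: ccont_cmeas.
by apply: cmeas_real; exact: measurable_indic.
Qed.

Let normc_itv g a b (B : R) x : 0 <= B -> (forall x, a <= x < b -> normc (g x) <= B) ->
  normc ((\1_(`[a, b[%classic) x : R)%:C * g x) <= B * \1_(`[a, b[%classic) x.
Proof.
move=> B0 gB; rewrite Normc.normcM normc_real indicE.
have [/set_mem /= xab|_] := boolP (x \in _).
  by rewrite normr1 mul1r mulr1; apply: gB; move: xab; rewrite in_itv.
by rewrite normr0 mul0r mulr0.
Qed.

Let integral_itv a b (B : R) : a <= b -> 0 <= B ->
  (\int[mu]_x (B * \1_(`[a, b[%classic) x)%:E = (B * (b - a))%:E)%E.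
Proof.
move=> ab B0; under eq_integral do rewrite EFinM.
rewrite ge0_integralZl//.
- rewrite integral_indic// setIT.
  rewrite [X in (_ * X)%E](_ : _ = (if a%:E < b%:E then b%:E - a%:E else 0)%E); last first.
    exact: lebesgue_measure_itv.
  rewrite lte_fin.
  case: ltP => [_|ba]; first by rewrite EFinM EFinB.
  by rewrite mule0 (_ : b - a = 0) ?mulr0//; apply/eqP; rewrite subr_eq0 eq_le ab ba.
- by apply/measurable_EFinP; exact: measurable_indic.
Qed.

Lemma cintble_itv g a b : a <= b -> ccont g ->
  cintble mu (fun x => (\1_(`[a, b[%classic) x : R)%:C * g x).
Proof.
move=> ab cg; split; first exact: cmeas_itv.
have [M MP] := ccont_bounded a b cg.
have M0 : 0 <= Num.max M 0 by rewrite le_max lexx orbT.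
apply: (@le_lt_trans _ _ (\int[mu]_x (Num.max M 0 * \1_(`[a, b[%classic) x)%:E)%E).
  apply: ge0_le_integral => //.
  - by move=> x _; rewrite lee_fin normc_ge0.
  - by apply: measurable_enormc; exact: cmeas_itv.
  - by apply/measurable_EFinP; apply: measurable_funM => //; exact: measurable_indic.
  - move=> x _; rewrite lee_fin; apply: normc_itv => // y /andP[ay yb].
    by rewrite le_max MP// ay ltW.
by rewrite integral_itv// ltry.
Qed.

Lemma itvint_le g a b (B : R) : a <= b -> ccont g -> 0 <= B ->
  (forall x, a <= x < b -> normc (g x) <= B) -> normc (itvint a b g) <= B * (b - a).
Proof.
move=> ab cg B0 gB; apply: cint_norm_le_fin; first exact: cintble_itv.
rewrite -integral_itv//; apply: ge0_le_integral => //.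
- by move=> x _; rewrite lee_fin normc_ge0.
- by apply: measurable_enormc; exact: cmeas_itv.
- by apply/measurable_EFinP; apply: measurable_funM => //; exact: measurable_indic.
- by move=> x _; rewrite lee_fin; exact: normc_itv.
Qed.

Lemma itvint_cst (k : R[i]) a b : a <= b -> itvint a b (cst k) = (b - a)%:C * k.
Proof.
move=> ab; rewrite /itvint mulrC.
under eq_cint do rewrite mulrC.
have ci : cintble mu (fun x => (\1_(`[a, b[%classic) x : R)%:C).
  have : cintble mu (fun x => (\1_(`[a, b[%classic) x : R)%:C * cst 1 x).
    by apply: cintble_itv => //; split; exact: cst_continuous.
  by congr cintble; apply/funext => x; rewrite mulr1.
rewrite cintZ//; congr (_ * _).
rewrite cintE /comp /= /Rintegral integral0 /=; congr (_ +i* _).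
have := @integral_itv a b 1 ab ler01.
by under eq_integral do rewrite mul1r; move=> ->; rewrite /= mul1r.
Qed.

Lemma itvintB g h a b : a <= b -> ccont g -> ccont h ->
  itvint a b (fun x => g x - h x) = itvint a b g - itvint a b h.
Proof.
move=> ab cg ch; rewrite /itvint -cintB; try exact: cintble_itv.
by apply: eq_cint => x; rewrite mulrBr.
Qed.

Lemma itvint_split g a b c : a <= b -> b <= c -> ccont g ->
  itvint a c g = itvint a b g + itvint b c g.
Proof.
move=> ab bc cg; rewrite /itvint -cintD; try exact: cintble_itv.
apply: eq_cint => x; rewrite -mulrDl -rmorphD; congr (_%:C * _).
rewrite !indicE !mem_setE !in_itv /=.
by have [xa|ax] := leP a x; have [xb|bx] := ltP x b; have [xc|cx] := ltP x c;
  rewrite /= ?addr0 ?add0r//; lra.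
Qed.

Lemma ccontB g h : ccont g -> ccont h -> ccont (fun x => g x - h x).
Proof.
move=> [gR gI] [hR hI]; split.
  rewrite (_ : _ \o _ = (Re \o g) \- (Re \o h)); last by apply/funext => x /=; rewrite ReB.
  by move=> x; apply: cvgB; [exact: gR|exact: hR].
rewrite (_ : _ \o _ = (Im \o g) \- (Im \o h)); last by apply/funext => x /=; rewrite ImB.
by move=> x; apply: cvgB; [exact: gI|exact: hI].
Qed.

Lemma ccontP g : (forall x e, 0 < e -> exists2 d, 0 < d &
  forall y, `|y - x| < d -> normc (g y - g x) < e) -> ccont g.
Proof.
move=> h; split => x; apply/cvgrPdist_lt => e e0; have [d d0 dP] := h x e e0;
  near=> y => /=; rewrite distrC -?ReB -?ImB;
  [apply: le_lt_trans (Re_le_normc _) _|apply: le_lt_trans (Im_le_normc _) _];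
  apply: dP; rewrite distrC; near: y; exact: cvgr_dist_lt.
Unshelve. all: by end_near. Qed.

End interval_integral.

End Goursat.

(** * Complex differentiability in one variable and the exponential *)

Section HolomorphicOneVariable.
Variable R : realType.
Implicit Types (z w h : R[i]).

(** Over the scalar field R[i] the norms and the radii of balls are themselves complex numbers; this
    lemma and [ltc_normc] bring them back to real ones. *)
Lemma gt0_complexE (e : R[i]) : 0 < e -> e = (Re e)%:C /\ 0 < Re e.
Proof. by rewrite ltcE /= => /andP[/eqP ie re]; split => //; rewrite [LHS]complex_eta ie. Qed.

Lemma ltc_normc z (d : R) : (`|z| < d%:C) = (normc z < d).
Proof. by rewrite normcE ltcR. Qed.

Lemma near_complexP (P : set R[i]) z :
  (\forall w \near z, P w) <->
  exists2 d : R, 0 < d & forall w, normc (w - z) < d -> P w.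
Proof.
split.
  rewrite -nbhs_nearE => /nbhs_normP[d /= /gt0_complexE[dE d0]] dP; exists (Re d) => // w wz.
  by apply: dP; rewrite /= dE ltc_normc -normcN opprB.
move=> [d d0 dP]; rewrite -nbhs_nearE; apply/nbhs_normP.
exists d%:C => /=; first by rewrite ltcR.
by move=> w /=; rewrite ltc_normc => zw; apply: dP; rewrite -normcN opprB.
Qed.

(** Anchored at 0 and valid for both signs of [b]: each Taylor bound below follows by applying it to
    a function whose derivative is already bounded. *)
Lemma MVT0 (f df : R -> R) (b : R) : (forall x : R, is_derive x (1 : R) f (df x)) ->
  exists2 c, `|c| <= `|b| & f b - f 0 = df c * b.
Proof.
move=> fdf.
have cf : continuous f.
  by move=> x; apply/differentiable_continuous/derivable1_diffP; exact: ex_derive.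
have [b0|b0] := leP 0 b.
  have [c cb fE] := @MVT_segment _ f df 0 b b0 (fun x _ => fdf x) (continuous_subspaceT cf).
  move: cb fE; rewrite in_itv /= subr0 => /andP[c0 cb] fE.
  by exists c; rewrite ?ger0_norm.
have [c cb fE] := @MVT_segment _ f df b 0 (ltW b0) (fun x _ => fdf x) (continuous_subspaceT cf).
move: cb fE; rewrite in_itv /= sub0r => /andP[c0 cb] fE.
exists c; first by rewrite !ler0_norm ?lerN2// ltW.
by apply: oppr_inj; rewrite opprB fE mulrN.
Qed.

Lemma expR_sub1_le (a : R) : `|expR a - 1| <= `|a| * expR `|a|.
Proof.
have [c ca] := @MVT0 (@expR R) (@expR R) a (fun x => is_derive_expR x).
rewrite expR0 => ->; rewrite normrM mulrC ler_wpM2l//.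
by rewrite ger0_norm ?expR_ge0// ler_expR (le_trans (ler_norm _)).
Qed.

Lemma expR_sub2_le (a : R) : `|expR a - 1 - a| <= a ^+ 2 * expR `|a|.
Proof.
pose f (x : R) := expR x - x.
have fd (x : R) : is_derive x (1 : R) f (expR x - 1) by rewrite /f; apply: is_deriveB.
have [c ca] := @MVT0 f _ a fd.
rewrite /f expR0 subr0 => E.
rewrite addrAC E normrM -[a ^+ 2]real_normK ?num_real// expr2 mulrAC ler_wpM2r//.
by apply: le_trans (expR_sub1_le c) _; rewrite ler_pM ?ler_expR// expR_ge0.
Qed.

Lemma sin_le (b : R) : `|sin b| <= `|b|.
Proof.
have [c cb] := @MVT0 (@sin R) (@cos R) b (fun x => is_derive_sin x).
rewrite sin0 subr0 => ->; rewrite normrM ler_piMl// ler_norml cos_geN1 cos_le1//.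
Qed.

Lemma cos_sub1_le (b : R) : `|cos b - 1| <= b ^+ 2.
Proof.
have [c cb] := @MVT0 (@cos R) (fun x => - sin x) b (fun x => is_derive_cos x).
rewrite cos0 => ->; rewrite normrM normrN -[leRHS]real_normK ?num_real// expr2.
by rewrite ler_wpM2r//; exact: le_trans (sin_le _) cb.
Qed.

Lemma cos_sub1_le1 (b : R) : `|cos b - 1| <= `|b|.
Proof.
have [c cb] := @MVT0 (@cos R) (fun x => - sin x) b (fun x => is_derive_cos x).
rewrite cos0 => ->; rewrite normrM normrN ler_piMl// ler_norml sin_geN1 sin_le1//.
Qed.

Lemma sin_sub_le (b : R) : `|sin b - b| <= b ^+ 2.
Proof.
pose f (x : R) := sin x - x.
have fd (x : R) : is_derive x (1 : R) f (cos x - 1) by rewrite /f; apply: is_deriveB.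
have [c cb] := @MVT0 f _ b fd.
rewrite /f sin0 !subr0 => ->; rewrite normrM -[leRHS]real_normK ?num_real// expr2.
by rewrite ler_wpM2r//; exact: le_trans (cos_sub1_le1 _) cb.
Qed.

(** For h = a + ib the real part is (e^a - 1 - a) + e^a (cos b - 1) and the imaginary part is (sin b
    - b) + (e^a - 1) sin b. Each of these four terms is at most |h|^2 e^|h|. *)
Lemma cexp_sub2_le h : normc (cexp h - 1 - h) <= 4 * normc h ^+ 2 * expR (normc h).
Proof.
case: h => a b; set N := normc (a +i* b).
have aN : `|a| <= N by exact: Re_le_normc (a +i* b).
have bN : `|b| <= N by exact: Im_le_normc (a +i* b).
have N0 : 0 <= N by exact: normc_ge0.
have E1 : 1 <= expR N by rewrite -expR0 ler_expR.
have ea : expR a <= expR N by rewrite ler_expR (le_trans (ler_norm _)).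
have ea' : expR `|a| <= expR N by rewrite ler_expR.
have a2 : a ^+ 2 <= N ^+ 2 by rewrite -[a ^+ 2]real_normK ?num_real// lerXn2r// nnegrE.
have b2 : b ^+ 2 <= N ^+ 2 by rewrite -[b ^+ 2]real_normK ?num_real// lerXn2r// nnegrE.
have H1 : `|expR a - 1 - a| <= N ^+ 2 * expR N.
  by apply: le_trans (expR_sub2_le a) _; rewrite ler_pM ?sqr_ge0 ?expR_ge0.
have H2 : `|cos b - 1| <= N ^+ 2 by exact: le_trans (cos_sub1_le b) b2.
have H3 : `|sin b - b| <= N ^+ 2 by exact: le_trans (sin_sub_le b) b2.
have H4 : `|expR a - 1| <= N * expR N.
  by apply: le_trans (expR_sub1_le a) _; rewrite ler_pM ?expR_ge0.
have H5 : `|sin b| <= N by exact: le_trans (sin_le b) bN.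
have N2 : N ^+ 2 <= N ^+ 2 * expR N by rewrite ler_peMr// sqr_ge0.
have P1 : `|Re (cexp (a +i* b) - 1 - (a +i* b))| <= 2 * (N ^+ 2 * expR N).
  rewrite !ReB ReE_cexp /=.
  rewrite (_ : _ - _ = (expR a - 1 - a) + expR a * (cos b - 1)); last by ring.
  apply: le_trans (ler_normD _ _) _.
  rewrite mulr_natl mulr2n lerD// normrM mulrC ler_pM//.
  by rewrite ger0_norm ?expR_ge0.
have P2 : `|Im (cexp (a +i* b) - 1 - (a +i* b))| <= 2 * (N ^+ 2 * expR N).
  rewrite !ImB ImE_cexp /= subr0.
  rewrite (_ : _ - _ = (sin b - b) + (expR a - 1) * sin b); last by ring.
  apply: le_trans (ler_normD _ _) _.
  rewrite mulr_natl mulr2n lerD//; first exact: le_trans N2.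
  by rewrite normrM expr2 mulrAC ler_pM.
by apply: le_trans (normc_leD _) _; have := lerD P1 P2; rewrite -mulrDl -mulrA -natrD.
Qed.

Lemma cexp_shift_le z h : normc (cexp (z + h) - cexp z - cexp z * h) <=
  normc (cexp z) * (4 * normc h ^+ 2 * expR (normc h)).
Proof.
rewrite cexpD (_ : _ - _ - _ = cexp z * (cexp h - 1 - h)); last by ring.
by rewrite Normc.normcM ler_wpM2l ?normc_ge0// cexp_sub2_le.
Qed.

Section quadratic.
Variable V : normedModType R[i].

(** The quadratic bound makes f a little-o of the increment, so the zero map is its differential at
    x. Other functions are handled by subtracting their affine part first. *)
Lemma differentiable_quadratic (f : V -> R[i]) (x : V) (C : R) : f x = 0 ->
  (forall h : V, `|h| <= 1 -> normc (f (h + x)) <= C * Re `|h| ^+ 2) ->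
  differentiable f x.
Proof.
move=> fx0 fC.
have fo : f \o shift x = cst (f x) + (\0 : V -> R[i]) +o_ (0 : V) id.
  apply/eqaddoP => _/posnumP[e] /=.
  have [eE e0] := gt0_complexE (gt0 e).
  (* [C] may be nonpositive; its replacement [C'] can be divided by. *)
  set e' := Re e%:num in e0; set C' := Num.max C 1.
  have C'0 : 0 < C' by rewrite lt_max ltr01 orbT.
  have d0 : 0 < (Num.min 1 (e' / C'))%:C :> R[i] by rewrite ltcR lt_min ltr01 divr_gt0.
  near=> h.
  rewrite fx0 /cst /= [X in `|X|](_ : _ = f (h + x)); last first.
    by rewrite -![(_ + _ : _ -> _) _]/(_ + _) /= -[X in _ - X]/(0 + 0) addr0 subr0.
  have hd : `|h| < (Num.min 1 (e' / C'))%:C.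
    by near: h; exact: nbhs0_lt.
  have [hr hE] : exists r : R, 0 <= r /\ `|h| = r%:C.
    have : 0 <= `|h| by []. rewrite lecE /= => /andP[/eqP ih rh].
    by exists (Re `|h|); split => //; rewrite [LHS]complex_eta ih.
  move: hE => [hr0 hE].
  move: hd; rewrite hE ltcR lt_min => /andP[h1 h2].
  have := fC h; rewrite hE lecR (ltW h1) => /(_ isT) /= fh.
  rewrite normcE eE -rmorphM lecR; apply: le_trans fh _.
  apply: (@le_trans _ _ (C' * hr ^+ 2)).
    by rewrite ler_wpM2r ?sqr_ge0// le_max lexx.
  rewrite expr2 mulrA ler_wpM2r//.
  by move: h2; rewrite ltr_pdivlMr// => /ltW; rewrite mulrC.
have c0 : continuous (\0 : V -> R[i]) by exact: cst_continuous.
have d0 := diff_unique c0 fo.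
by apply/diff_locallyP; rewrite d0.
Unshelve. all: by end_near. Qed.

End quadratic.

Lemma differentiable_cexp z : differentiable (@cexp R) z.
Proof.
pose f w := cexp w - (cexp z + cexp z * (w - z)).
have -> : @cexp R = f + (fun w => cexp z + cexp z * (w - z)).
  by apply/funext => w; rewrite -[RHS]/(f w + _) /f subrK.
apply: differentiableD; last first.
  apply: differentiableD; first exact: differentiable_cst.
  apply: differentiableM; first exact: differentiable_cst.
  by apply: differentiableB; [exact: ex_diff|exact: differentiable_cst].
apply: (@differentiable_quadratic _ _ _ (normc (cexp z) * (4 * expR 1))).
  by rewrite /f subrr mulr0 addr0 subrr.
move=> h; rewrite normcE -[1]/(1%:C) lecR => h1.
have -> : f (h + z) = cexp (z + h) - cexp z - cexp z * h.
  by rewrite /f [h + z]addrC [z + h]addrC addrK opprD addrA.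
apply: le_trans (cexp_shift_le _ _) _.
rewrite -[leRHS]mulrA; apply: ler_wpM2l; first exact: normc_ge0.
have E : expR (normc h) <= expR 1 by rewrite ler_expR.
have := ler_wpM2l (sqr_ge0 (normc h)) E; rewrite [Re _]/(normc h).
by move: (expR _) (expR 1) (_ ^+ 2) => u v w; lra.
Qed.

Lemma differentiable_epsP (f : R[i] -> R[i]) z : differentiable f z ->
  exists D, forall e, 0 < e -> exists2 d, 0 < d & forall w, normc (w - z) < d ->
    normc (f w - f z - D * (w - z)) <= e * normc (w - z).
Proof.
move=> /derivable1_diffP /derivable_nbhs df; exists ('D_1 f z) => e e0.
move: df => /eqaddoP/(_ e%:C); rewrite ltcR => /(_ e0)/near_complexP[d d0 dP].
exists d => // w wz; have := dP (w - z); rewrite subr0 => /(_ wz).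
rewrite -![(_ + _ : _ -> _) _]/(_ + _) -![(- _ : _ -> _) _]/(- _) /= -![(_ + _ : _ -> _) _]/(_ + _) /cst /=.
rewrite !normcE -rmorphM lecR [_ *: 1]mulr1 subrK opprD addrA.
by rewrite [_ *: _]mulrC.
Qed.

End HolomorphicOneVariable.

(** * Contour integrals over squares and means over circles *)

Section CircleMean.
Variable R : realType.

Section goursat.
Variable G : R -> R -> R[i].
Hypothesis Gdiff : forall s0 t0, exists D, forall e, 0 < e -> exists2 d, 0 < d &
  forall s t, `|s - s0| < d -> `|t - t0| < d ->
    normc (G s t - G s0 t0 - D * ((s - s0) +i* (t - t0))) <= e * (`|s - s0| + `|t - t0|).

Let normc_cart (a b : R) : normc (a +i* b) <= `|a| + `|b|.
Proof. exact: (normc_leD (a +i* b)). Qed.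

Let Gcont s0 t0 e : 0 < e -> exists2 d, 0 < d &
  forall s t, `|s - s0| < d -> `|t - t0| < d -> normc (G s t - G s0 t0) < e.
Proof.
move=> e0; have [D DP] := Gdiff s0 t0; have [d d0 dP] := DP 1 ltr01.
have N0 := normc_ge0 D; set N := normc D in N0.
exists (Num.min d (e / (2 * (N + 1)) / 2)).
  by rewrite lt_min d0 !divr_gt0// mulr_gt0// ltr_wpDl.
move=> s t; rewrite !lt_min => /andP[sd se] /andP[td te].
have := dP s t sd td; rewrite mul1r => h.
set x := `|s - s0| + `|t - t0| in h *.
have x1 : x < e / (2 * (N + 1)).
  by rewrite [ltRHS]splitr; apply: ltrD.
have hD : normc (D * ((s - s0) +i* (t - t0))) <= N * x.
  by rewrite Normc.normcM ler_wpM2l// normc_cart.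
apply: (@le_lt_trans _ _ ((N + 1) * x)).
  apply: le_trans (le_normc_sub _ (D * ((s - s0) +i* (t - t0)))) _.
  by rewrite mulrDl mul1r lerD.
have N1 : 0 < N + 1 by rewrite ltr_wpDl.
rewrite -ltr_pdivlMl//; apply: lt_le_trans x1 _.
rewrite invfM; have : 0 <= (N + 1)^-1 by rewrite invr_ge0 ltW.
by move: (N + 1)^-1 => u u0; nra.
Qed.

Let cG1 s : ccont (G s).
Proof.
apply: ccontP => t e e0; have [d d0 dP] := Gcont s t e0.
by exists d => // t' ?; apply: dP => //; rewrite subrr normr0.
Qed.

Let cG2 t : ccont (G ^~ t).
Proof.
apply: ccontP => s e e0; have [d d0 dP] := Gcont s t e0.
by exists d => // s' ?; apply: dP => //; rewrite subrr normr0.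
Qed.

(** The counterclockwise integral of G(s + it) d(s + it) along the boundary of a square: the
    vertical edges contribute i dt, the horizontal ones ds. *)
Definition contour a c l : R[i] :=
  'i * (itvint c (c + l) (G (a + l)) - itvint c (c + l) (G a)) -
  (itvint a (a + l) (G ^~ (c + l)) - itvint a (a + l) (G ^~ c)).

Let contour_add a c l : 0 < l -> contour a c (l + l) =
  contour a c l + contour (a + l) c l + contour a (c + l) l + contour (a + l) (c + l) l.
Proof.
move=> l0; rewrite /contour !addrA.
have sp x g : ccont g ->
    itvint x (x + l + l) g = itvint x (x + l) g + itvint (x + l) (x + l + l) g.
  by move=> cg; apply: itvint_split => //; rewrite lerDl ltW.
rewrite !(sp c) // !(sp a)//.
by move: (itvint _ _ _) (itvint _ _ (G a)) => *; ring.
Qed.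

(** The affine part of G at (a0, c0) integrates to 0 along the boundary. On each of the four edges,
    of length l, the error is at most e/8 * 2l; the sum is e l^2. *)
Let contour_small a0 c0 e : 0 < e -> exists2 d, 0 < d &
  forall a c l, 0 < l < d -> a <= a0 <= a + l -> c <= c0 <= c + l ->
    normc (contour a c l) <= e * l ^+ 2.
Proof.
move=> e0; have [D DP] := Gdiff a0 c0.
have e8 : 0 < e / 8 by rewrite divr_gt0.
have [d d0 dP] := DP _ e8; exists d => // a c l /andP[l0 ld] /andP[aa a0l] /andP[cc c0l].
have cD (k : R[i]) : ccont (cst k) by split; exact: cst_continuous.
pose err s t := G s t - G a0 c0 - D * ((s - a0) +i* (t - c0)).
have errle s t : a <= s <= a + l -> c <= t <= c + l -> normc (err s t) <= e / 8 * (l + l).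
  move=> /andP[sa sl] /andP[tc tl].
  have h1 : `|s - a0| <= l by rewrite ler_norml; apply/andP; split; lra.
  have h2 : `|t - c0| <= l by rewrite ler_norml; apply/andP; split; lra.
  apply: le_trans (dP s t _ _) _; [exact: le_lt_trans ld|exact: le_lt_trans ld|].
  by apply: ler_wpM2l; [exact: ltW|exact: lerD].
have B0 : 0 <= e / 2 * l by rewrite mulr_ge0 ?divr_ge0 ?ltW.
(* Through this identity the linear parts of the vertical and of the horizontal edges cancel. *)
have il : 'i * (D * l%:C) = D * (0 +i* l) :> R[i].
  by rewrite mulrCA; congr (_ * _); apply/eqP; rewrite eq_complex /=; apply/andP; split; apply/eqP; ring.
have lc x : x <= x + l by rewrite lerDl ltW.
have V : normc (itvint c (c + l) (G (a + l)) - itvint c (c + l) (G a)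
    - l%:C * (D * l%:C)) <= e / 2 * l * l.
  have -> : l%:C * (D * l%:C) = itvint c (c + l) (cst (D * l%:C)) :> R[i].
    by rewrite itvint_cst// addrAC subrr add0r.
  rewrite -!itvintB//; last exact: ccontB.
  rewrite [e / 2 * l * l](_ : _ = e / 2 * l * (c + l - c)); last by rewrite [c + l]addrC addrK.
  apply: itvint_le => //.
  - by apply: ccontB => //; exact: ccontB.
  - move=> t /andP[ct tl]; rewrite (_ : _ - _ = err (a + l) t - err a t); last first.
      rewrite /err /cst; have -> : l%:C = ((a + l - a0) +i* (t - c0)) - ((a - a0) +i* (t - c0)) :> R[i].
        by apply/eqP; rewrite eq_complex /=; apply/andP; split; apply/eqP; ring.
      by ring.
    apply: le_trans (le_normcB _ _) _.
    have hl := errle (a + l) t; have ha := errle a t.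
    have {}hl := hl _ _; have {}ha := ha _ _.
    have -> : e / 2 * l = e / 8 * (l + l) + e / 8 * (l + l) by lra.
    apply: lerD; [apply: hl|apply: ha]; apply/andP; split; lra.
have H : normc (itvint a (a + l) (G ^~ (c + l)) - itvint a (a + l) (G ^~ c)
    - l%:C * (D * (0 +i* l))) <= e / 2 * l * l.
  have -> : l%:C * (D * (0 +i* l)) = itvint a (a + l) (cst (D * (0 +i* l))) :> R[i].
    by rewrite itvint_cst// addrAC subrr add0r.
  rewrite -!itvintB//; last exact: ccontB.
  rewrite [e / 2 * l * l](_ : _ = e / 2 * l * (a + l - a)); last by rewrite [a + l]addrC addrK.
  apply: itvint_le => //.
  - by apply: ccontB => //; exact: ccontB.
  - move=> s /andP[sa sl]; rewrite (_ : _ - _ = err s (c + l) - err s c); last first.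
      rewrite /err /cst; have -> : (0 +i* l) = ((s - a0) +i* (c + l - c0)) - ((s - a0) +i* (c - c0)) :> R[i].
        by apply/eqP; rewrite eq_complex /=; apply/andP; split; apply/eqP; ring.
      by ring.
    apply: le_trans (le_normcB _ _) _.
    have hl := errle s (c + l); have ha := errle s c.
    have -> : e / 2 * l = e / 8 * (l + l) + e / 8 * (l + l) by lra.
    apply: lerD; [apply: hl|apply: ha]; apply/andP; split; lra.
rewrite /contour.
set v := itvint c _ _ - _ in V *; set h := itvint a _ _ - _ in H *.
rewrite (_ : _ - _ = 'i * (v - l%:C * (D * l%:C)) - (h - l%:C * (D * (0 +i* l)))); last first.
  by rewrite -il; ring.
apply: le_trans (le_normcB _ _) _; rewrite Normc.normcM.
have -> : normc ('i : R[i]) = 1 by rewrite /= expr0n add0r expr1n sqrtr1.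
by move: V H; move: (normc _) (normc _) => ? ?; nra.
Qed.

(** On a square whose side is the period, top and bottom edges carry the same integral, so the
    integrals over the two vertical edges must agree. *)
Lemma goursat_periodic (P a : R) : 0 < P -> (forall s t, G s (t + P) = G s t) ->
  itvint 0 P (G (a + P)) = itvint 0 P (G a).
Proof.
move=> P0 per; have := square_additive_eq0 contour_add contour_small a 0 P0.
rewrite /contour add0r.
have -> : (G ^~ P) = (G ^~ 0) by apply/funext => s; rewrite -[P]add0r per.
rewrite subrr subr0 => /eqP; rewrite mulf_eq0 => /orP[|]; last by rewrite subr_eq0 => /eqP.
by rewrite eq_complex /= oner_eq0 andbF.
Qed.

End goursat.

(** In the coordinate s + it with g(e^{s + it}), a vertical segment of length 2 pi is a circle of
    radius e^s. Its integral is unchanged when s drops by 2 pi; after k such steps the circle is so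
    small that continuity at 0 gives the value 2 pi g(0). *)
Lemma circle_mean (g : R[i] -> R[i]) : (forall z, differentiable g z) ->
  itvint 0 (2 * pi) (fun x => g (cos x +i* sin x)) = (2 * pi)%:C * g 0.
Proof.
move=> dg; pose G s t := g (cexp (s +i* t)).
have dF z : differentiable (g \o @cexp R) z.
  by apply: differentiable_comp; [exact: differentiable_cexp|exact: dg].
have Gdiff s0 t0 : exists D, forall e, 0 < e -> exists2 d, 0 < d &
  forall s t, `|s - s0| < d -> `|t - t0| < d ->
    normc (G s t - G s0 t0 - D * ((s - s0) +i* (t - t0))) <= e * (`|s - s0| + `|t - t0|).
  have [D DP] := differentiable_epsP (dF (s0 +i* t0)); exists D => e e0.
  have [d d0 dP] := DP e e0; exists (d / 2); first by rewrite divr_gt0.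
  move=> s t sd td; have le := normc_leD ((s +i* t) - (s0 +i* t0)).
  rewrite /= in le; apply: le_trans (dP (s +i* t) _) _; last by rewrite ler_pM2l.
  by apply: le_lt_trans le _; rewrite [ltRHS]splitr ltrD.
have pi0 : 0 < 2 * pi :> R by rewrite mulr_gt0 ?pi_gt0.
have per s t : G s (t + 2 * pi) = G s t.
  rewrite /G; congr g; rewrite /cexp /=.
  by rewrite mulr_natl cosD2pi sinD2pi.
have VP a := goursat_periodic Gdiff a pi0 per.
have cG s : ccont (G s).
  apply: ccontP => x e e0.
  have cF : {for (s +i* x), continuous (g \o @cexp R)} by exact: differentiable_continuous.
  move: cF => /cvgrPdist_lt/(_ e%:C); rewrite ltcR => /(_ e0)/near_complexP[d d0 dP].
  exists d => // y yx; rewrite -ltc_normc distrC; apply: dP.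
  by rewrite /= subrr expr0n add0r sqrtr_sqr.
have VN k : itvint 0 (2 * pi) (G (- (k%:R * (2 * pi)))) = itvint 0 (2 * pi) (G 0).
  elim: k => [|k ih]; first by rewrite mul0r oppr0.
  rewrite -ih -VP; congr (itvint _ _ (G _)).
  by rewrite -natr1 mulrDl mul1r opprD addrNK.
have -> : (fun x => g (cos x +i* sin x)) = G 0.
  by apply/funext => x; rewrite /G /cexp /= expR0 mul1r.
apply/eqP; rewrite -subr_eq0 -normc_eq0 eq_le normc_ge0 andbT.
apply/ler_addgt0Pr => e e0; rewrite add0r.
have e' : 0 < e / (2 * pi) by rewrite divr_gt0.
have /cvgrPdist_lt/(_ (e / (2 * pi))%:C) := differentiable_continuous (dg 0).
rewrite ltcR => /(_ e')/near_complexP[d d0 dP].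
have [k kd] : exists k : nat, expR (- (k%:R * (2 * pi))) < d.
  exists (Num.truncn d^-1).+1; rewrite expRN.
  have kd : d^-1 < (Num.truncn d^-1).+1%:R by exact: truncnS_gt.
  rewrite -[ltRHS]invrK ltf_pV2 ?posrE ?expR_gt0 ?invr_gt0//.
  apply: lt_le_trans kd _; set k := _.+1%:R.
  have k0 : 0 <= k :> R by exact: ler0n.
  apply: le_trans (expR_ge1Dx _); apply: (@le_trans _ _ (k * (2 * pi))); last by rewrite lerDr.
  by rewrite ler_peMr//; have := @pi_ge2 R; lra.
rewrite -(VN k); set s := - _.
have -> : (2 * pi)%:C * g 0 = itvint 0 (2 * pi) (cst (g 0)).
  by rewrite itvint_cst ?subr0// ltW.
have cc : ccont (cst (g 0)) by split; exact: cst_continuous.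
rewrite -itvintB ?(ltW pi0)//.
have -> : e = e / (2 * pi) * (2 * pi - 0) by rewrite subr0 mulfVK// gt_eqF.
apply: itvint_le; rewrite ?(ltW pi0) ?(ltW e')//; first exact: ccontB.
move=> t _; rewrite ltW//= -ltc_normc distrC; apply: dP.
by rewrite subr0 normc_cexp.
Qed.

End CircleMean.

(** * Measure-preserving maps of C^n *)

Section MeasurePreserving.
Variable R : realType.

Section def.
Context d (T : measurableType d) (mu : {measure set T -> \bar R}).

(** Stated on nonnegative integrals rather than on preimages of sets: composition is immediate, and
    Tonelli's theorem produces this form directly. *)
Definition mpreserving (phi : T -> T) := measurable_fun setT phi /\
  forall f : T -> \bar R, measurable_fun setT f -> (forall x, 0 <= f x)%E ->
  (\int[mu]_x f (phi x) = \int[mu]_x f x)%E.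

Lemma mpreserving_comp phi psi : mpreserving phi -> mpreserving psi ->
  mpreserving (phi \o psi).
Proof.
move=> [mphi hphi] [mpsi hpsi]; split; first exact: measurableT_comp.
move=> f mf f0; rewrite -[RHS]hphi// -[RHS](hpsi (f \o phi))//; first exact: measurableT_comp.
by move=> x /=.
Qed.

Variable phi : T -> T.
Hypothesis hphi : mpreserving phi.

Lemma cmeas_mpreserving (f : T -> R[i]) : cmeas f -> cmeas (fun x => f (phi x)).
Proof. by move=> mf; apply: cmeas_comp => //; case: hphi. Qed.

Lemma cintble_mpreserving (f : T -> R[i]) : cintble mu f -> cintble mu (fun x => f (phi x)).
Proof.
move=> [mf foo]; split; first exact: cmeas_mpreserving.
rewrite (hphi.2 (fun x => (normc (f x))%:E))//; first exact: measurable_enormc.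
by move=> x; rewrite lee_fin normc_ge0.
Qed.

Lemma integral_mpreserving (f : T -> \bar R) : measurable_fun setT f ->
  (\int[mu]_x f (phi x) = \int[mu]_x f x)%E.
Proof.
move=> mf; rewrite integralE [RHS]integralE; congr (_ - _)%E.
  have := hphi.2 (f^\+)%E (measurable_funepos mf) (funepos_ge0 f).
  by move=> <-; apply: eq_integral => x _; rewrite !funeposE.
have := hphi.2 (f^\-)%E (measurable_funeneg mf) (funeneg_ge0 f).
by move=> <-; apply: eq_integral => x _; rewrite !funenegE.
Qed.

Lemma cint_mpreserving (f : T -> R[i]) : cmeas f ->
  cint mu (fun x => f (phi x)) = cint mu f.
Proof.
move=> [mRe mIm]; rewrite !cintE; congr (_ +i* _); rewrite /Rintegral; congr fine.
  by rewrite -(integral_mpreserving (f := EFin \o (Re \o f)))//; exact/measurable_EFinP.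
by rewrite -(integral_mpreserving (f := EFin \o (Im \o f)))//; exact/measurable_EFinP.
Qed.

End def.

Local Notation R1 := (measurableTypeR R).
Local Notation mu := (@lebesgue_measure R).
Local Notation R2 := (R1 * R1)%type.

(** Uniqueness of Lebesgue measure: its image under the shift agrees with it on the intervals ]x,
    y]. *)
Lemma mpreserving_shift (a : R) : mpreserving mu (fun x : R1 => x + a : R1).
Proof.
have mphi : measurable_fun setT (fun x : R1 => x + a : R1).
  by apply: measurable_funD => //; exact: measurable_cst.
split => // f mf f0.
pose phi : {mfun R1 >-> R1} := HB.pack (fun x : R1 => x + a : R1)
  (isMeasurableFun.Build _ _ _ _ _ mphi).
have E : (\int[pushforward mu phi]_y f y = \int[mu]_x f (phi x))%E.
  by rewrite ge0_integral_pushforward.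
rewrite -[LHS]E; apply: eq_measure_integral => //= A mA _.
apply/esym.
apply: lebesgue_measure_unique => //= _ [[x y]] _ <-.
transitivity (lebesgue_measure (`]x - a, y - a]%classic : set R)).
  rewrite !lebesgue_measure_itv/= !lte_fin ltrD2r -!EFinB opprB.
  by rewrite addrA subrK.
congr (mu _); apply/seteqP; split => z /=; rewrite !in_itv /= ltrBlDr lerBrDr//.
Qed.

(** For a fixed second coordinate the shear is a translation of the first one; Tonelli does the
    rest. *)
Lemma mpreserving_shear1 (h : R -> R) : measurable_fun [set: R1] h ->
  mpreserving (lebesgue2 (R := R)) (fun z : R2 => (z.1 + h z.2, z.2)).
Proof.
move=> mh; have mphi : measurable_fun setT (fun z : R2 => (z.1 + h z.2, z.2) : R2).
  apply: measurable_fun_pair => //; apply: measurable_funD => //.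
  exact: measurableT_comp.
split => // f mf f0; rewrite /lebesgue2.
rewrite (fubini_tonelli2 (m1 := mu) (m2 := mu) (fun z => f (z.1 + h z.2, z.2)))//; last exact: measurableT_comp.
rewrite (fubini_tonelli2 (m1 := mu) (m2 := mu) f)//; apply: eq_integral => y _.
rewrite /fubini_G /=.
rewrite -[RHS](integral_mpreserving (mpreserving_shift (h y)))//.
exact: measurableT_comp.
Qed.

Lemma mpreserving_shear2 (h : R -> R) : measurable_fun [set: R1] h ->
  mpreserving (lebesgue2 (R := R)) (fun z : R2 => (z.1, z.2 + h z.1)).
Proof.
move=> mh; have mphi : measurable_fun setT (fun z : R2 => (z.1, z.2 + h z.1) : R2).
  apply: measurable_fun_pair => //; apply: measurable_funD => //.
  exact: measurableT_comp.
split => // f mf f0; rewrite /lebesgue2.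
rewrite (fubini_tonelli1 (m1 := mu) (m2 := mu) (fun z => f (z.1, z.2 + h z.1)))//; last exact: measurableT_comp.
rewrite (fubini_tonelli1 (m1 := mu) (m2 := mu) f)//; apply: eq_integral => x _.
rewrite /fubini_F /=.
rewrite -[RHS](integral_mpreserving (mpreserving_shift (h x)))//.
exact: measurableT_comp.
Qed.

(* A rotation is a product of three shears, unless it is the half-turn. *)
Lemma mpreserving_rotation2 (c s : R) : c ^+ 2 + s ^+ 2 = 1 ->
  mpreserving (lebesgue2 (R := R)) (fun z : R2 => (c * z.1 - s * z.2, s * z.1 + c * z.2)).
Proof.
have mlin (k : R) : measurable_fun [set: R1] (fun x : R => k * x) by exact: mulrl_measurable.
have rot (c' s' : R) : 1 + c' != 0 -> c' ^+ 2 + s' ^+ 2 = 1 ->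
    mpreserving (lebesgue2 (R := R)) (fun z : R2 => (c' * z.1 - s' * z.2, s' * z.1 + c' * z.2)).
  (* k = - tan(theta/2) when c' = cos theta and s' = sin theta; the three shears have slopes k, s',
     k. *)
  move=> c1 cs; pose k := - s' / (1 + c').
  have := mpreserving_comp (mpreserving_shear1 (mlin k))
    (mpreserving_comp (mpreserving_shear2 (mlin s')) (mpreserving_shear1 (mlin k))).
  congr mpreserving; apply/funext => -[x y] /=.
  have E : 1 + s' * k = c'.
    rewrite /k; apply: (mulIf c1); rewrite mulrDl mul1r -mulrA mulfVK//.
    have s2 : s' * s' = 1 - c' * c' by rewrite -cs; ring.
    by rewrite mulrN s2; ring.
  have E2 : k + k * c' = - s' by rewrite -[X in X + _]mulr1 -mulrDr mulfVK.
  congr pair.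
    have -> : x + k * y + k * (y + s' * (x + k * y)) =
      (1 + s' * k) * x + (k + k * (1 + s' * k)) * y by ring.
    by rewrite E E2 mulNr.
  by rewrite -E; ring.
move=> cs; have [/eqP c1|] := boolP (1 + c == 0); last by move=> /rot; apply.
have cE : c = -1 by apply/eqP; rewrite -subr_eq0 opprK addrC c1.
have s0 : s = 0 by apply/eqP; rewrite -sqrf_eq0; move: cs; rewrite cE sqrrN expr1n => /eqP; rewrite -subr_eq0 addrAC subrr add0r.
(* Here 1 + c = 0 and the tangent is infinite; the half-turn is obtained as the square of the
   quarter-turn. *)
have r90 : mpreserving (lebesgue2 (R := R)) (fun z : R2 => (0 * z.1 - 1 * z.2, 1 * z.1 + 0 * z.2)).
  by apply: rot; rewrite ?addr0 ?oner_neq0// expr0n add0r expr1n.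
have := mpreserving_comp r90 r90; congr mpreserving.
by apply/funext => -[x y] /=; rewrite cE s0; congr pair; ring.
Qed.

Lemma mpreserving_affine2 (c s a b : R) : c ^+ 2 + s ^+ 2 = 1 ->
  mpreserving (lebesgue2 (R := R)) (fun z : R2 => (c * z.1 - s * z.2 + a, s * z.1 + c * z.2 + b)).
Proof.
move=> cs; have := mpreserving_comp (mpreserving_shear1 (@measurable_cst _ _ R1 R1 setT a))
  (mpreserving_comp (mpreserving_shear2 (@measurable_cst _ _ R1 R1 setT b)) (mpreserving_rotation2 cs)).
by [].
Qed.

Section Cn.
Local Open Scope ereal_scope.

Lemma integral_CnS n (f : 'rV[R[i]]_n.+1 -> \bar R) : measurable_fun setT f ->
  (forall z, 0 <= f z) ->
  \int[lebesgue_Cn R n.+1]_z f z =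
  \int[lebesgue2 (R := R)]_x \int[lebesgue_Cn R n]_z f (cons_Cn (x, z)).
Proof.
move=> mf f0 /=.
have := @ge0_integral_pushforward _ _ _ _ R _ (@measurable_cons_Cn R n)
  (lebesgue2 (R := R) \x lebesgue_Cn R n) setT f measurableT mf (fun y _ => f0 y).
rewrite preimage_setT => E; rewrite -[LHS]/(integral (pushforward _ _) setT f) E.
rewrite fubini_tonelli1//.
- by apply: measurableT_comp => //; exact: measurable_cons_Cn.
- by move=> x /=.
Qed.

Lemma rV0E (z w : 'rV[R[i]]_0) : z = w.
Proof. by apply/rowP => -[]. Qed.

Lemma measurable_affine_Cn n (c : R[i]) (a : 'rV[R[i]]_n) :
  measurable_fun setT (fun z : 'rV[R[i]]_n => c *: z + a)%R.
Proof.
apply/measurable_recoordP => j.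
have := @measurable_recoord R n j => /measurable_fun_pairP[mRe mIm].
rewrite (_ : _ \o _ = (fun z : 'rV[R[i]]_n =>
   (Re c * (recoord j z).1 - Im c * (recoord j z).2 + Re (a 0 j),
    Re c * (recoord j z).2 + Im c * (recoord j z).1 + Im (a 0 j)))%R); last first.
  by apply/funext => z; rewrite /recoord /= !mxE ReD ImD ReM ImM.
apply: measurable_fun_pair; apply: measurable_funD => //.
  by apply: measurable_funB; apply: measurable_funM.
by apply: measurable_funD; apply: measurable_funM.
Qed.

(** By induction on n: each complex coordinate undergoes a plane rotation and a translation. The
    scalars c = 1 and c = -1 give translations and reflections, the others the rotations behind
    [mean_value]. *)
Lemma mpreserving_affine_Cn n (c : R[i]) (a : 'rV[R[i]]_n) : (normc c = 1)%R ->
  mpreserving (lebesgue_Cn R n) (fun z => c *: z + a)%R.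
Proof.
move=> c1; split; first exact: measurable_affine_Cn.
elim: n a => [|n ih] a f mf f0.
  by apply: eq_integral => z _; congr f; exact: rV0E.
have mfa : measurable_fun setT (fun z : 'rV[R[i]]_n.+1 => f (c *: z + a)%R).
  by apply: measurableT_comp => //; exact: measurable_affine_Cn.
rewrite integral_CnS// (integral_CnS mf)//.
pose a' : 'rV[R[i]]_n := \row_k a 0%R (lift ord0 k).
pose phi (x : R2) : R2 := (Re c * x.1 - Im c * x.2 + Re (a 0 ord0), Im c * x.1 + Re c * x.2 + Im (a 0 ord0))%R.
have phiP : mpreserving (lebesgue2 (R := R)) phi.
  by apply: mpreserving_affine2; rewrite -normc_sqr c1 expr1n.
have mcons : measurable_fun setT (fun xz => f (@cons_Cn R n xz)).
  by apply: measurableT_comp => //; exact: measurable_cons_Cn.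
have E x z : (c *: cons_Cn (x, z) + a = cons_Cn (phi x, c *: z + a'))%R.
  apply/rowP => j; rewrite /cons_Cn !mxE; have [k ->|->] := unliftP ord0 j.
    by rewrite !mxE.
  rewrite [LHS]complex_eta ReD ImD ReM ImM /=.
  by rewrite [(Re c * x.2 + _)%R]addrC.
rewrite -(phiP.2 (fun x => \int[lebesgue_Cn R n]_z f (cons_Cn (x, z)))).
- apply: eq_integral => x _ /=; under eq_integral do rewrite E.
  rewrite (ih a' (fun z => f (cons_Cn (phi x, z))))//.
  by apply: (measurableT_comp mcons); exact: measurable_pair1.
- exact: (measurable_fun_fubini_tonelli_F (fun xz => f (@cons_Cn R n xz))).
- by move=> x; exact: integral_ge0.
Qed.

End Cn.

End MeasurePreserving.

(** * The Hermitian form of C^n *)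

Section Hermitian.
Variables (R : realType) (n : nat).
Implicit Types (z w v : 'rV[R[i]]_n) (a : R[i]).

Lemma cdotDl z w v : cdot (z + w) v = cdot z v + cdot w v.
Proof. by rewrite /cdot -big_split; apply: eq_bigr => j _; rewrite mxE mulrDl. Qed.

Lemma cdotZl a z v : cdot (a *: z) v = a * cdot z v.
Proof. by rewrite /cdot mulr_sumr; apply: eq_bigr => j _; rewrite mxE mulrA. Qed.

Lemma cdot_conj z w : (cdot z w)^*%R = cdot w z.
Proof.
by rewrite /cdot rmorph_sum; apply: eq_bigr => j _; rewrite rmorphM /= conjCK mulrC.
Qed.

Lemma cdotDr z w v : cdot v (z + w) = cdot v z + cdot v w.
Proof. by rewrite -cdot_conj cdotDl rmorphD /= !cdot_conj. Qed.

Lemma cdotZr a z v : cdot v (a *: z) = a^*%R * cdot v z.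
Proof. by rewrite -cdot_conj cdotZl rmorphM /= cdot_conj. Qed.

Lemma cdotNl z v : cdot (- z) v = - cdot z v.
Proof. by rewrite -scaleN1r cdotZl mulN1r. Qed.

Lemma cdotNr z v : cdot v (- z) = - cdot v z.
Proof. by rewrite -cdot_conj cdotNl rmorphN /= cdot_conj. Qed.

Lemma cdotZrr (a : R) z v : cdot v (a%:C *: z) = a%:C * cdot v z.
Proof. by rewrite cdotZr conjcE conjc_real. Qed.

Lemma cdot0l v : cdot 0 v = 0.
Proof. by rewrite -(scale0r 0) cdotZl mul0r. Qed.

Lemma cdot0r v : cdot v 0 = 0.
Proof. by rewrite -cdot_conj cdot0l rmorph0. Qed.

Lemma sqnormE z : sqnorm z = \sum_j normc (z 0 j) ^+ 2.
Proof. by apply: eq_bigr => j _; rewrite normc_sqr. Qed.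

Lemma cdot_self z : cdot z z = (sqnorm z)%:C.
Proof.
rewrite /cdot sqnormE rmorph_sum; apply: eq_bigr => j _ /=.
by rewrite conjcE -sqr_normc normcE -rmorphXn.
Qed.

Lemma sqnorm_ge0 z : 0 <= sqnorm z.
Proof. by rewrite sqnormE sumr_ge0// => j _; rewrite sqr_ge0. Qed.

Lemma sqnormD z w : sqnorm (z + w) = sqnorm z + sqnorm w + 2 * Re (cdot z w).
Proof.
have : (sqnorm (z + w))%:C = (sqnorm z)%:C + (sqnorm w)%:C + (cdot z w + cdot w z).
  by rewrite -!cdot_self cdotDl !cdotDr; ring.
move=> /(congr1 Re); rewrite -(cdot_conj z w) !ReD Re_conj /= => ->.
by rewrite mulr_natl mulr2n.
Qed.

Lemma sqnormZ a z : sqnorm (a *: z) = normc a ^+ 2 * sqnorm z.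
Proof.
by rewrite !sqnormE mulr_sumr; apply: eq_bigr => j _; rewrite mxE Normc.normcM exprMn.
Qed.

Lemma sqnormN z : sqnorm (- z) = sqnorm z.
Proof. by rewrite -scaleN1r sqnormZ normcN Normc.normc1 expr1n mul1r. Qed.

Lemma sqnormB z w : sqnorm (z - w) = sqnorm z + sqnorm w - 2 * Re (cdot z w).
Proof. by rewrite sqnormD sqnormN cdotNr ReN mulrN. Qed.

Lemma sqnormC z w : sqnorm (z - w) = sqnorm (w - z).
Proof. by rewrite -sqnormN opprB. Qed.

Lemma sqnorm0 : sqnorm (0 : 'rV[R[i]]_n) = 0.
Proof. by rewrite -(scale0r 0) sqnormZ Normc.normc0 expr0n mul0r. Qed.

Lemma sqnormD_le z w : sqnorm (z + w) <= 2 * (sqnorm z + sqnorm w).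
Proof. by have := sqnorm_ge0 (z - w); rewrite sqnormB sqnormD; lra. Qed.

Lemma Re_cdot_ge z w : - ((sqnorm z + sqnorm w) / 2) <= Re (cdot z w).
Proof. by have := sqnorm_ge0 (z + w); rewrite sqnormD; lra. Qed.

Lemma normc_le_sqnorm z j : normc (z 0 j) ^+ 2 <= sqnorm z.
Proof.
rewrite sqnormE (bigD1 j)//= lerDl sumr_ge0// => k _.
by rewrite sqr_ge0.
Qed.

Lemma sqnorm_le (e : R) z : 0 <= e <= 1 -> (forall j, normc (z 0 j) <= e) ->
  sqnorm z <= n%:R * e.
Proof.
move=> /andP[e0 e1] ze; rewrite sqnormE.
apply: (@le_trans _ _ (\sum_(j < n) e)); last by rewrite sumr_const card_ord mulr_natl.
apply: ler_sum => j _; apply: (@le_trans _ _ (e ^+ 2)).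
  by rewrite lerXn2r// nnegrE ?normc_ge0.
by rewrite expr2 ler_piMl.
Qed.

End Hermitian.

(** * Topology and Borel sets of C^n *)

Section TopologyCn.
Variables (R : realType) (n : nat).
Local Notation Cn := ('rV[R[i]]_n).
Implicit Types (z w v : Cn).

(** Trades max-norm balls with complex radius for [sqnorm] with a real bound. Since e^2 <= e for e
    <= 1, coordinates of modulus at most e give a [sqnorm] of at most n e; dividing by n + 1 makes
    the inequality strict. *)
Lemma near_CnP (P : set Cn) z :
  (\forall w \near z, P w) <->
  exists2 d : R, 0 < d & forall w, sqnorm (w - z) < d -> P w.
Proof.
split.
  rewrite -nbhs_nearE => /nbhs_ballP[d /= /gt0_complexE[dE d0]] dP.
  exists (Re d ^+ 2); first by rewrite exprn_gt0.
  move=> w wz; apply: dP; split => [|i j]; first by rewrite dE ltcR.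
  rewrite /ball /= dE (ord1 i) ltc_normc.
  rewrite -(@ltr_pXn2r R 2) ?nnegrE ?normc_ge0 ?ltW//; apply: le_lt_trans wz.
  by rewrite -normcN opprB; have := normc_le_sqnorm (w - z) j; rewrite !mxE.
move=> [d d0 dP]; rewrite -nbhs_nearE; apply/nbhs_ballP.
pose e := Num.min 1 (d / (n%:R + 1)).
have n0 : 0 < n%:R + 1 :> R by rewrite ltr_wpDl.
have e0 : 0 < e by rewrite lt_min ltr01 divr_gt0.
exists e%:C => /=; first by rewrite ltcR.
move=> w zw; apply: dP; apply: (@le_lt_trans _ _ (n%:R * e)).
  apply: sqnorm_le => [|j]; first by rewrite ltW//= ge_min lexx.
  have := zw.2 ord0 j; rewrite /ball /= ltc_normc => /ltW.
  by rewrite -normcN opprB !mxE.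
apply: (@lt_le_trans _ _ ((n%:R + 1) * e)); first by rewrite ltr_pM2r// ltrDl.
by rewrite -ler_pdivlMl// mulrC ge_min lexx orbT.
Qed.

Lemma continuous_CnP (f : Cn -> R[i]) z : {for z, continuous f} <->
  forall e : R, 0 < e -> exists2 d : R, 0 < d & forall w, sqnorm (w - z) < d -> normc (f w - f z) < e.
Proof.
split.
  move=> /cvgrPdist_lt h e e0; have := h e%:C; rewrite ltcR => /(_ e0)/near_CnP[d d0 dP].
  by exists d => // w /dP; rewrite distrC ltc_normc.
move=> h; change (f x @[x --> z] --> f z).
apply/(@cvgrPdist_lt _ _ _ _ (nbhs_filter z)) => e /gt0_complexE[eE e0]; apply/near_CnP.
have [d d0 dP] := h _ e0; exists d => // w /dP.
by rewrite eE distrC ltc_normc.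
Qed.

Lemma unif_continuousP (f : Cn -> R[i]) : unif_continuous f <->
  forall e : R, 0 < e -> exists2 d : R, 0 < d &
    forall z w, sqnorm (w - z) < d -> normc (f w - f z) < e.
Proof.
split.
  move=> uf e e0.
  have : entourage [set xy : R[i] * R[i] | ball xy.1 e%:C xy.2].
    by rewrite -entourage_ballE; exists e%:C => //=; rewrite ltcR.
  move=> /uf; rewrite /nbhs /= -entourage_ballE => -[d /= /gt0_complexE[dE d0] dP].
  exists (Re d ^+ 2); first by rewrite exprn_gt0.
  move=> z w zw; have /= := dP (z, w); rewrite /ball /= ltc_normc -normcN opprB; apply.
  split => [|i j]; first by rewrite dE ltcR.
  rewrite /ball /= dE (ord1 i) ltc_normc.
  rewrite -(@ltr_pXn2r R 2) ?nnegrE ?normc_ge0 ?ltW//; apply: le_lt_trans zw.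
  by rewrite -normcN opprB; have := normc_le_sqnorm (w - z) j; rewrite !mxE.
move=> h A /=; rewrite -entourage_ballE => -[e /= /gt0_complexE[eE e0] eA].
have [d d0 dP] := h _ e0.
pose r := Num.min 1 (d / (n%:R + 1)).
have n0 : 0 < n%:R + 1 :> R by rewrite ltr_wpDl.
have r0 : 0 < r by rewrite lt_min ltr01 divr_gt0.
rewrite /nbhs /= -entourage_ballE; exists r%:C => /=; first by rewrite ltcR.
move=> [z w] /= zw; apply: eA; rewrite /= /ball /= eE ltc_normc -normcN opprB; apply: dP.
apply: (@le_lt_trans _ _ (n%:R * r)).
  apply: sqnorm_le => [|j]; first by rewrite ltW//= ge_min lexx.
  have := zw.2 ord0 j; rewrite /ball /= ltc_normc => /ltW.
  by rewrite -normcN opprB !mxE.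
apply: (@lt_le_trans _ _ ((n%:R + 1) * r)); first by rewrite ltr_pM2r// ltrDl.
by rewrite -ler_pdivlMl// mulrC ge_min lexx orbT.
Qed.

Lemma measurable_coord (j : 'I_n) : cmeas (fun z : Cn => z 0 j).
Proof. by have /measurable_fun_pairP[] := @measurable_recoord R n j. Qed.

Lemma measurable_sqnorm : measurable_fun setT (@sqnorm R n).
Proof.
apply: measurable_sum => j; have [? ?] := measurable_coord j.
by apply: measurable_funD; exact: measurable_funX.
Qed.

Definition ratpt (q : 'rV[rat * rat]_n) : Cn :=
  \row_j (ratr (q 0 j).1 +i* ratr (q 0 j).2).

Lemma ratpt_dense z (d : R) : 0 < d -> exists q, sqnorm (z - ratpt q) < d.
Proof.
move=> d0; pose e := Num.min 1 (d / (n%:R + 1)).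
have n0 : 0 < n%:R + 1 :> R by rewrite ltr_wpDl.
have e0 : 0 < e by rewrite lt_min ltr01 divr_gt0.
have /choice[q qP] : forall j, exists q : rat * rat,
    normc (z 0 j - (ratr q.1 +i* ratr q.2)) <= e.
  move=> j; have e2 : 0 < e / 2 by rewrite divr_gt0.
  have h x : exists q : rat, `|x - ratr q| <= e / 2.
    have [|q] := @rat_in_itvoo R (x - e / 2) (x + e / 2); first by lra.
    by rewrite in_itv /= => /andP[h1 h2]; exists q; rewrite ler_norml; apply/andP; split; lra.
  have [q1 h1] := h (Re (z 0 j)); have [q2 h2] := h (Im (z 0 j)).
  exists (q1, q2); apply: le_trans (normc_leD _) _.
  by rewrite ReB ImB /= [leRHS]splitr lerD.
exists (\row_j q j); apply: (@le_lt_trans _ _ (n%:R * e)).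
  apply: sqnorm_le => [|j]; first by rewrite ltW//= ge_min lexx.
  by rewrite !mxE qP.
apply: (@lt_le_trans _ _ ((n%:R + 1) * e)); first by rewrite ltr_pM2r// ltrDl.
by rewrite -ler_pdivlMl// mulrC ge_min lexx orbT.
Qed.

Definition ratball (d : R) (q : 'rV[rat * rat]_n) : set Cn := [set z | sqnorm (z - ratpt q) < d].

Lemma measurable_shift (a : Cn) : measurable_fun setT (fun z : Cn => z - a).
Proof.
have := measurable_affine_Cn (1 : R[i]) (- a).
by congr measurable_fun; apply/funext => z; rewrite scale1r.
Qed.

Lemma measurable_ratball d q : measurable (ratball d q).
Proof.
have mf : measurable_fun setT (fun z : Cn => sqnorm (z - ratpt q)).
  by apply: (measurableT_comp measurable_sqnorm); exact: measurable_shift.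
rewrite (_ : ratball d q = setT `&` (fun z => sqnorm (z - ratpt q)) @^-1` `]-oo, d[); last first.
  by rewrite setTI; apply/seteqP; split => z; rewrite /= in_itv.
exact: mf.
Qed.

(** The sigma-algebra is generated by the coordinates, so the Borel property has to be proved: an
    open set is the union of the countably many rational balls that it contains. *)
Lemma open_measurable_Cn (O : set Cn) : open O -> measurable O.
Proof.
move=> oO.
pose I := [set x : 'rV[rat * rat]_n * nat | ratball (x.2.+1%:R^-1) x.1 `<=` O].
rewrite (_ : O = \bigcup_x [set z | I x /\ ratball (x.2.+1%:R^-1) x.1 z]); last first.
  apply/seteqP; split; last by move=> z [x _ [xI]]; apply: xI.
  move=> z Oz; have /near_CnP[d d0 dP] : nbhs z O by exact: open_nbhs_nbhs.
  (* A ball of squared radius below d/4 around a rational point stays within squared distance d of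
     z, because |a + b|^2 <= 2 (|a|^2 + |b|^2). *)
  pose m := Num.truncn (4 / d).
  have md : (m.+1%:R)^-1 < d / 4.
    rewrite -[ltRHS]invrK ltf_pV2 ?posrE ?invr_gt0 ?divr_gt0// invf_div.
    exact: truncnS_gt.
  have m0 : 0 < m.+1%:R^-1 :> R by rewrite invr_gt0.
  have [q zq] := ratpt_dense z m0.
  exists (q, m) => //; split => //= w; rewrite /ratball /= => wq; apply: dP.
  have -> : w - z = (w - ratpt q) + (ratpt q - z) by rewrite addrA subrK.
  apply: le_lt_trans (sqnormD_le _ _) _; rewrite [sqnorm (ratpt q - z)]sqnormC.
  move: wq zq md; rewrite /=; move: (_.+1%:R^-1) (sqnorm _) (sqnorm _) => k s1 s2 ? ? ?; lra.
apply: countable_bigcupT_measurable => [|x]; first exact: countableP.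
 have [xI|xI] := pselect (I x).
  rewrite (_ : [set _ | _] = ratball (x.2.+1%:R^-1) x.1); first exact: measurable_ratball.
  by apply/seteqP; split => [z []|z].
by rewrite (_ : [set _ | _] = set0)//; apply/seteqP; split => [z []|z].
Qed.

Lemma continuous_cmeas (f : Cn -> R[i]) : continuous f -> cmeas f.
Proof.
move=> cf.
have mR (h : R[i] -> R) : (forall x y, `|h x - h y| <= normc (x - y)) ->
    measurable_fun setT (h \o f).
  move=> hle.
  apply: (measurability _ (RGenOpens.measurableE R)).
  move=> _ [_ [a [b ->] <-]]; rewrite setTI; apply: open_measurable_Cn.
  apply: open_comp; last exact: interval_open.
  move=> z _ /=; apply: continuous_comp; first exact: cf.
  change (h y @[y --> f z] --> h (f z)).
  apply/(@cvgrPdist_lt _ _ _ _ (nbhs_filter (f z))) => e e0; apply/near_complexP; exists e => // w wz.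
  by apply: le_lt_trans (hle _ _) _; rewrite -normcN opprB.
split; apply: mR => x y; rewrite -?ReB -?ImB; [exact: Re_le_normc|exact: Im_le_normc].
Qed.

End TopologyCn.

Lemma ge0_integral_scale d (T : measurableType d) (R : realType)
    (m : {measure set T -> \bar R}) (k : R) (h : T -> R) :
  measurable_fun setT h -> (forall x, 0 <= h x) -> 0 <= k ->
  (\int[m]_x (k * h x)%:E = k%:E * \int[m]_x (h x)%:E)%E.
Proof.
move=> mh h0 k0; under eq_integral do rewrite EFinM.
rewrite ge0_integralZl//; first exact/measurable_EFinP.
by move=> x _; rewrite lee_fin.
Qed.

(** * Gaussian integrals *)

Section GaussianIntegrals.
Variable R : realType.
Local Notation mu := (@lebesgue_measure R).
Local Notation leb := (lebesgue_Cn R).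

Lemma measurable_gauss1 (b : R) :
  measurable_fun [set: measurableTypeR R] (fun x : measurableTypeR R => expR (- (b * x ^+ 2))).
Proof.
apply: (measurableT_comp (@measurable_expR R)).
apply: (@measurable_funN _ _ _ _ (fun x : measurableTypeR R => b * x ^+ 2)).
by apply: measurable_funM => //; exact: exprn_measurable.
Qed.

(** Read off from the total mass 1 of the normal density of variance 1/(2b). *)
Lemma integral_gauss1 (b : R) : 0 < b ->
  (\int[mu]_x (expR (- (b * x ^+ 2)))%:E = (Num.sqrt (pi / b))%:E)%E.
Proof.
move=> b0; pose s := Num.sqrt ((2 * b)^-1).
have s2 : s ^+ 2 = (2 * b)^-1 by rewrite sqr_sqrtr// invr_ge0 mulr_ge0 ?ltW.
have s0 : s != 0 by rewrite sqrtr_eq0 -ltNge invr_gt0 mulr_gt0.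
have := integral_normal_pdf 0 s; rewrite normal_pdfE//.
have -> : (fun x => (normal_peak s * normal_fun 0 s x)%:E) =
    (fun x => ((normal_peak s)%:E * (expR (- (b * x ^+ 2)))%:E)%E).
  apply/funext => x; rewrite EFinM /normal_fun subr0 s2; congr (_ * (expR _)%:E)%E.
  by field; rewrite gt_eqF.
rewrite ge0_integralZl//; last 2 first.
- by apply/measurable_EFinP; exact: measurable_gauss1.
- by rewrite lee_fin normal_peak_ge0.
have pE : (normal_peak s)^-1 = Num.sqrt (pi / b).
  rewrite /normal_peak invrK s2; congr Num.sqrt.
  by field; rewrite gt_eqF.
have p0 := normal_peak_gt0 s0.
case: (\int[mu]_x _)%E => [r| |].
- by rewrite -EFinM => -[pr]; rewrite -pE; congr EFin; apply: (mulfI (lt0r_neq0 p0)); rewrite pr divff// lt0r_neq0.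
- by rewrite gt0_muley.
- by rewrite gt0_muleNy.
Qed.

Definition gaussian n (b : R) (z : 'rV[R[i]]_n) : R := expR (- (b * sqnorm z)).

Lemma gaussian_ge0 n b (z : 'rV[R[i]]_n) : 0 <= gaussian b z.
Proof. exact: expR_ge0. Qed.

Lemma measurable_gaussian n b : measurable_fun setT (@gaussian n b).
Proof.
apply: (measurableT_comp (@measurable_expR R)).
apply: (@measurable_funN _ _ _ _ (fun z => b * sqnorm z)).
by apply: measurable_funM => //; exact: measurable_sqnorm.
Qed.

Lemma integral_gaussian n (b : R) : 0 < b ->
  (\int[leb n]_z (gaussian b z)%:E = ((pi / b) ^+ n)%:E)%E.
Proof.
move=> b0; elim: n => [|n ih].
  rewrite /= integral_dirac//; last by apply/measurable_EFinP; exact: measurable_gaussian.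
  by rewrite diracT mul1e /gaussian /sqnorm big_ord0 mulr0 oppr0 expR0 expr0.
rewrite integral_CnS; last 2 first.
- by apply/measurable_EFinP; exact: measurable_gaussian.
- by move=> z; rewrite lee_fin gaussian_ge0.
pose g (x : R) := expR (- (b * x ^+ 2)).
have mg : measurable_fun [set: measurableTypeR R] g by exact: measurable_gauss1.
have E x z : gaussian b (@cons_Cn R n (x, z)) = g x.1 * g x.2 * gaussian b z.
  rewrite /gaussian /g -!expRD; congr expR.
  rewrite /sqnorm big_ord_recl /cons_Cn !mxE unlift_none /=.
  have -> : \sum_(i < n) (Re (cons_Cn (x, z) 0 (lift ord0 i)) ^+ 2 + Im (cons_Cn (x, z) 0 (lift ord0 i)) ^+ 2) =
    \sum_(j < n) (Re (z 0 j) ^+ 2 + Im (z 0 j) ^+ 2).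
    by apply: eq_bigr => j _; rewrite /cons_Cn !mxE liftK.
  by ring.
have c0 : 0 <= (pi / b) ^+ n by rewrite exprn_ge0// divr_ge0 ?pi_ge0 ?ltW.
transitivity (\int[lebesgue2 (R := R)]_x ((pi / b) ^+ n * (g x.1 * g x.2))%:E)%E.
  apply: eq_integral => x _; under eq_integral do rewrite E.
  rewrite ge0_integral_scale ?mulr_ge0 ?expR_ge0//; last 2 first.
  - exact: measurable_gaussian.
  - exact: gaussian_ge0.
  by rewrite ih -EFinM mulrC.
have mgg : measurable_fun setT (fun x : measurableTypeR R * measurableTypeR R => g x.1 * g x.2).
  by apply: measurable_funM; apply: (measurableT_comp mg).
rewrite ge0_integral_scale//; last by move=> x; rewrite mulr_ge0 ?expR_ge0.
rewrite /lebesgue2 (fubini_tonelli1 (m1 := mu) (m2 := mu) (fun x => (g x.1 * g x.2)%:E)); last 2 first.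
- exact/measurable_EFinP.
- by move=> x; rewrite lee_fin mulr_ge0 ?expR_ge0.
rewrite /fubini_F /=.
transitivity (((pi / b) ^+ n)%:E * \int[mu]_x (Num.sqrt (pi / b) * g x)%:E)%E.
  congr (_ * _)%E; apply: eq_integral => x _.
  rewrite (ge0_integral_scale mu mg) ?expR_ge0//; last by move=> ?; exact: expR_ge0.
  by rewrite integral_gauss1// -EFinM mulrC.
rewrite (ge0_integral_scale mu mg) ?sqrtr_ge0//; last by move=> ?; exact: expR_ge0.
rewrite integral_gauss1// -!EFinM exprS mulrC; congr (_ * _)%:E.
by rewrite -expr2 sqr_sqrtr// divr_ge0 ?pi_ge0 ?ltW.
Qed.

Lemma integral_gaussian_lty n (b : R) : 0 < b ->
  (\int[leb n]_z (gaussian b z)%:E < +oo)%E.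
Proof. by move=> /integral_gaussian ->; rewrite ltry. Qed.

Section gauss_density.
Variable (n : nat) (s : {posnum R}).
Import HBNNSimple.
Local Open Scope ereal_scope.

Let dens z : R := gauss_density (n := n) s z.
Let mdens : measurable_fun setT (EFin \o dens).
Proof. by apply/measurable_EFinP; exact: measurable_gauss_density. Qed.
Let dens0 z : 0 <= (dens z)%:E.
Proof. by rewrite lee_fin gauss_density_ge0. Qed.

(** [gauss s] is given as a set function with a density; the formula passes from indicators to
    simple functions by linearity, and to f by monotone convergence on both sides. *)
Lemma ge0_integral_gauss (f : 'rV[R[i]]_n -> \bar R) : measurable_fun setT f ->
  (forall z, 0 <= f z) ->
  \int[gauss s]_z f z = \int[leb n]_z (f z * (gauss_density s z)%:E).
Proof.
move=> mf f0; pose f_ := nnsfun_approx measurableT mf.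
have cf z : EFin \o f_ ^~ z @ \oo --> f z.
  by apply: cvg_nnsfun_approx => // *; apply: f0.
have mfn k : measurable_fun setT (EFin \o f_ k).
  by apply/measurable_EFinP.
have fn0 k z : 0 <= (EFin \o f_ k) z by rewrite lee_fin.
have ndf z a b : (a <= b)%N -> (f_ a z)%:E <= (f_ b z)%:E.
  by move=> ab; rewrite lee_fin; exact/lefP/nd_nnsfun_approx.
transitivity (limn (fun k => \int[gauss s]_z (f_ k z)%:E)).
  rewrite -monotone_convergence//; last 2 first.
  - by move=> k z _; rewrite lee_fin.
  - by move=> z _ a b; exact: ndf.
  by apply: eq_integral => z _; apply/esym/cvg_lim => //; exact: cf.
transitivity (limn (fun k => \int[leb n]_z ((f_ k z)%:E * (dens z)%:E))); last first.
  rewrite -monotone_convergence//; first last.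
  - by move=> z _ a b ab; apply: lee_wpmul2r => //; exact: ndf.
  - by move=> k z _; apply: mule_ge0; [rewrite lee_fin|exact: dens0].
  - by move=> k; apply: emeasurable_funM; [exact: mfn|exact: mdens].
  apply: eq_integral => z _; apply/cvg_lim => //.
  by apply: cvgeZr => //; exact: cf.
congr (limn _); apply/funext => k.
have mk r : measurable (f_ k @^-1` [set r]) by rewrite -[X in measurable X]setTI; exact: (measurable_funP (f_ k)).
transitivity (\sum_(r \in range (f_ k)) \int[gauss s]_z (r * \1_(f_ k @^-1` [set r]) z)%:E).
  under eq_integral do rewrite fimfunE -fsumEFin//.
  rewrite ge0_integral_fsum//.
  - by move=> r; exact/measurable_EFinP/measurable_funM.
  - by move=> r z _; rewrite nnfun_muleindic_ge0.
transitivity (\sum_(r \in range (f_ k)) \int[leb n]_z ((r * \1_(f_ k @^-1` [set r]) z)%:E * (dens z)%:E)); last first.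
  rewrite -ge0_integral_fsum//.
  - apply: eq_integral => z _; rewrite [in RHS]fimfunE -fsumEFin// ge0_mule_fsuml//.
    by move=> r; rewrite nnfun_muleindic_ge0.
  - move=> r; apply: emeasurable_funM => //.
    exact/measurable_EFinP/measurable_funM.
  - by move=> r z _; apply: mule_ge0; [exact: nnfun_muleindic_ge0|exact: dens0].
apply: eq_fsbigr => r _.
have [r0|r0] := ltP r 0%R.
  by rewrite preimage_nnfun0// !integral0_eq// => z _; rewrite indicE in_set0 mulr0 ?mul0e.
under eq_integral do rewrite EFinM; under [RHS]eq_integral do rewrite EFinM -muleA.
rewrite ge0_integralZl//; last by exact/measurable_EFinP.
rewrite ge0_integralZl//; last 2 first.
- by apply: emeasurable_funM => //; exact/measurable_EFinP.
- by move=> z _; apply: mule_ge0; [rewrite lee_fin|exact: dens0].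
congr (_ * _); rewrite integral_indic// setIT.
transitivity (\int[leb n]_(z in f_ k @^-1` [set r]) (dens z)%:E) => //.
rewrite [LHS]integral_mkcond; apply: eq_integral => z _.
by rewrite patchE /= indicE; case: ifP => _; rewrite ?mul1e ?mul0e.
Qed.

Lemma integral_gauss (f : 'rV[R[i]]_n -> R) : measurable_fun setT f ->
  \int[gauss s]_z (f z)%:E = \int[leb n]_z (gauss_density s z * f z)%:E.
Proof.
move=> mf; have mF : measurable_fun setT (EFin \o f) by exact/measurable_EFinP.
rewrite integralE [RHS]integralE; congr (_ - _).
  rewrite ge0_integral_gauss//; last exact: measurable_funepos.
  apply: eq_integral => z _; rewrite !funeposE /= -!EFin_max -EFinM; congr EFin.
  by rewrite mulrC maxr_pMr ?gauss_density_ge0// mulr0.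
rewrite ge0_integral_gauss//; last exact: measurable_funeneg.
apply: eq_integral => z _; rewrite !funenegE /= -!EFin_max -EFinM; congr EFin.
by rewrite mulrC maxr_pMr ?gauss_density_ge0// mulr0 mulrN.
Qed.

Lemma cintegral_gauss (f : 'rV[R[i]]_n -> R[i]) : cmeas f ->
  cintegral (gauss s) f = cint (leb n) (fun z => (gauss_density s z)%:C * f z)%R.
Proof.
move=> [mRe mIm]; rewrite cintE /cintegral /Rintegral; congr (fine _ +i* fine _).
  by rewrite integral_gauss//; apply: eq_integral => z _; rewrite /= Re_mulr.
by rewrite integral_gauss//; apply: eq_integral => z _; rewrite /= Im_mulr.
Qed.

End gauss_density.

End GaussianIntegrals.

(* A curried form of [cexpD]: rewriting with [mulrA] would unfold [cexp] into a
   product. *)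
Lemma cexpDM (R : realType) (a b u : R[i]) : cexp a * (cexp b * u) = cexp (a + b) * u.
Proof. by rewrite cexpD [LHS]mulrA. Qed.

(** * Integrals of holomorphic functions against Gaussians *)

Section MeanValue.
Variables (R : realType) (n : nat).
Local Notation Cn := ('rV[R[i]]_n).
Local Notation mu := (@lebesgue_measure R).
Local Notation leb := (lebesgue_Cn R n).

Lemma Hol_cmeas (U : Cn -> R[i]) : Hol U -> cmeas U.
Proof. by move=> hU; apply: continuous_cmeas => z; exact: differentiable_continuous. Qed.

Lemma Hol_cdot (b : Cn) : Hol (fun z : Cn => cdot z b).
Proof.
move=> z; rewrite /cdot.
have -> : (fun z : Cn => \sum_j z 0 j * (b 0 j)^*%R) =
  \sum_(j < n) (fun z : Cn => z 0 j * (b 0 j)^*%R).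
  by apply/funext => x; rewrite fct_sumE.
apply: differentiable_sum => j; apply: differentiableM; last exact: differentiable_cst.
exact: differentiable_coord.
Qed.

Lemma Hol_cexp_cdot (b : Cn) : Hol (fun z : Cn => cexp (cdot z b)).
Proof.
move=> z; apply: (@differentiable_comp _ _ _ _ (fun z : Cn => cdot z b) (@cexp R)).
  exact: Hol_cdot.
exact: differentiable_cexp.
Qed.

Lemma HolM (U W : Cn -> R[i]) : Hol U -> Hol W -> Hol (fun z => U z * W z).
Proof. by move=> hU hW z; apply: differentiableM; [exact: hU|exact: hW]. Qed.

Lemma Hol_shift (U : Cn -> R[i]) (a : Cn) : Hol U -> Hol (fun z => U (z + a)).
Proof.
move=> hU z; apply: (@differentiable_comp _ _ _ _ (fun z : Cn => z + a) U); last exact: hU.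
by apply: differentiableD; [exact: ex_diff|exact: differentiable_cst].
Qed.

Lemma gaussian_cexp (c : R) (z : Cn) : (gaussian c z)%:C = cexp (- (c%:C * cdot z z)).
Proof. by rewrite /gaussian -cexp_real cdot_self -rmorphM -rmorphN. Qed.

Let e (x : R) : R[i] := cos x +i* sin x.

Let normc_e x : normc (e x) = 1.
Proof. by rewrite /= cos2Dsin2 sqrtr1. Qed.

Let measurable_rot : measurable_fun setT
  (fun xw : measurableTypeR R * Cn => e xw.1 *: xw.2).
Proof.
apply/measurable_recoordP => j.
have mc : measurable_fun setT (fun xw : measurableTypeR R * Cn => cos xw.1).
  apply: (@measurableT_comp _ _ _ _ _ _ (@cos R : measurableTypeR R -> measurableTypeR R)) => //.
  by apply: continuous_measurable_fun; exact: continuous_cos.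
have ms : measurable_fun setT (fun xw : measurableTypeR R * Cn => sin xw.1).
  apply: (@measurableT_comp _ _ _ _ _ _ (@sin R : measurableTypeR R -> measurableTypeR R)) => //.
  by apply: continuous_measurable_fun; exact: continuous_sin.
have mz : cmeas (fun xw : measurableTypeR R * Cn => xw.2 0 j).
  by apply: (cmeas_comp (f := fun z : Cn => z 0 j)) => //; exact: measurable_coord.
have [m1 m2] := cmeasM (conj mc ms : cmeas (fun xw : measurableTypeR R * Cn => e xw.1)) mz.
rewrite (_ : _ \o _ = (fun xw : measurableTypeR R * Cn =>
   (Re (e xw.1 * xw.2 0 j), Im (e xw.1 * xw.2 0 j)))); last first.
  by apply/funext => xw; rewrite /recoord /= !mxE.
exact: measurable_fun_pair.
Qed.

(* Averaging over the rotations w |-> e^{ix} w, which preserve Lebesgue measure,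
   reduces the claim to the mean value property on circles. *)
Lemma mean_value (U : Cn -> R[i]) (c : R) : 0 < c -> Hol U ->
  cintble leb (fun z => (gaussian c z)%:C * U z) ->
  cint leb (fun z => (gaussian c z)%:C * U z) = ((pi / c) ^+ n)%:C * U 0.
Proof.
move=> c0 hU Ui; have mU := Hol_cmeas hU.
pose I01 (x : R) : R := \1_(`[0, (2 * pi)[%classic) x.
pose F (xw : measurableTypeR R * Cn) : R[i] :=
  (I01 xw.1)%:C * ((gaussian c xw.2)%:C * U (e xw.1 *: xw.2)).
have pi2 : 0 <= 2 * pi :> R by rewrite mulr_ge0// pi_ge0.
have rotP x : mpreserving leb (fun z => e x *: z).
  have := @mpreserving_affine_Cn R n (e x) 0 (normc_e x).
  by congr mpreserving; apply/funext => z; rewrite addr0.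
have gr x z : gaussian c (e x *: z) = gaussian c z.
  by rewrite /gaussian sqnormZ normc_e expr1n mul1r.
have mg : cmeas (fun z : Cn => (gaussian c z)%:C).
  by apply: cmeas_real; exact: measurable_gaussian.
have mI : measurable_fun [set: measurableTypeR R] I01 by exact: measurable_indic.
have mF : cmeas F.
  apply: cmeasM.
    apply: cmeas_real; exact: (measurableT_comp mI).
  apply: cmeasM; first exact: (cmeas_comp mg measurable_snd).
  exact: (cmeas_comp mU measurable_rot).
have rotE x : cint leb (fun w => (gaussian c w)%:C * U (e x *: w)) =
    cint leb (fun z => (gaussian c z)%:C * U z).
  rewrite -[RHS](cint_mpreserving (rotP x)); first by apply: eq_cint => w; rewrite gr.
  exact: cmeasM.
have rotI x : cintble leb (fun w => (gaussian c w)%:C * U (e x *: w)).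
  have := cintble_mpreserving (rotP x) Ui.
  by congr cintble; apply/funext => w; rewrite gr.
have Fi : cintble (mu \x leb)%E F.
  apply: cintble_prod => //.
  apply: (@le_lt_trans _ _ (\int[mu]_x ((I01 x)%:E *
      \int[leb]_w (normc ((gaussian c w)%:C * U w))%:E))%E).
    rewrite le_eqVlt; apply/orP; left; apply/eqP; apply: eq_integral => x _.
    have I0 : 0 <= I01 x by rewrite /I01 indicE; case: (_ \in _).
    under eq_integral do rewrite /F Normc.normcM normc_real (ger0_norm I0).
    rewrite ge0_integral_scale//; last 2 first.
    - by apply: measurable_normc; case: (rotI x).
    - by move=> w; exact: normc_ge0.
    congr (_ * _)%E; rewrite -[RHS](integral_mpreserving (rotP x)); last first.
      by apply: measurable_enormc; case: Ui.
    by apply: eq_integral => w _; rewrite gr.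
  have [_] := Ui; case E : (\int[leb]_w _)%E => [r| |] // _; last first.
    have : (0 <= \int[leb]_w (normc ((gaussian c w)%:C * U w))%:E)%E.
      by apply: integral_ge0 => w _; rewrite lee_fin normc_ge0.
    by rewrite E.
  rewrite ge0_integralZr//; last 3 first.
  - exact/measurable_EFinP.
  - by move=> x _; rewrite lee_fin /I01 indicE; case: (_ \in _).
  - by rewrite -E; apply: integral_ge0 => w _; rewrite lee_fin normc_ge0.
  rewrite integral_indic// setIT.
  rewrite [X in (X * _)%E](_ : _ = (2 * pi)%:E); first by rewrite -EFinM ltry.
  have := @lebesgue_measure_itv R `[0, 2 * pi[ => /= ->; rewrite lte_fin.
  by have [//|] := ltP; [rewrite -EFinB subr0|move=> h; congr EFin; apply/le_anti; rewrite h pi2].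
have := cint_fubini Fi.
have -> : cint mu (fun x => cint leb (fun w => F (x, w))) =
    (2 * pi)%:C * cint leb (fun z => (gaussian c z)%:C * U z).
  rewrite -[2 * pi]subr0 -itvint_cst// /itvint; apply: eq_cint => x.
  by rewrite /F /= cintZ ?rotE ?subr0//; exact: rotI.
have -> : cint leb (fun w => cint mu (fun x => F (x, w))) =
    (2 * pi)%:C * (((pi / c) ^+ n)%:C * U 0).
  transitivity (cint leb (fun w => ((2 * pi)%:C * U 0) * (gaussian c w)%:C)).
    (* U 0 becomes U (0 *: w), the value at the centre of the entire function y |-> U (y *: w) of
       one variable. *)
    apply: eq_cint => w; rewrite -(scale0r w).
    have dg (z : R[i]) : differentiable (fun y : R[i] => U (y *: w)) z.
      apply: (@differentiable_comp _ _ _ _ (fun y : R[i] => y *: w) U); last exact: hU.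
      by apply: differentiableZl; exact: ex_diff.
    have := circle_mean dg; rewrite /= => <-.
    rewrite /itvint mulrC -cintZ.
      by apply: eq_cint => x; rewrite /F /= mulrCA.
    apply: cintble_itv => //; apply: ccontP => x r r0.
    have cg : {for (e x), continuous (fun y : R[i] => U (y *: w))} by exact: differentiable_continuous.
    move: cg => /cvgrPdist_lt/(_ r%:C); rewrite ltcR => /(_ r0)/near_complexP[d d0 dP].
    have d2 : 0 < d / 2 by rewrite divr_gt0.
    have /cvgrPdist_lt/(_ _ d2)/nbhs_normP[d1 /= d10 d1P] := @continuous_cos R x.
    have /cvgrPdist_lt/(_ _ d2)/nbhs_normP[d3 /= d30 d3P] := @continuous_sin R x.
    exists (Num.min d1 d3); first by rewrite lt_min d10.
    move=> y; rewrite lt_min => /andP[y1 y3]; rewrite -ltc_normc distrC; apply: dP.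
    apply: le_lt_trans (normc_leD _) _; rewrite ReB ImB /= [ltRHS]splitr ltrD//.
      by rewrite distrC; apply: d1P; rewrite /= distrC.
    by rewrite distrC; apply: d3P; rewrite /= distrC.
  have gi : cintble leb (fun w : Cn => (gaussian c w)%:C).
    split => //; under eq_integral do rewrite normc_real ger0_norm ?gaussian_ge0//.
    exact: integral_gaussian_lty.
  rewrite cintZ// mulrAC -mulrA; congr (_ * (_ * _)).
  rewrite cintE /Rintegral /= integral0 (integral_gaussian n c0) //.
have p0 : (2 * pi)%:C != 0 :> R[i].
  by rewrite -normc_eq0 normc_real normr_eq0 mulf_neq0 ?pnatr_eq0// gt_eqF ?pi_gt0.
by move=> /(mulfI p0).
Qed.

(** Translation by a cancels the antiholomorphic term c <a, v>. Apart from -c|v|^2 and the constant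
    <a, q>, the remaining exponent <v, q - c a> is holomorphic in v and joins U, so that
    [mean_value] applies. *)
Lemma gaussian_shift (U : Cn -> R[i]) (c : R) (a q : Cn) : 0 < c -> Hol U ->
  cintble leb (fun v => cexp (- (c%:C * cdot v v) + c%:C * cdot a v + cdot v q) * U v) ->
  cint leb (fun v => cexp (- (c%:C * cdot v v) + c%:C * cdot a v + cdot v q) * U v) =
  ((pi / c) ^+ n)%:C * (cexp (cdot a q) * U a).
Proof.
move=> c0 hU Ui.
have sP : mpreserving leb (fun z => z + a).
  have := @mpreserving_affine_Cn R n 1 a (Normc.normc1 _).
  by congr mpreserving; apply/funext => z; rewrite scale1r.
pose W (v : Cn) : R[i] := cexp (cdot v (q - c%:C *: a)) * U (v + a).
have hW : Hol W by apply: HolM; [exact: Hol_cexp_cdot|exact: Hol_shift].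
have E v : cexp (- (c%:C * cdot (v + a) (v + a)) + c%:C * cdot a (v + a) + cdot (v + a) q) * U (v + a)
   = cexp (cdot a q) * ((gaussian c v)%:C * W v).
  rewrite gaussian_cexp /W !cexpDM; congr (cexp _ * _).
  by rewrite !cdotDl !cdotDr !cdotNr !cdotZrr; ring.
have Wi : cintble leb (fun v => (gaussian c v)%:C * W v).
  have := cintbleZ (cexp (- cdot a q)) (cintble_mpreserving sP Ui).
  congr cintble; apply/funext => v; by rewrite E cexpDM addNr cexp0 mul1r.
rewrite -[LHS](cint_mpreserving sP); last by case: Ui.
under eq_cint do rewrite E.
rewrite cintZ// mean_value// /W cdot0l cexp0 mul1r add0r.
by rewrite mulrCA.
Qed.

End MeanValue.

(** * Fock norms and the projection *)

Section WeightedNorms.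
Variables (R : realType) (n : nat) (p t : {posnum R}).
Local Notation Cn := ('rV[R[i]]_n).
Local Notation leb := (lebesgue_Cn R n).
Local Notation P := (p%:num).
Local Notation T := (t%:num).
Implicit Types (f g h : Cn -> R[i]) (z w : Cn).

(* For every p, the norm of F_t^p is a multiple of the L^p(dV) norm of [u * wt]. *)
Definition wt z : R := gaussian (2 * T)^-1 z.

Lemma wt_gt0 z : 0 < wt z. Proof. exact: expR_gt0. Qed.
Lemma wt_ge0 z : 0 <= wt z. Proof. exact: expR_ge0. Qed.

(** The p-th power of the norm up to the factor [fock_cst], kept in the extended reals so that
    estimates can be stated before finiteness is known. *)
Definition wint f : \bar R := (\int[leb]_z ((normc (f z) * wt z) `^ P)%:E)%E.

Lemma wint_ge0 f : (0 <= wint f)%E.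
Proof. by apply: integral_ge0 => z _; rewrite lee_fin powR_ge0. Qed.

Lemma measurable_wnorm f : cmeas f ->
  measurable_fun setT (fun z => (normc (f z) * wt z) `^ P).
Proof.
move=> mf; apply: (measurableT_comp (@measurable_powR R P)).
apply: measurable_funM; [exact: measurable_normc|exact: measurable_gaussian].
Qed.

Definition fock_cst : R := (pi * (2 * T / P)) ^- n.

Lemma fock_cst_gt0 : 0 < fock_cst.
Proof. by rewrite invr_gt0 exprn_gt0// mulr_gt0 ?pi_gt0. Qed.

Lemma wt_powR z : wt z `^ P = expR (- sqnorm z / (2 * T / P)).
Proof.
rewrite /wt /gaussian -expRM; congr expR.
by field; rewrite !gt_eqF.
Qed.

Lemma fock_integral f : cmeas f ->
  (\int[fock_measure n p t]_z (normc (f z) `^ P)%:E = fock_cst%:E * wint f)%E.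
Proof.
move=> mf; rewrite /fock_measure ge0_integral_gauss; last 2 first.
- apply/measurable_EFinP; apply: (measurableT_comp (@measurable_powR R P)).
  exact: measurable_normc.
- by move=> z; rewrite lee_fin powR_ge0.
rewrite /wint -ge0_integral_scale; last 3 first.
- exact: measurable_wnorm.
- by move=> z; exact: powR_ge0.
- exact/ltW/fock_cst_gt0.
apply: eq_integral => z _; rewrite -EFinM; congr EFin.
rewrite powRM ?normc_ge0 ?wt_ge0// wt_powR /gauss_density /fock_cst.
by rewrite [LHS]mulrCA.
Qed.

Lemma wint_fin f : cmeas f -> (Lp_norm (fock_measure n p t) P f < +oo)%E = (wint f < +oo)%E.
Proof.
move=> mf; rewrite Lp_norm_fin fock_integral//.
have := wint_ge0 f; case: (wint f) => [r| |] //= _; first by rewrite -EFinM !ltry.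
by rewrite gt0_muley// lte_fin fock_cst_gt0.
Qed.

Lemma fock_memP f : (f \in fock_pred p t) <-> [/\ cmeas f, (wint f < +oo)%E & Hol f].
Proof.
rewrite /fock_pred inE; split.
  by move=> [[mf foo] hf]; split => //; rewrite -wint_fin.
by move=> [mf foo hf]; split => //; split => //; rewrite wint_fin.
Qed.

Definition wnorm f : R := (fock_cst * fine (wint f)) `^ P^-1.

Lemma Lp_norm_wnorm f : cmeas f -> (wint f < +oo)%E ->
  Lp_norm (fock_measure n p t) P f = (wnorm f)%:E.
Proof.
move=> mf foo; rewrite /Lp_norm unlock.
have -> : (\int[fock_measure n p t]_x `|(EFin \o (normc \o f)) x| `^ P)%E =
          (\int[fock_measure n p t]_z (normc (f z) `^ P)%:E)%E.
  by apply: eq_integral => z _; rewrite /= ger0_norm// normc_ge0.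
rewrite fock_integral// /wnorm.
have := wint_ge0 f; case: (wint f) foo => [r| |] //= _ _.
Qed.

Lemma fock_valP (u : fock n p t) : [/\ cmeas u, (wint u < +oo)%E & Hol u].
Proof. by apply/fock_memP; case: u. Qed.

Lemma fock_normE (u : fock n p t) : fock_norm u = wnorm u.
Proof. by have [? ? ?] := fock_valP u; rewrite /fock_norm Lp_norm_wnorm. Qed.

Lemma fock_norm_ge0 (u : fock n p t) : 0 <= fock_norm u.
Proof. by rewrite fock_normE powR_ge0. Qed.

Lemma fock_norm_le (u v : fock n p t) (C : R) : 0 <= C ->
  (wint u <= (C `^ P)%:E * wint v)%E -> fock_norm u <= C * fock_norm v.
Proof.
move=> C0; rewrite !fock_normE /wnorm.
have [_ uoo _] := fock_valP u; have [_ voo _] := fock_valP v.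
have := wint_ge0 u; have := wint_ge0 v.
case: (wint u) uoo => [a| |] // _; case: (wint v) voo => [b| |] // _.
rewrite !lee_fin /= => b0 a0 ab.
have -> : C = (C `^ P) `^ P^-1 by rewrite -powRrM divff ?gt_eqF// powRr1.
have k0 := ltW fock_cst_gt0.
have ka : 0 <= fock_cst * a by exact: mulr_ge0.
have kb : 0 <= fock_cst * b by exact: mulr_ge0.
have CP : 0 <= C `^ P by exact: powR_ge0.
rewrite -powRM//; apply: ge0_ler_powR; rewrite ?invr_ge0 ?nnegrE//.
  exact: mulr_ge0.
by have := ler_wpM2l k0 ab; rewrite mulrCA.
Qed.

Lemma wint_norm (u : fock n p t) : (wint u)%E = (fock_norm u `^ P / fock_cst)%:E.
Proof.
have [_ uoo _] := fock_valP u; rewrite fock_normE /wnorm -powRrM mulVf ?gt_eqF//.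
have := wint_ge0 u; case: (wint u) uoo => [a| |] // _; rewrite lee_fin => a0.
have k0 := fock_cst_gt0.
by rewrite -[fine _]/a powRr1 ?mulr_ge0 ?(ltW k0)// [fock_cst * a]mulrC mulfK// gt_eqF.
Qed.

Lemma fock_normZ (a : R[i]) (u : fock n p t) : fock_norm (a *: u) = normc a * fock_norm u.
Proof.
have [mu uoo _] := fock_valP u.
have E : (wint (a *: u) = ((normc a) `^ P)%:E * wint u)%E.
  rewrite /wint -ge0_integral_scale; last 3 first.
  - exact: measurable_wnorm.
  - by move=> z; exact: powR_ge0.
  - exact: powR_ge0.
  apply: eq_integral => z _; congr EFin.
  by rewrite -powRM ?normc_ge0 ?mulr_ge0 ?normc_ge0 ?wt_ge0// mulrA -Normc.normcM.
rewrite !fock_normE /wnorm [wint (a *: u)]E.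
have := wint_ge0 u; case: (wint u) uoo => [r| |] // _; rewrite lee_fin => r0.
have -> : fine ((normc a `^ P)%:E * r%:E)%E = normc a `^ P * r by [].
rewrite -[fine _]/r [fock_cst * (_ * _)]mulrCA [LHS]powRM ?powR_ge0 ?mulr_ge0 ?(ltW fock_cst_gt0)//.
by rewrite -powRrM divff ?gt_eqF// powRr1 ?normc_ge0.
Qed.

(** Minkowski's inequality for the real functions |u| and |v|, then monotonicity of the norm under
    |u + v| <= |u| + |v|. *)
Lemma fock_normD (u v : fock n p t) : 1 <= P ->
  fock_norm (u + v) <= fock_norm u + fock_norm v.
Proof.
move=> p1; have [mu uoo _] := fock_valP u; have [mv voo _] := fock_valP v.
have [muv uvoo _] := fock_valP (u + v).
have := minkowski_EFin (fock_measure n p t) (measurable_normc mu) (measurable_normc mv) p1.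
rewrite -[X in (_ <= X + _)%E]/(Lp_norm _ _ _) -[X in (_ <= _ + X)%E]/(Lp_norm _ _ _).
rewrite !Lp_norm_wnorm// -EFinD -!fock_normE => H.
rewrite -lee_fin; apply: le_trans H; rewrite fock_normE -Lp_norm_wnorm// /Lp_norm.
have p0 : P != 0 by rewrite gt_eqF.
have L (h : Cn -> R) : ('N[fock_measure n p t]_P%:E[EFin \o h])%E =
   ((\int[fock_measure n p t]_x `|(h x)%:E| `^ P) `^ P^-1)%E by rewrite unlock.
rewrite !L; apply: gt0_ler_poweR; rewrite ?invr_ge0//.
- by rewrite in_itv/= leey integral_ge0// => x _; exact: poweR_ge0.
- by rewrite in_itv/= leey integral_ge0// => x _; exact: poweR_ge0.
have mm (h : Cn -> R) : measurable_fun setT h ->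
    measurable_fun setT (fun x => (`|(h x)%:E| `^ P)%E).
  move=> mh; have -> : (fun x => (`|(h x)%:E| `^ P)%E) = EFin \o (fun x => `|h x| `^ P) by [].
  apply/measurable_EFinP; apply: (measurableT_comp (@measurable_powR R P)).
  exact: measurableT_comp.
apply: ge0_le_integral => //.
- by move=> x _; exact: poweR_ge0.
- by apply: mm; exact: measurable_normc.
- by apply: mm; apply: measurable_funD; exact: measurable_normc.
- move=> x _; rewrite /= lee_fin; apply: ge0_ler_powR => //.
  by rewrite !ger0_norm ?addr_ge0 ?normc_ge0// le_normcD.
Qed.

Section integrability.
Hypothesis p1 : 1 <= P.

(** Bounds [cdot] term by term ([normc_cdot_le]), in place of Cauchy-Schwarz; by [l1norm_le] its
    exponentials are absorbed by any Gaussian. *)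
Definition l1norm w : R := \sum_j normc (w 0 j).

Lemma l1norm_ge0 w : 0 <= l1norm w.
Proof. by apply: sumr_ge0 => j _; exact: normc_ge0. Qed.

Lemma measurable_l1norm : measurable_fun setT l1norm.
Proof. by apply: measurable_sum => j; apply: measurable_normc; exact: measurable_coord. Qed.

Lemma l1norm_le (l d : R) w : 0 < d -> l * l1norm w <= d * sqnorm w + n%:R * (l ^+ 2 / (4 * d)).
Proof.
move=> d0; rewrite /l1norm sqnormE !mulr_sumr.
have -> : n%:R * (l ^+ 2 / (4 * d)) = \sum_(j < n) (l ^+ 2 / (4 * d)).
  by rewrite sumr_const card_ord mulr_natl.
rewrite -big_split /=; apply: ler_sum => j _; set x := normc _.
rewrite -subr_ge0; have -> : d * x ^+ 2 + l ^+ 2 / (4 * d) - l * x = d * (x - l / (2 * d)) ^+ 2.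
  by field; rewrite gt_eqF.
by rewrite mulr_ge0 ?sqr_ge0 ?ltW.
Qed.

Lemma powR_ge_self (x : R) : 0 <= x -> x <= 1 + x `^ P.
Proof.
move=> x0; have [x1|x1] := leP x 1; first by rewrite ler_wpDr ?powR_ge0.
rewrite ler_wpDl// -[leLHS]powRr1//; apply: ler_powR => //; exact: ltW.
Qed.

(** The surplus c - 1/(2t) of decay over the weight is split in two halves: one absorbs the
    exponential of [l1norm], the other leaves an integrable Gaussian. The inequality x <= 1 + x^p
    then stands in for Hölder's. *)
Lemma Lp_weighted_lty f (c l : R) : (2 * T)^-1 < c -> cmeas f -> (wint f < +oo)%E ->
  (\int[leb]_w (normc (f w) * (gaussian c w * expR (l * l1norm w)))%:E < +oo)%E.
Proof.
move=> cT mf foo; pose d := (c - (2 * T)^-1) / 2.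
have d0 : 0 < d by rewrite divr_gt0// subr_gt0.
pose C := expR (n%:R * (l ^+ 2 / (4 * d))).
have C0 : 0 <= C by exact: expR_ge0.
have mg : measurable_fun setT (@gaussian R n d) by exact: measurable_gaussian.
apply: (@le_lt_trans _ _ (\int[leb]_w (C * (gaussian d w + (normc (f w) * wt w) `^ P))%:E)%E).
  apply: ge0_le_integral => //.
  - by move=> w _; rewrite lee_fin !mulr_ge0 ?normc_ge0 ?expR_ge0.
  - apply/measurable_EFinP; apply: measurable_funM; first exact: measurable_normc.
    apply: measurable_funM; first exact: measurable_gaussian.
    apply: (measurableT_comp (@measurable_expR R)); apply: measurable_funM => //.
    exact: measurable_l1norm.
  - apply/measurable_EFinP; apply: measurable_funM => //; apply: measurable_funD => //.
    exact: measurable_wnorm.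
  move=> w _; rewrite lee_fin.
  have E : gaussian c w * expR (l * l1norm w) <= C * (wt w * gaussian d w).
    rewrite /wt /gaussian /C -!expRD ler_expR.
    have := l1norm_le l w d0.
    have -> : c = 2 * d + (2 * T)^-1 by rewrite /d mulrC mulfVK// subrK.
    set A := l * _; set B := n%:R * _; set D := (2 * T)^-1; set q := sqnorm w.
    by move: A B D q => A B D q; lra.
  apply: le_trans (ler_wpM2l (normc_ge0 _) E) _.
  rewrite mulrCA ler_wpM2l// mulrA.
  have H0 : 0 <= normc (f w) * wt w by rewrite mulr_ge0 ?normc_ge0 ?wt_ge0.
  have g0 := gaussian_ge0 d w.
  have g1 : gaussian d w <= 1.
    by rewrite /gaussian -expR0 ler_expR oppr_le0 mulr_ge0 ?sqnorm_ge0 ?ltW.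
  apply: le_trans (ler_wpM2r g0 (powR_ge_self H0)) _.
  by rewrite mulrDl mul1r lerD2l ler_piMr ?powR_ge0.
rewrite ge0_integral_scale//; last 2 first.
- by apply: measurable_funD => //; exact: measurable_wnorm.
- by move=> w; rewrite addr_ge0 ?gaussian_ge0 ?powR_ge0.
under eq_integral do rewrite EFinD.
rewrite ge0_integralD//; last 4 first.
- by move=> w _; rewrite lee_fin gaussian_ge0.
- exact/measurable_EFinP.
- by move=> w _; rewrite lee_fin powR_ge0.
- by apply/measurable_EFinP; exact: measurable_wnorm.
by rewrite lte_mul_pinfty ?lee_fin// lte_add_pinfty// integral_gaussian_lty.
Qed.

Lemma cintble_weighted f g (K c l : R) : (2 * T)^-1 < c -> cmeas f -> (wint f < +oo)%E ->
  cmeas g -> (forall w, normc (g w) <= K * (gaussian c w * expR (l * l1norm w))) ->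
  cintble leb (fun w => g w * f w).
Proof.
move=> cT mf foo mg gK; split; first exact: cmeasM.
have K0 : 0 <= Num.max K 0 by rewrite le_max lexx orbT.
have ml : measurable_fun setT (fun w : Cn => gaussian c w * expR (l * l1norm w)).
  apply: measurable_funM; first exact: measurable_gaussian.
  apply: (measurableT_comp (@measurable_expR R)); apply: measurable_funM => //.
  exact: measurable_l1norm.
apply: (@le_lt_trans _ _ (\int[leb]_w (Num.max K 0 *
    (normc (f w) * (gaussian c w * expR (l * l1norm w))))%:E)%E).
  apply: ge0_le_integral => //.
  - by move=> w _; rewrite lee_fin normc_ge0.
  - by apply: measurable_enormc; exact: cmeasM.
  - apply/measurable_EFinP; apply: measurable_funM => //; apply: measurable_funM => //.
    exact: measurable_normc.
  move=> w _; rewrite lee_fin Normc.normcM mulrC mulrCA ler_wpM2l ?normc_ge0//.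
  apply: le_trans (gK w) _; rewrite ler_wpM2r ?mulr_ge0 ?expR_ge0//.
  by rewrite le_max lexx.
rewrite ge0_integral_scale//.
- by rewrite lte_mul_pinfty ?lee_fin// Lp_weighted_lty.
- by apply: measurable_funM => //; exact: measurable_normc.
- by move=> w; rewrite !mulr_ge0 ?normc_ge0 ?expR_ge0.
Qed.

End integrability.

End WeightedNorms.

Section MeasurableCdot.
Variables (R : realType) (n : nat).
Local Notation Cn := ('rV[R[i]]_n).
Context d (X : measurableType d).

Lemma cmeas_coord (F : X -> Cn) j : measurable_fun setT F -> cmeas (fun x => F x 0 j).
Proof. by move=> mF; exact: (cmeas_comp (@measurable_coord R n j) mF). Qed.

Lemma measurable_Cn (F : X -> Cn) : (forall j, cmeas (fun x => F x 0 j)) -> measurable_fun setT F.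
Proof.
by move=> mF; apply/measurable_recoordP => j; have [? ?] := mF j; apply: measurable_fun_pair.
Qed.

Lemma cmeas_cdot (F G : X -> Cn) : measurable_fun setT F -> measurable_fun setT G ->
  cmeas (fun x => cdot (F x) (G x)).
Proof.
move=> mF mG; apply: cmeas_sum => j; apply: cmeasM; first exact: cmeas_coord.
by apply: cmeas_conj; exact: cmeas_coord.
Qed.

Lemma measurable_CnB (F G : X -> Cn) : measurable_fun setT F -> measurable_fun setT G ->
  measurable_fun setT (fun x => F x - G x).
Proof.
move=> mF mG; apply: measurable_Cn => j.
have := cmeasB (cmeas_coord j mF) (cmeas_coord j mG).
by congr cmeas; apply/funext => x; rewrite !mxE.
Qed.

End MeasurableCdot.

(** * Jensen's inequality for powers *)

Section Jensen.
Variables (R : realType) (P : R).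
Hypothesis p1 : 1 < P.

(** The graph of x^P lies above its tangent at m; this is Young's inequality for x and m^(P-1) with
    the exponents P and P/(P-1). *)
Lemma powR_tangent (m x : R) : 0 <= m -> 0 <= x ->
  P * m `^ (P - 1) * x <= x `^ P + (P - 1) * m `^ P.
Proof.
move=> m0 x0; have P0 : 0 < P by apply: lt_trans p1.
have P10 : 0 < P - 1 by rewrite subr_gt0.
have q0 : 0 < P / (P - 1) by rewrite divr_gt0.
have pq : P^-1 + (P / (P - 1))^-1 = 1 by field; rewrite !gt_eqF.
have := conjugate_powR x0 (powR_ge0 m (P - 1)) P0 q0 pq.
rewrite -powRrM mulrC (_ : (P - 1) * (P / (P - 1)) = P); last by field; rewrite gt_eqF.
move=> H; have := ler_wpM2l (ltW P0) H.
rewrite mulrA; congr (_ <= _).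
by field; rewrite !gt_eqF.
Qed.

(** The tangent inequality at m, integrated against the probability density k. Only a lower bound m
    of the mean enters, so the mean itself may be infinite. *)
Lemma jensen_powR d (X : measurableType d) (mu : {measure set X -> \bar R})
    (k H : X -> R) (m : R) :
  measurable_fun setT k -> measurable_fun setT H ->
  (forall x, 0 <= k x) -> (forall x, 0 <= H x) ->
  (\int[mu]_x (k x)%:E = 1)%E -> 0 <= m -> (m%:E <= \int[mu]_x (k x * H x)%:E)%E ->
  ((m `^ P)%:E <= \int[mu]_x (k x * H x `^ P)%:E)%E.
Proof.
move=> mk mH k0 H0 k1; rewrite le_eqVlt => /predU1P[<- _|m0 mle].
  rewrite powR0 ?gt_eqF ?(lt_trans _ p1)//.
  by apply: integral_ge0 => x _; rewrite lee_fin mulr_ge0 ?powR_ge0.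
have P0 : 0 < P by apply: lt_trans p1.
have mHP : measurable_fun setT (fun x => k x * H x `^ P).
  apply: measurable_funM => //; exact: (measurableT_comp (@measurable_powR R P)).
have c0 : 0 <= P * m `^ (P - 1) by rewrite mulr_ge0 ?powR_ge0 ?ltW.
have : ((P * m `^ P)%:E <= \int[mu]_x (k x * H x `^ P)%:E + ((P - 1) * m `^ P)%:E)%E.
  have -> : P * m `^ P = P * m `^ (P - 1) * m.
    rewrite -mulrA; congr (_ * _); rewrite -[X in _ = _ * X]powRr1 ?ltW//.
    by rewrite -powRD ?subrK// (gt_eqF m0) implybT.
  rewrite EFinM; apply: le_trans (lee_wpmul2l _ mle) _; first by rewrite lee_fin.
  rewrite -ge0_integral_scale//; last 2 first.
  - exact: measurable_funM.
  - by move=> x; rewrite mulr_ge0.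
  have -> : (((P - 1) * m `^ P)%:E = \int[mu]_x ((P - 1) * m `^ P * k x)%:E)%E.
    rewrite ge0_integral_scale// ?k1 ?mule1// mulr_ge0 ?powR_ge0//.
    by rewrite subr_ge0 ltW.
  have e0 : 0 <= (P - 1) * m `^ P by rewrite mulr_ge0 ?powR_ge0// subr_ge0 ltW.
  rewrite -ge0_integralD//; last 4 first.
  - by move=> x _; rewrite lee_fin mulr_ge0 ?powR_ge0 ?k0.
  - exact/measurable_EFinP.
  - by move=> x _; rewrite lee_fin mulr_ge0 ?k0.
  - by apply/measurable_EFinP; apply: measurable_funM; [exact: measurable_cst|].
  apply: ge0_le_integral => //.
  - by move=> x _; rewrite lee_fin !mulr_ge0 ?powR_ge0 ?k0 ?H0 ?(ltW P0).
  - apply/measurable_EFinP; apply: measurable_funM; [exact: measurable_cst|exact: measurable_funM].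
  - apply: emeasurable_funD; first exact/measurable_EFinP.
    by apply/measurable_EFinP; apply: measurable_funM; [exact: measurable_cst|].
  - move=> x _; rewrite -EFinD lee_fin.
    have := ler_wpM2l (k0 x) (powR_tangent (ltW m0) (H0 x)).
    by move: (m `^ _) (m `^ P) (H x `^ P) (k x) (H x) => a b c e f; lra.
have : (0 <= \int[mu]_x (k x * H x `^ P)%:E)%E.
  by apply: integral_ge0 => x _; rewrite lee_fin mulr_ge0 ?powR_ge0 ?k0.
case: (\int[mu]_x _)%E => [r| |] // _; last by move=> _; rewrite leey.
by rewrite -EFinD !lee_fin mulrBl mul1r => ?; lra.
Qed.

End Jensen.

(** * The kernel of P_t and its L^p bounds *)

Section Projection.
Variables (R : realType) (n : nat) (p t : {posnum R}).
Local Notation Cn := ('rV[R[i]]_n).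
Local Notation leb := (lebesgue_Cn R n).
Local Notation P := (p%:num).
Local Notation T := (t%:num).
Implicit Types (f g h : Cn -> R[i]) (z w : Cn).

(** The reproducing kernel multiplied by the density of [gauss t]: the integral kernel of P_t with
    respect to Lebesgue measure. *)
Definition kern z w : R[i] := (gauss_density t w)%:C * cexp (cdot z w / T%:C).

Definition kcst : R := (pi * T) ^- n.

Lemma kcst_gt0 : 0 < kcst.
Proof. by rewrite invr_gt0 exprn_gt0// mulr_gt0 ?pi_gt0. Qed.

Lemma gauss_densityE w : gauss_density t w = kcst * gaussian T^-1 w.
Proof. by rewrite /gauss_density /gaussian mulNr [_ / _]mulrC. Qed.

Lemma Re_divr z (a : R) (c : R[i]) : Re (c / a%:C) = Re c / a.
Proof. by rewrite -fmorphV mulrC Re_mulr mulrC. Qed.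

Lemma normc_kern z w : normc (kern z w) = kcst * (gaussian T^-1 w * expR (Re (cdot z w) / T)).
Proof.
rewrite /kern Normc.normcM normc_cexp normc_real ger0_norm ?gauss_density_ge0//.
by rewrite gauss_densityE -mulrA Re_divr.
Qed.

(** Completing the square: conjugated by the weights, the modulus of the kernel depends on z - w
    only. The bounds on all L^p come from this identity. *)
Lemma normc_kern_wt z w : normc (kern z w) * wt t z = kcst * gaussian (2 * T)^-1 (z - w) * wt t w.
Proof.
rewrite normc_kern /wt /gaussian -!mulrA -!expRD; congr (_ * expR _).
rewrite sqnormB; have T0 : T != 0 by rewrite gt_eqF.
by field.
Qed.

Lemma normc_cdot_le z w : normc (cdot z w) <= l1norm z * l1norm w.
Proof.
apply: le_trans (normc_sum _ _ _) _; rewrite /l1norm mulr_suml; apply: ler_sum => j _.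
rewrite Normc.normcM normc_conj ler_wpM2l ?normc_ge0// (bigD1 j)//= lerDl.
by rewrite sumr_ge0// => k _; exact: normc_ge0.
Qed.

Lemma normc_kern_le z w :
  normc (kern z w) <= kcst * (gaussian T^-1 w * expR (l1norm z / T * l1norm w)).
Proof.
rewrite normc_kern ler_wpM2l ?(ltW kcst_gt0)// ler_wpM2l ?expR_ge0// ler_expR.
rewrite mulrAC ler_wpM2r ?invr_ge0//; apply: le_trans (normc_cdot_le z w).
exact: le_trans (ler_norm _) (Re_le_normc _).
Qed.

Lemma cmeas_kern d (X : measurableType d) (F G : X -> Cn) :
  measurable_fun setT F -> measurable_fun setT G -> cmeas (fun x => kern (F x) (G x)).
Proof.
move=> mF mG; apply: cmeasM.
  apply: cmeas_real; apply: measurableT_comp => //; exact: measurable_gauss_density.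
apply: cmeas_cexp; under eq_fun do rewrite mulrC; apply: cmeasZ.
exact: cmeas_cdot.
Qed.

Lemma projE h z : cmeas h -> proj t h z = cint leb (fun w => kern z w * h w).
Proof.
move=> mh; rewrite /proj cintegral_gauss; last first.
  apply: cmeasM => //; apply: cmeas_cexp; under eq_fun do rewrite mulrC; apply: cmeasZ.
  by apply: cmeas_cdot => //; exact: measurable_cst.
by apply: eq_cint => w; rewrite mulrA.
Qed.

Hypothesis p1 : 1 < P.

Lemma half_lt_invT : (2 * T)^-1 < T^-1.
Proof. by rewrite invfM gtr_pMl ?invr_gt0// invf_lt1// ltr1n. Qed.

Lemma cintble_kern h z : cmeas h -> (wint p t h < +oo)%E ->
  cintble leb (fun w => kern z w * h w).
Proof.
move=> mh hoo; apply: (cintble_weighted (ltW p1) half_lt_invT mh hoo (K := kcst) (l := l1norm z / T)).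
  by apply: cmeas_kern => //; exact: measurable_cst.
by move=> w; exact: normc_kern_le.
Qed.

(* [normc (kern z w) * wt z = 2 ^+ n * ukern (z - w) * wt w], with [ukern] a
   probability density: this bounds the projection on every L^p. *)
Definition ukern z : R := 2 ^- n * (kcst * gaussian (2 * T)^-1 z).

Lemma ukern_ge0 z : 0 <= ukern z.
Proof.
apply: mulr_ge0; first by rewrite invr_ge0 exprn_ge0.
by apply: mulr_ge0; [exact: ltW kcst_gt0|exact: gaussian_ge0].
Qed.

Lemma measurable_ukern : measurable_fun setT ukern.
Proof. by do 2 apply: measurable_funM => //; exact: measurable_gaussian. Qed.

Lemma integral_ukern : (\int[leb]_z (ukern z)%:E = 1)%E.
Proof.
have T0 : 0 < (2 * T)^-1 by rewrite invr_gt0 mulr_gt0.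
have mg : measurable_fun setT (@gaussian R n (2 * T)^-1) by exact: measurable_gaussian.
have mkg : measurable_fun setT (fun z => kcst * gaussian (2 * T)^-1 z) by exact: measurable_funM.
have kg0 z : 0 <= kcst * gaussian (2 * T)^-1 z.
  by rewrite mulr_ge0 ?gaussian_ge0 ?(ltW kcst_gt0).
rewrite (ge0_integral_scale leb mkg kg0) ?invr_ge0 ?exprn_ge0//.
rewrite (ge0_integral_scale leb mg (gaussian_ge0 _)) ?(ltW kcst_gt0)//.
rewrite integral_gaussian// -!EFinM /kcst -!exprVn -!exprMn; congr EFin.
rewrite [X in X ^+ n](_ : _ = 1) ?expr1n//.
by have := pi_gt0 R; move: (pi : R) => x x0; field; rewrite !gt_eqF.
Qed.

Lemma affine1_mpreserving (a : Cn) : mpreserving leb (fun z => z + a).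
Proof.
have := @mpreserving_affine_Cn R n 1 a (Normc.normc1 _).
by congr mpreserving; apply/funext => z; rewrite scale1r.
Qed.

Lemma reflect_mpreserving (a : Cn) : mpreserving leb (fun z => a - z).
Proof.
have := @mpreserving_affine_Cn R n (-1) a; rewrite normcN => /(_ (Normc.normc1 _)).
by congr mpreserving; apply/funext => z; rewrite scaleN1r addrC.
Qed.

Lemma integral_ukern_shift z : (\int[leb]_w (ukern (z - w))%:E = 1)%E.
Proof.
rewrite -integral_ukern -[RHS](integral_mpreserving (reflect_mpreserving z))//.
by apply/measurable_EFinP; exact: measurable_ukern.
Qed.

Lemma integral_ukern_shift2 w : (\int[leb]_z (ukern (z - w))%:E = 1)%E.
Proof.
rewrite -integral_ukern -[RHS](integral_mpreserving (affine1_mpreserving (- w)))//.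
by apply/measurable_EFinP; exact: measurable_ukern.
Qed.

Lemma measurable_ukern_shift z : measurable_fun setT (fun w => ukern (z - w)).
Proof.
by apply: (measurableT_comp measurable_ukern); case: (reflect_mpreserving z).
Qed.

Lemma proj_wt_le h z : cmeas h -> (wint p t h < +oo)%E ->
  ((normc (proj t h z) * wt t z / 2 ^+ n)%:E <=
   \int[leb]_w (ukern (z - w) * (normc (h w) * wt t w))%:E)%E.
Proof.
move=> mh hoo; have ki := cintble_kern z mh hoo.
have c0 : 0 <= wt t z / 2 ^+ n by rewrite divr_ge0 ?wt_ge0 ?exprn_ge0.
rewrite projE// -mulrA [normc _ * _]mulrC EFinM.
apply: le_trans (lee_wpmul2l _ (cint_norm_le ki)) _; first by rewrite lee_fin.
rewrite -ge0_integral_scale//; last 2 first.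
- by apply: measurable_normc; case: ki.
- by move=> w; exact: normc_ge0.
rewrite le_eqVlt; apply/orP; left; apply/eqP; apply: eq_integral => w _; congr EFin.
rewrite Normc.normcM [wt t z / _]mulrC.
transitivity (2 ^- n * (normc (kern z w) * wt t z) * normc (h w)).
  by rewrite -!mulrA; congr (_ * _); rewrite mulrCA.
by rewrite normc_kern_wt /ukern -!mulrA; do 3 congr (_ * _); rewrite mulrC.
Qed.

Lemma jensen_proj h z : cmeas h -> (wint p t h < +oo)%E ->
  (((normc (proj t h z) * wt t z) `^ P)%:E <=
   ((2 ^+ n) `^ P)%:E * \int[leb]_w (ukern (z - w) * (normc (h w) * wt t w) `^ P)%:E)%E.
Proof.
move=> mh hoo.
have m0 : 0 <= normc (proj t h z) * wt t z / 2 ^+ n.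
  by rewrite divr_ge0 ?mulr_ge0 ?normc_ge0 ?wt_ge0 ?exprn_ge0.
have H0 w : 0 <= normc (h w) * wt t w by rewrite mulr_ge0 ?normc_ge0 ?wt_ge0.
have mH : measurable_fun setT (fun w => normc (h w) * wt t w).
  by apply: measurable_funM; [exact: measurable_normc|exact: measurable_gaussian].
have := jensen_powR p1 (measurable_ukern_shift z) mH (fun w => ukern_ge0 _) H0
  (integral_ukern_shift z) m0 (proj_wt_le z mh hoo).
move/(lee_wpmul2l (_ : (0 <= ((2 ^+ n) `^ P)%:E)%E)); rewrite lee_fin powR_ge0 => /(_ isT).
by rewrite -EFinM -powRM ?exprn_ge0// mulrC divfK ?expf_neq0.
Qed.

(** Jensen's inequality in w for each z, then Tonelli, where [ukern (z - w)] has mass 1 in z as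
    well. The operator bound 2^n is the mass of the unnormalized convolution kernel. *)
Lemma wint_proj h : cmeas h -> cmeas (proj t h) -> (wint p t h < +oo)%E ->
  (wint p t (proj t h) <= ((2 ^+ n) `^ P)%:E * wint p t h)%E.
Proof.
move=> mh mph hoo.
have mw := measurable_wnorm p t mh.
have mF : measurable_fun setT (fun zw : Cn * Cn =>
    (ukern (zw.1 - zw.2) * (normc (h zw.2) * wt t zw.2) `^ P)%:E).
  apply/measurable_EFinP; apply: measurable_funM; last exact: (measurableT_comp mw).
  by apply: (measurableT_comp measurable_ukern); exact: measurable_CnB.
have F0 (zw : Cn * Cn) : (0 <= (ukern (zw.1 - zw.2) * (normc (h zw.2) * wt t zw.2) `^ P)%:E)%E.
  by rewrite lee_fin mulr_ge0 ?powR_ge0 ?ukern_ge0.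
apply: (@le_trans _ _ (\int[leb]_z (((2 ^+ n) `^ P)%:E *
    \int[leb]_w (ukern (z - w) * (normc (h w) * wt t w) `^ P)%:E))%E).
  apply: ge0_le_integral => //.
  - by move=> z _; rewrite lee_fin powR_ge0.
  - by apply/measurable_EFinP; exact: measurable_wnorm.
  - apply: measurable_funeM.
    exact: (measurable_fun_fubini_tonelli_F (m2 := leb) _ mF F0).
  - by move=> z _; exact: jensen_proj.
have mG := measurable_fun_fubini_tonelli_F (m2 := leb) _ mF F0.
have G0 z : (0 <= fubini_F leb (fun zw : Cn * Cn =>
    (ukern (zw.1 - zw.2) * (normc (h zw.2) * wt t zw.2) `^ P)%:E) z)%E.
  by apply: integral_ge0 => w _; exact: (F0 (z, w)).
have c0 : (0 <= ((2 ^+ n) `^ P)%:E)%E by rewrite lee_fin powR_ge0.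
rewrite [leLHS](ge0_integralZl leb measurableT mG (fun z _ => G0 z) c0).
apply: lee_wpmul2l; first by rewrite lee_fin powR_ge0.
rewrite (fubini_tonelli (m1 := leb) (m2 := leb) _ mF F0) /wint /=.
rewrite le_eqVlt; apply/orP; left; apply/eqP; apply: eq_integral => w _.
under eq_integral do rewrite mulrC.
rewrite ge0_integral_scale ?powR_ge0//.
- by rewrite integral_ukern_shift2 mule1.
- by apply: (measurableT_comp measurable_ukern); case: (affine1_mpreserving (- w)).
- by move=> z; exact: ukern_ge0.
Qed.

End Projection.

(** * Holomorphy of P_t h, reproduction, and bounds of Toeplitz operators *)

Section HolomorphicProjection.
Variables (R : realType) (n : nat) (p t : {posnum R}).
Local Notation Cn := ('rV[R[i]]_n).
Local Notation leb := (lebesgue_Cn R n).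
Local Notation P := (p%:num).
Local Notation T := (t%:num).
Implicit Types (f g h : Cn -> R[i]) (z w k : Cn).
Hypothesis p1 : 1 < P.

Lemma normc_le_norm k j : normc (k 0 j) <= Re `|k|.
Proof.
have [nE n0] : `|k| = (Re `|k|)%:C /\ 0 <= Re `|k|.
  have : 0 <= `|k| by []. rewrite lecE /= => /andP[/eqP ih rh].
  by split => //; rewrite [LHS]complex_eta ih.
apply/ler_addgt0Pr => e e0.
have : ball (0 : Cn) (Re `|k| + e)%:C k.
  by rewrite -ball_normE /= sub0r normrN nE ltcR ltrDl.
by move=> [_ /(_ ord0 j)]; rewrite mxE -ball_normE /= sub0r normrN ltc_normc => /ltW.
Qed.

Lemma normc_cdot_norm k w : normc (cdot k w) <= Re `|k| * l1norm w.
Proof.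
apply: le_trans (normc_sum _ _ _) _; rewrite /l1norm mulr_sumr; apply: ler_sum => j _.
by rewrite Normc.normcM normc_conj ler_wpM2r ?normc_ge0// normc_le_norm.
Qed.

Lemma sqr_le_expR (x : R) : 0 <= x -> x ^+ 2 <= 4 * expR x.
Proof.
move=> x0; have -> : expR x = expR (x / 2) ^+ 2 by rewrite expr2 -expRD -splitr.
have : x / 2 <= expR (x / 2).
  by apply: le_trans (expR_ge1Dx _); rewrite ler_wpDl.
move=> h; have : (x / 2) ^+ 2 <= expR (x / 2) ^+ 2.
  by rewrite lerXn2r// nnegrE ?expR_ge0 ?divr_ge0.
by rewrite expr_div_n; move: (expR _ ^+ 2) (x ^+ 2) => a b; lra.
Qed.

(** Differentiation under the integral with an explicit remainder: once the affine part is removed,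
    the integrand contains e^x - 1 - x at x = <k, w>/t, which is quadratic in the increment k by
    [cexp_sub2_le]. *)
Lemma Hol_proj h : cmeas h -> (wint p t h < +oo)%E -> Hol (proj t h).
Proof.
move=> mh hoo z0.
(* The candidate partial derivatives at z0: differentiating e^{<z, w>/t} in z_j yields the factor
   conj(w_j)/t. *)
pose c (j : 'I_n) : R[i] := cint leb (fun w => (w 0 j)^*%R / T%:C * (kern t z0 w * h w)).
pose L (z : Cn) : R[i] := \sum_j (z 0 j - z0 0 j) * c j.
pose rem (z : Cn) : R[i] := proj t h z - (proj t h z0 + L z).
have -> : proj t h = rem + (fun z => proj t h z0 + L z).
  by apply/funext => w; rewrite -[RHS]/(rem w + _) /rem subrK.
apply: differentiableD; last first.
  apply: differentiableD; first exact: differentiable_cst.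
  have -> : L = \sum_(j < n) (fun z : Cn => (z 0 j - z0 0 j) * c j).
    by apply/funext => x; rewrite fct_sumE.
  apply: differentiable_sum => j; apply: differentiableM; last exact: differentiable_cst.
  by apply: differentiableB; [exact: differentiable_coord|exact: differentiable_cst].
have Tc : normc (T%:C)^-1 = T^-1 by rewrite Normc.normcV normc_real ger0_norm.
have mk0 : cmeas (fun w => kern t z0 w) by apply: cmeas_kern => //; exact: measurable_cst.
have ci j : cintble leb (fun w => (w 0 j)^*%R / T%:C * (kern t z0 w * h w)).
  under eq_fun do rewrite mulrA.
  apply: (cintble_weighted (ltW p1) (half_lt_invT t) mh hoo
    (K := T^-1 * kcst n t) (l := l1norm z0 / T + 1)).
    apply: cmeasM => //; under eq_fun do rewrite mulrC; apply: cmeasZ; apply: cmeas_conj.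
    exact: measurable_coord.
  move=> w; rewrite Normc.normcM [normc (_ / _)]Normc.normcM normc_conj Tc.
  have kle := normc_kern_le t z0 w.
  rewrite mulrDl mul1r expRD.
  have wl : normc (w 0 j) <= expR (l1norm w).
    apply: le_trans (expR_ge1Dx _); rewrite ler_wpDl// /l1norm (bigD1 j)//= lerDl.
    by rewrite sumr_ge0// => i _; exact: normc_ge0.
  have Ti : 0 <= T^-1 by rewrite invr_ge0.
  have := ler_wpM2l Ti (ler_pM (normc_ge0 _) (normc_ge0 _) kle wl).
  move: (normc _) (normc _) (T^-1) (kcst _ _) (gaussian _ _) (expR _) (expR _) => a b e d G' g g'.
  by lra.
have ki z := cintble_kern p1 z mh hoo.
(* The extra 2/t pays for two factors e^x, x = |w|_1 / t: one bounds x^2 through [sqr_le_expR], the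
   other is the exponential in [cexp_sub2_le]. Each of these lemmas also contributes a 4 to the
   constant 16. *)
pose B := fine (\int[leb]_w (normc (h w) * (gaussian T^-1 w * expR ((l1norm z0 / T + 2 / T) * l1norm w)))%:E)%E.
have Boo := Lp_weighted_lty (ltW p1) (l1norm z0 / T + 2 / T) (half_lt_invT t) mh hoo.
apply: (@differentiable_quadratic _ _ _ _ (16 * kcst n t * B)).
  by rewrite /rem /L big1 ?addr0 ?subrr// => j _; rewrite subrr mul0r.
move=> k; rewrite -[1]/(1%:C) => k1.
have k1' : Re `|k| <= 1 by move: k1; rewrite lecE => /andP[].
have k0 : 0 <= Re `|k|.
  by have : 0 <= `|k| by []; rewrite lecE => /andP[].
have E : rem (k + z0) = cint leb (fun w => kern t (k + z0) w * h w - kern t z0 w * h w -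
    cdot k w / T%:C * (kern t z0 w * h w)).
  have sE : forall w, cdot k w / T%:C * (kern t z0 w * h w) =
      \sum_j (k 0 j) * ((w 0 j)^*%R / T%:C * (kern t z0 w * h w)).
    by move=> w; rewrite /cdot !mulr_suml; apply: eq_bigr => j _; rewrite !mulrA.
  have si : cintble leb (fun w => cdot k w / T%:C * (kern t z0 w * h w)).
    under eq_fun do rewrite sE; apply: cintble_sum => j; exact: cintbleZ.
  rewrite cintB//; last exact: cintbleB.
  rewrite cintB// -!projE// /rem opprD addrA; congr (_ - _).
  under eq_cint do rewrite sE.
  rewrite cint_sum; last by move=> j; exact: cintbleZ.
  by apply: eq_bigr => j _; rewrite cintZ// mxE addrK.
have Ei : cintble leb (fun w => kern t (k + z0) w * h w - kern t z0 w * h w -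
    cdot k w / T%:C * (kern t z0 w * h w)).
  apply: cintbleB; first exact: cintbleB.
  have -> : (fun w => cdot k w / T%:C * (kern t z0 w * h w)) =
      (fun w => \sum_j (k 0 j) * ((w 0 j)^*%R / T%:C * (kern t z0 w * h w))).
    by apply/funext => w; rewrite /cdot !mulr_suml; apply: eq_bigr => j _; rewrite !mulrA.
  by apply: cintble_sum => j; exact: cintbleZ.
rewrite E; apply: cint_norm_le_fin => //.
have B0 : (0 <= \int[leb]_w (normc (h w) * (gaussian T^-1 w * expR ((l1norm z0 / T + 2 / T) * l1norm w)))%:E)%E.
  by apply: integral_ge0 => w _; rewrite lee_fin !mulr_ge0 ?normc_ge0 ?expR_ge0.
have -> : (16 * kcst n t * B * Re `|k| ^+ 2)%:E = ((16 * kcst n t * Re `|k| ^+ 2)%:E *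
   \int[leb]_w (normc (h w) * (gaussian T^-1 w * expR ((l1norm z0 / T + 2 / T) * l1norm w)))%:E)%E.
  by rewrite mulrAC EFinM /B fineK// ge0_fin_numE.
have mI : measurable_fun setT (fun w : Cn => normc (h w) * (gaussian T^-1 w * expR ((l1norm z0 / T + 2 / T) * l1norm w))).
  apply: measurable_funM; first exact: measurable_normc.
  apply: measurable_funM; first exact: measurable_gaussian.
  apply: (measurableT_comp (@measurable_expR R)); apply: measurable_funM => //.
  exact: measurable_l1norm.
have c0 : 0 <= 16 * kcst n t * Re `|k| ^+ 2.
  by rewrite !mulr_ge0 ?sqr_ge0 ?(ltW (kcst_gt0 _ _)).
rewrite -ge0_integral_scale//; last by move=> w; rewrite !mulr_ge0 ?normc_ge0 ?expR_ge0.
apply: ge0_le_integral => //.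
- by move=> w _; rewrite lee_fin normc_ge0.
- by apply: measurable_enormc; case: Ei.
- by apply/measurable_EFinP; apply: measurable_funM.
move=> w _; rewrite lee_fin.
have -> : kern t (k + z0) w * h w - kern t z0 w * h w - cdot k w / T%:C * (kern t z0 w * h w) =
    kern t z0 w * (cexp (cdot k w / T%:C) - 1 - cdot k w / T%:C) * h w.
  have -> : kern t (k + z0) w = kern t z0 w * cexp (cdot k w / T%:C).
    by rewrite /kern cdotDl mulrDl addrC cexpD [LHS]mulrA.
  by ring.
rewrite Normc.normcM [normc (kern _ _ _ * _)]Normc.normcM [leLHS]mulrC [leRHS]mulrCA ler_wpM2l ?normc_ge0//.
set x := l1norm w / T; have x0 : 0 <= x by rewrite divr_ge0 ?l1norm_ge0.
have kx : normc (cdot k w / T%:C) <= Re `|k| * x.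
  by rewrite Normc.normcM Tc /x mulrA ler_wpM2r ?invr_ge0// normc_cdot_norm.
have kx1 : normc (cdot k w / T%:C) <= x by apply: le_trans kx _; rewrite ler_piMl.
have h1 : normc (cexp (cdot k w / T%:C) - 1 - cdot k w / T%:C) <=
    16 * Re `|k| ^+ 2 * (expR x * expR x).
  apply: le_trans (cexp_sub2_le _) _.
  have e1 : expR (normc (cdot k w / T%:C)) <= expR x by rewrite ler_expR.
  have e2 : normc (cdot k w / T%:C) ^+ 2 <= Re `|k| ^+ 2 * (4 * expR x).
    apply: (@le_trans _ _ ((Re `|k| * x) ^+ 2)).
      apply: lerXn2r => //; rewrite nnegrE; first exact: normc_ge0.
      exact: mulr_ge0.
    by rewrite exprMn ler_wpM2l ?sqr_ge0// sqr_le_expR.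
  have := ler_pM (sqr_ge0 _) (expR_ge0 _) e2 e1.
  by move: (_ ^+ 2) (expR x) (expR _) (_ ^+ 2) => a b e d; lra.
have := ler_pM (normc_ge0 _) (normc_ge0 _) (normc_kern_le t z0 w) h1.
have -> : expR ((l1norm z0 / T + 2 / T) * l1norm w) = expR (l1norm z0 / T * l1norm w) * (expR x * expR x).
  by rewrite -!expRD; congr expR; rewrite /x; field; rewrite gt_eqF.
by move: (expR _) (expR x) (gaussian _ _) (kcst _ _) (_ ^+ 2) => a b e d g; lra.
Qed.

(** The reproducing property: [gaussian_shift] with c = 1/t, a = z and q = 0. *)
Lemma proj_id (u : Cn -> R[i]) : cmeas u -> (wint p t u < +oo)%E -> Hol u -> proj t u = u.
Proof.
move=> mu uoo hu; apply/funext => z; rewrite projE//.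
have ki := cintble_kern p1 z mu uoo.
have T0 : 0 < T^-1 by rewrite invr_gt0.
have k0 : (kcst n t)%:C != 0 by rewrite -normc_eq0 normc_real normr_eq0 gt_eqF ?kcst_gt0.
have E w : kern t z w * u w = (kcst n t)%:C *
    (cexp (- ((T^-1)%:C * cdot w w) + (T^-1)%:C * cdot z w + cdot w 0) * u w).
  rewrite /kern gauss_densityE rmorphM /= gaussian_cexp.
  transitivity ((kcst n t)%:C * (cexp (- ((T^-1)%:C * cdot w w)) * (cexp (cdot z w / T%:C) * u w))).
    by ring.
  rewrite cexpDM; congr (_ * (cexp _ * _)).
  by rewrite cdot0r addr0 fmorphV [cdot z w / _]mulrC.
have gi : cintble leb (fun w => cexp (- ((T^-1)%:C * cdot w w) + (T^-1)%:C * cdot z w + cdot w 0) * u w).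
  have := cintbleZ (kcst n t)%:C^-1 ki.
  congr cintble; apply/funext => w; rewrite E.
  by rewrite mulKf.
under eq_cint do rewrite E.
rewrite cintZ// gaussian_shift//.
rewrite cdot0r cexp0 mul1r mulrA -rmorphM /kcst invrK.
by rewrite mulVf ?mul1r// expf_neq0// gt_eqF// mulr_gt0// pi_gt0.
Qed.

Definition cbounded f (M : R) := cmeas f /\ forall z, normc (f z) <= M.

Lemma wint_mul f h (M : R) : cbounded f M -> cmeas h ->
  (wint p t (fun z => f z * h z)%R <= (M `^ P)%:E * wint p t h)%E.
Proof.
move=> [mf fM] mh; have M0 : 0 <= M by exact: le_trans (normc_ge0 (f 0)) (fM 0).
rewrite /wint -ge0_integral_scale; last 3 first.
- exact: measurable_wnorm.
- by move=> z; exact: powR_ge0.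
- exact: powR_ge0.
apply: ge0_le_integral => //.
- by move=> z _; rewrite lee_fin powR_ge0.
- by apply/measurable_EFinP; apply: measurable_wnorm; exact: cmeasM.
- by apply/measurable_EFinP; apply: measurable_funM => //; exact: measurable_wnorm.
move=> z _; rewrite lee_fin -powRM ?mulr_ge0 ?normc_ge0 ?wt_ge0//.
apply: ge0_ler_powR; rewrite ?nnegrE ?mulr_ge0 ?normc_ge0 ?wt_ge0//.
by rewrite Normc.normcM -mulrA ler_wpM2r// mulr_ge0 ?normc_ge0 ?wt_ge0.
Qed.

Lemma wint_mul_lty f h (M : R) : cbounded f M -> cmeas h -> (wint p t h < +oo)%E ->
  (wint p t (fun z => f z * h z)%R < +oo)%E.
Proof.
move=> fM mh hoo; apply: le_lt_trans (wint_mul fM mh) _.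
by rewrite lte_mul_pinfty ?lee_fin ?powR_ge0.
Qed.

(** [Hol_proj] and [wint_proj] place P_t(f u) in the Fock space, which rules out the default value
    of [insubd]. *)
Lemma toeplitz_val f (M : R) (u : fock n p t) : cbounded f M ->
  (toeplitz f u : Cn -> R[i]) = proj t (fun z => f z * u z).
Proof.
move=> fM; have [mu uoo hu] := fock_valP u.
have mfu : cmeas (fun z => f z * u z) by apply: cmeasM => //; case: fM.
have fuoo := wint_mul_lty fM mu uoo.
have hP := Hol_proj mfu fuoo.
have mP := Hol_cmeas hP.
rewrite /toeplitz insubdK//; apply/fock_memP; split => //.
apply: le_lt_trans (wint_proj p1 mfu mP fuoo) _.
by rewrite lte_mul_pinfty ?lee_fin ?powR_ge0.
Qed.

Lemma toeplitz_norm f (M : R) (u : fock n p t) : cbounded f M ->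
  fock_norm (toeplitz f u) <= 2 ^+ n * M * fock_norm u.
Proof.
move=> fM; have [mu uoo hu] := fock_valP u.
have M0 : 0 <= M by case: fM => _ fM; exact: le_trans (normc_ge0 (f 0)) (fM 0).
have mfu : cmeas (fun z => f z * u z) by apply: cmeasM => //; case: fM.
have fuoo := wint_mul_lty fM mu uoo.
have mP := Hol_cmeas (Hol_proj mfu fuoo).
apply: fock_norm_le; first by rewrite mulr_ge0// exprn_ge0.
rewrite (toeplitz_val u fM); apply: le_trans (wint_proj p1 mfu mP fuoo) _.
rewrite powRM ?exprn_ge0// EFinM -muleA; apply: lee_wpmul2l; first by rewrite lee_fin powR_ge0.
exact: wint_mul.
Qed.

End HolomorphicProjection.

(** * Uniformly closed spaces and Gaussian convolution *)

Section FunctionSpaces.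
Variables (R : realType) (n : nat).
Local Notation Cn := ('rV[R[i]]_n).
Local Notation leb := (lebesgue_Cn R n).
Implicit Types (f g h : Cn -> R[i]) (z w : Cn).

(** Pointwise bounds replace [supnorm], a real supremum that is only meaningful on bounded
    functions. *)
Definition uniform_closed (Q : set (Cn -> R[i])) := forall h,
  (forall e : R, 0 < e -> exists2 y, Q y & forall z, normc (h z - y z) <= e) -> Q h.

Lemma BUC_bounded f : BUC f -> exists2 M, 0 <= M & cbounded f M.
Proof.
move=> [[M fM] /unif_continuousP uf]; exists M; first exact: le_trans (normc_ge0 _) (fM 0).
split => //; apply: continuous_cmeas => z; apply/continuous_CnP => e e0.
by have [d d0 dP] := uf e e0; exists d => // w; exact: dP.
Qed.

Lemma BUC_uniform_closed : uniform_closed (@BUC R n).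
Proof.
move=> h hP; split.
  have [y [[M yM] _] hy] := hP 1 ltr01; exists (M + 1) => z.
  by apply: le_trans (le_normc_sub _ (y z)) _; rewrite lerD.
apply/unif_continuousP => e e0; have e4 : 0 < e / 4 by rewrite divr_gt0.
have [y [_ /unif_continuousP uy] hy] := hP _ e4.
have [d d0 dP] := uy _ e4; exists d => // z w zw.
have -> : h w - h z = (h w - y w) + (y w - y z) - (h z - y z) by ring.
apply: le_lt_trans (le_normcB _ _) _.
have := le_normcD (h w - y w) (y w - y z); have := dP z w zw.
by have := hy w; have := hy z; move: (normc _) (normc _) (normc _) (normc _) => *; lra.
Qed.

Lemma closed_subspace_uniform_closed D : closed_subspace_BUC D -> uniform_closed D.
Proof.
move=> [DB [D0 Dlin] Dcl] h hP; apply: Dcl; split.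
  apply: BUC_uniform_closed => e e0; have [y Dy hy] := hP e e0.
  by exists y => //; exact: DB.
move=> e e0; have e2 : 0 < e / 2 by rewrite divr_gt0.
have [y Dy hy] := hP _ e2; exists y => //.
apply: (@le_lt_trans _ _ (e / 2)); last by lra.
apply: ge_sup; first by exists (normc ((h - y) 0)); exists 0.
by move=> _ [z _ <-]; exact: hy.
Qed.

Lemma subspace_sum (V : lmodType R[i]) (Q : set V) (I : Type) (r : seq I) (c : I -> R[i]) (F : I -> V) :
  subspace Q -> (forall i, Q (F i)) -> Q (\sum_(i <- r) c i *: F i).
Proof.
move=> [Q0 Qlin] QF; elim: r => [|i r ih]; first by rewrite big_nil.
by rewrite big_cons; exact: Qlin.
Qed.

Section integral_mem.
Context d (X : measurableType d) (mu : {measure set X -> \bar R}).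

(** Separability of the range of F for the sup norm, in measurable form: it stands for strong
    measurability of F. For translates it comes from uniform continuity and the rational points. *)
Definition finely_covered (F : X -> Cn -> R[i]) := forall e : R, 0 < e ->
  exists A : nat -> set X, exists x : nat -> X,
    [/\ forall j, measurable (A j), forall y, exists j, A j y &
        forall j y z, A j y -> normc (F y z - F (x j) z) <= e].

(* The integral is a uniform limit of Riemann sums over a countable partition. *)
Lemma integral_mem (Q : set (Cn -> R[i])) (k : X -> R[i]) (F : X -> Cn -> R[i]) (M : R) :
  subspace Q -> uniform_closed Q -> cintble mu k -> (forall x, Q (F x)) ->
  (forall x z, normc (F x z) <= M) -> (forall z, cmeas (F ^~ z)) ->
  finely_covered F -> Q (fun z => cint mu (fun x => k x * F x z)).
Proof.
move=> Qsub Qcl ki QF FM mF Fcov; apply: Qcl => e e0.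
have kr := ki.2; have mk := ki.1.
have Kge0 : (0 <= \int[mu]_x (normc (k x))%:E)%E.
  by apply: integral_ge0 => x _; rewrite lee_fin normc_ge0.
pose K := fine (\int[mu]_x (normc (k x))%:E)%E.
have KE : (\int[mu]_x (normc (k x))%:E)%E = K%:E by rewrite fineK// ge0_fin_numE.
have K0 : 0 <= K by rewrite fine_ge0.
have e1 : 0 < e / (2 * (K + 1)) by rewrite divr_gt0// mulr_gt0// ltr_wpDl.
have [A [x [mA cA AP]]] := Fcov _ e1.
(* The first set of the cover that contains y; its level sets form a measurable partition. *)
pose J y := ex_minn (ex_intro (fun j => `[< A j y >]) (sval (cid (cA y))) (asboolT (svalP (cid (cA y))))).
have JA y : A (J y) y by rewrite /J; case: ex_minnP => m /asboolP.
have mJ j : measurable [set y | J y = j].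
  rewrite (_ : [set y | J y = j] = A j `\` \bigcup_(i in [set i | (i < j)%N]) A i).
    apply: measurableD => //; apply: bigcup_measurable => i _; exact: mA.
  apply/seteqP; split => y /=.
    move=> Jy; split; first by rewrite -Jy.
    move=> [i /= ij Ai]; move: Jy ij; rewrite /J; case: ex_minnP => m _ mP <-.
    by rewrite ltnNge mP//; exact/asboolP.
  move=> [Aj nA]; rewrite /J; case: ex_minnP => m /asboolP Am mP.
  apply/eqP; rewrite eqn_leq mP ?andTb; last exact/asboolP.
  by rewrite leqNgt; apply/negP => mj; apply: nA; exists m.
pose I j y : R := \1_[set y | J y = j] y.
have IE j y : I j y = (J y == j)%:R.
  rewrite /I indicE; congr (_%:R); congr nat_of_bool.
  by apply/idP/eqP => [/set_mem|Jy]//; apply/mem_set.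
have mI j : cmeas (fun y => (I j y)%:C) by apply: cmeas_real; exact: measurable_indic.
have Iki j : cintble mu (fun y => (I j y)%:C * k y).
  apply: (le_cintble _ ki); first exact: cmeasM.
  move=> y; rewrite Normc.normcM normc_real IE; case: (_ == _); first by rewrite normr1 mul1r.
  by rewrite normr0 mul0r normc_ge0.
(* The mass of k beyond the first N pieces; dominated convergence makes its integral small, and the
   Riemann sum keeps only those N pieces. *)
pose tl N y := normc (k y) * (N <= J y)%:R.
have mtl N : measurable_fun setT (tl N).
  apply: measurable_funM; first exact: measurable_normc.
  rewrite (_ : (fun y => _) = \1_(\bigcup_(i in [set i | (N <= i)%N]) [set y | J y = i])).
    by apply: measurable_indic; apply: bigcup_measurable.
  apply/funext => y; rewrite indicE; congr (_%:R); congr nat_of_bool.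
  apply/idP/idP => [NJ|/set_mem[i /= Ni Ji]]; last by rewrite Ji.
  by apply/mem_set; exists (J y).
have M0 : 0 <= M + 1.
  by apply: le_trans (normc_ge0 (F (x 0%N) 0)) _; apply: le_trans (FM _ _) _; rewrite lerDl.
have [N NP] : exists N, (\int[mu]_y (tl N y)%:E <= (e / (2 * (M + 1) + 1))%:E)%E.
  have ik : mu.-integrable setT (fun y => (normc (k y))%:E).
    apply/integrableP; split; first exact: measurable_enormc.
    by under eq_integral do rewrite gee0_abs ?lee_fin ?normc_ge0//.
  have tlc : {ae mu, forall y, setT y -> (tl N y)%:E @[N --> \oo] --> (0%E : \bar R)}.
    apply: aeW => y _; apply: cvg_near_cst; exists (J y).+1 => // N /= JN.
    by rewrite /tl leqNgt JN mulr0.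
  have tlb : {ae mu, forall y N, setT y -> (`|(tl N y)%:E|%E <= (normc (k y))%:E)%E}.
    apply: aeW => y N _; rewrite gee0_abs lee_fin /tl; last by rewrite mulr_ge0 ?normc_ge0.
    by case: (_ <= _)%N; rewrite ?mulr1// mulr0 normc_ge0.
  have mtlE N : measurable_fun setT (fun y => (tl N y)%:E) by exact/measurable_EFinP.
  have [_ _] := dominated_convergence measurableT mtlE (measurable_cst _) tlc ik tlb.
  rewrite integral0 => /fine_cvgP.
  move=> [[N1 _ N1P] /cvgrPdist_lt/(_ (e / (2 * (M + 1) + 1))) H].
  have [|N2 _ N2P] := H; first by rewrite divr_gt0// ltr_wpDl// mulr_ge0.
  exists (maxn N1 N2); have := N1P (maxn N1 N2) (leq_maxl _ _).
  have := N2P (maxn N1 N2) (leq_maxr _ _); rewrite /= sub0r normrN => lt1 fin.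
  by rewrite -(fineK fin) lee_fin; apply: le_trans (ltW lt1); exact: ler_norm.
exists (fun z => \sum_(j < N) cint mu (fun y => (I j y)%:C * k y) * F (x j) z).
  have := @subspace_sum _ Q _ (index_enum 'I_N) (fun j => cint mu (fun y => (I j y)%:C * k y))
    (fun j => F (x j)) Qsub (fun j => QF _).
  by congr Q; apply/funext => z; rewrite fct_sumE.
move=> z.
have Fi : cintble mu (fun y => k y * F y z).
  apply: (le_cintble _ (cintbleZ (M + 1)%:C ki)); first exact: cmeasM.
  move=> y; rewrite !Normc.normcM normc_real ger0_norm// mulrC ler_wpM2r ?normc_ge0//.
  by apply: le_trans (FM _ _) _; rewrite lerDl.
have Si j : cintble mu (fun y => F (x j) z * ((I j y)%:C * k y)) by exact: cintbleZ.
have -> : \sum_(j < N) cint mu (fun y => (I j y)%:C * k y) * F (x j) z =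
    cint mu (fun y => \sum_(j < N) F (x j) z * ((I j y)%:C * k y)).
  by rewrite cint_sum//; apply: eq_bigr => j _; rewrite cintZ// mulrC.
rewrite -cintB//; last exact: cintble_sum.
apply: cint_norm_le_fin.
  by apply: cintbleB => //; exact: cintble_sum.
apply: (@le_trans _ _ (\int[mu]_y ((e / (2 * (K + 1)) * normc (k y))%:E + ((M + 1) * tl N y)%:E))%E).
  apply: ge0_le_integral => //.
  - by move=> y _; rewrite lee_fin normc_ge0.
  - apply: measurable_enormc; apply: cmeasB; first by case: Fi.
    by have [] := cintble_sum (index_enum 'I_N) (fun j => Si j).
  - apply: emeasurable_funD; apply/measurable_EFinP; apply: measurable_funM => //.
    exact: measurable_normc.
  move=> y _; rewrite -EFinD lee_fin.
  have -> : \sum_(j < N) F (x j) z * ((I j y)%:C * k y) =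
      k y * (if (J y < N)%N then F (x (J y)) z else 0).
    case: ltnP => [JN|NJ].
      rewrite (bigD1 (Ordinal JN))//= big1 ?addr0.
        by rewrite IE eqxx mul1r mulrC.
      move=> j jJ; rewrite IE (_ : _ == _ = false) ?mul0r ?mulr0//.
      by apply/negP => /eqP Jj; move/eqP: jJ; apply; apply/val_inj.
    rewrite mulr0 big1// => j _; rewrite IE (_ : _ == _ = false) ?mul0r ?mulr0//.
    by apply/negP => /eqP Jj; have := ltn_ord j; rewrite -Jj ltnNge NJ.
  rewrite -mulrBr Normc.normcM /tl; case: ltnP => JN.
    by rewrite !mulr0 addr0 mulrC ler_wpM2r ?normc_ge0//; exact: AP (JA y).
  rewrite subr0 mulr1 ler_wpDl//; first by rewrite mulr_ge0 ?normc_ge0 ?ltW.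
  rewrite mulrC ler_wpM2r ?normc_ge0//.
  by apply: le_trans (FM _ _) _; rewrite lerDl.
have tl0 y : 0 <= tl N y by rewrite /tl mulr_ge0 ?normc_ge0.
rewrite ge0_integralD//; last 4 first.
- by move=> y _; rewrite lee_fin mulr_ge0 ?normc_ge0 ?ltW.
- by apply/measurable_EFinP; apply: measurable_funM => //; exact: measurable_normc.
- by move=> y _; rewrite lee_fin mulr_ge0.
- by apply/measurable_EFinP; apply: measurable_funM.
rewrite ge0_integral_scale ?(ltW e1)//; last 2 first.
- exact: measurable_normc.
- by move=> y; exact: normc_ge0.
rewrite ge0_integral_scale// KE.
apply: (@le_trans _ _ ((e / (2 * (K + 1)) * K)%:E + ((M + 1) * (e / (2 * (M + 1) + 1)))%:E)%E).
  by rewrite EFinM; apply: leeD => //; rewrite EFinM; apply: lee_wpmul2l; rewrite ?lee_fin.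
rewrite -EFinD lee_fin [leRHS]splitr; apply: lerD.
  have K1 : 0 < K + 1 by rewrite ltr_wpDl.
  rewrite invfM mulrA -mulrA ler_piMr ?divr_ge0 ?ltW// mulrC ltr_pdivrMr// mul1r.
  by rewrite ltrDl.
have M1 : 0 < 2 * (M + 1) + 1 by rewrite ltr_wpDl// mulr_ge0.
rewrite mulrCA ler_wpM2l ?ltW// ltr_pdivrMr//.
by lra.
Qed.

End integral_mem.

End FunctionSpaces.

(** * Convolution with Gaussians *)

Section Convolution.
Variables (R : realType) (n : nat).
Local Notation Cn := ('rV[R[i]]_n).
Local Notation leb := (lebesgue_Cn R n).
Implicit Types (f g h : Cn -> R[i]) (z w : Cn).

Definition qpt (k : nat) : Cn :=
  if unpickle k is Some q then @ratpt R n q else 0.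

Lemma qpt_dense z (d : R) : 0 < d -> exists k, sqnorm (z - qpt k) < d.
Proof.
by move=> d0; have [q qP] := ratpt_dense z d0; exists (pickle q); rewrite /qpt pickleK.
Qed.

Lemma measurable_near_qpt (d : R) (a : Cn) : measurable [set z | sqnorm (z - a) < d].
Proof.
have mf : measurable_fun setT (fun z : Cn => sqnorm (z - a)).
  by apply: (measurableT_comp (@measurable_sqnorm R n)); exact: measurable_shift.
rewrite (_ : [set z | _] = setT `&` (fun z => sqnorm (z - a)) @^-1` `]-oo, d[); last first.
  by rewrite setTI; apply/seteqP; split => z; rewrite /= in_itv.
exact: mf.
Qed.

Lemma finely_covered_shift f : BUC f -> finely_covered (fun (x : Cn) z => f (z - x)).
Proof.
move=> [_ /unif_continuousP uf] e e0; have [d d0 dP] := uf e e0.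
exists (fun k => [set z | sqnorm (z - qpt k) < d]), qpt; split.
- by move=> k; exact: measurable_near_qpt.
- by move=> y; exact: qpt_dense.
move=> j y z yj; rewrite ltW// -normcN opprB; apply: dP.
rewrite (_ : _ - _ = y - qpt j)//.
by rewrite opprB addrC addrA subrK.
Qed.

Lemma finely_covered_shift2 f g : BUC f -> BUC g ->
  finely_covered (fun (x : Cn * Cn) z => f (z - x.1) * g (z - x.2)).
Proof.
move=> fB gB e e0.
have [M1 M10 [_ fM]] := BUC_bounded fB; have [M2 M20 [_ gM]] := BUC_bounded gB.
have fc := finely_covered_shift fB; have gc := finely_covered_shift gB.
have M0 : 0 < M1 + M2 + 1 by rewrite ltr_wpDl// addr_ge0.
have e' : 0 < e / (M1 + M2 + 1) by rewrite divr_gt0.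
have [A1 [x1 [mA1 cA1 P1]]] := fc _ e'; have [A2 [x2 [mA2 cA2 P2]]] := gc _ e'.
pose u (k : nat) : nat * nat := odflt (0%N, 0%N) (unpickle k).
exists (fun k => A1 (u k).1 `*` A2 (u k).2), (fun k => (x1 (u k).1, x2 (u k).2)); split.
- by move=> k; exact: measurableX.
- move=> [y1 y2]; have [j1 h1] := cA1 y1; have [j2 h2] := cA2 y2.
  by exists (pickle (j1, j2)); rewrite /u pickleK.
move=> k [y1 y2] z [/= h1 h2].
have -> : f (z - y1) * g (z - y2) - f (z - x1 (u k).1) * g (z - x2 (u k).2) =
  f (z - y1) * (g (z - y2) - g (z - x2 (u k).2)) +
  (f (z - y1) - f (z - x1 (u k).1)) * g (z - x2 (u k).2) by ring.
apply: le_trans (le_normcD _ _) _; rewrite !Normc.normcM.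
have H1 := ler_pM (normc_ge0 _) (normc_ge0 _) (fM (z - y1)) (P2 _ _ z h2).
have H2 := ler_pM (normc_ge0 _) (normc_ge0 _) (P1 _ _ z h1) (gM (z - x2 (u k).2)).
apply: le_trans (lerD H1 H2) _; rewrite mulrC -mulrDr mulrAC ler_pdivrMr//.
by rewrite ler_wpM2l ?(ltW e0)// lerDl.
Qed.

Definition gconv f (b : R) z : R[i] := cint leb (fun x => (gaussian b x)%:C * f (z - x)).

Lemma cintble_gaussian (b : R) : 0 < b -> cintble leb (fun x => (gaussian b x)%:C).
Proof.
move=> b0; split; first by apply: cmeas_real; exact: measurable_gaussian.
under eq_integral do rewrite normc_real ger0_norm ?gaussian_ge0//.
exact: integral_gaussian_lty.
Qed.

Lemma cmeas_reflect f z : cmeas f -> cmeas (fun x : Cn => f (z - x)).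
Proof. by move=> mf; apply: (cmeas_comp mf); case: (reflect_mpreserving z). Qed.

Lemma cintble_bounded (k : Cn -> R[i]) f M : cintble leb k -> cbounded f M ->
  cintble leb (fun x => k x * f x).
Proof.
move=> ki [mf fM].
have M0 : 0 <= M by exact: le_trans (normc_ge0 (f 0)) (fM 0).
apply: (le_cintble _ (cintbleZ M%:C ki)); first by apply: cmeasM => //; case: ki.
by move=> x; rewrite !Normc.normcM normc_real ger0_norm// mulrC ler_wpM2r ?normc_ge0.
Qed.

Lemma cbounded_reflect f M z : cbounded f M -> cbounded (fun x : Cn => f (z - x)) M.
Proof. by move=> [mf fM]; split => [|x]; [exact: cmeas_reflect|exact: fM]. Qed.

Lemma gconv_mem (D : set (Cn -> R[i])) f (b : R) : closed_subspace_BUC D ->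
  translation_invariant D -> 0 < b -> D f -> D (gconv f b).
Proof.
move=> Dcl Dtr b0 Df; have [DB Dsub _] := Dcl.
have [M M0 [mf fM]] := BUC_bounded (DB _ Df).
have H := integral_mem (M := M) Dsub (closed_subspace_uniform_closed Dcl) (cintble_gaussian b0)
  (F := fun (x : Cn) z => f (z - x)).
apply: H => [x|x z|z|]; first exact: Dtr.
- exact: fM.
- exact: cmeas_reflect.
- by apply: finely_covered_shift; exact: DB.
Qed.

Lemma cintble_gconv f (b : R) M z : 0 < b -> cbounded f M ->
  cintble leb (fun x => (gaussian b x)%:C * f (z - x)).
Proof.
move=> b0 fM; apply: (cintble_bounded (cintble_gaussian b0) (M := M)).
exact: cbounded_reflect.
Qed.

Lemma pow_diff_le (a b B : R) k : `|a| <= B -> `|b| <= B ->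
  `|a ^+ k.+1 - b ^+ k.+1| <= k.+1%:R * B ^+ k * `|a - b|.
Proof.
move=> aB bB; have B0 : 0 <= B by exact: le_trans aB.
elim: k => [|k ih]; first by rewrite !expr1 expr0 mulr1 mul1r.
rewrite (_ : _ - _ = a * (a ^+ k.+1 - b ^+ k.+1) + (a - b) * b ^+ k.+1); last first.
  by rewrite ![_ ^+ k.+2]exprS; ring.
apply: le_trans (ler_normD _ _) _; rewrite !normrM normrX.
have H1 := ler_pM (normr_ge0 _) (normr_ge0 _) aB ih.
have H2 : `|b| ^+ k.+1 <= B ^+ k.+1 by rewrite lerXn2r// nnegrE.
have := ler_wpM2l (normr_ge0 (a - b)) H2.
rewrite -[k.+2%:R]natr1 [B ^+ k.+1]exprS; move: H1.
by move: (`|a| * _) (`|a - b|) (B ^+ k) (k.+1%:R) (`|b| ^+ _) => *; lra.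
Qed.

(* The polynomials [(2 - e^{y/m})^m] in [e^{y/m}] converge to [e^{-y}], with an
   error that stays integrable against a fixed Gaussian. *)
Lemma gauss_binomial_le (y : R) m : 0 <= y ->
  `|expR (- y) - (2 - expR (y / m.+1%:R)) ^+ m.+1| <= 8 / m.+1%:R * expR (2 * y).
Proof.
move=> y0; set s := y / m.+1%:R.
have m0 : 0 < m.+1%:R :> R by rewrite ltr0n.
have s0 : 0 <= s by rewrite divr_ge0// ltW.
have yE : y = m.+1%:R * s by rewrite /s mulrCA divff ?mulr1// gt_eqF.
have es1 : 1 <= expR s by rewrite -expR0 ler_expR.
have ens : expR (- s) <= 1 by rewrite -expR0 ler_expR oppr_le0.
have ens0 := expR_ge0 (- s).
have eyE : expR (- y) = expR (- s) ^+ m.+1 by rewrite -expRM_natl mulrN -yE.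
rewrite eyE distrC.
have h1 : `|2 - expR s| <= expR s by rewrite ler_norml; apply/andP; split; lra.
have h2 : `|expR (- s)| <= expR s by rewrite ger0_norm//; lra.
apply: le_trans (pow_diff_le m h1 h2) _.
(* Both 2 - e^s and e^{-s} equal 1 - s up to O(s^2). Passing to the power m + 1 costs a factor of
   order m, so that O(1/m) is left. *)
have h3 : `|2 - expR s - expR (- s)| <= 2 * s ^+ 2 * expR s.
  have a1 := expR_sub2_le s; have a2 := expR_sub2_le (- s).
  rewrite sqrrN normrN (ger0_norm s0) in a2; rewrite (ger0_norm s0) in a1.
  rewrite (_ : 2 - _ - _ = - (expR s - 1 - s) - (expR (- s) - 1 - - s)); last by ring.
  apply: le_trans (ler_normB _ _) _; rewrite normrN.
  by apply: le_trans (lerD a1 a2) _; rewrite -mulrA [2 * _]mulr_natl mulr2n.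
apply: le_trans (ler_wpM2l _ h3) _; first by rewrite mulr_ge0 ?exprn_ge0 ?expR_ge0 ?(ltW m0).
have -> : m.+1%:R * expR s ^+ m * (2 * s ^+ 2 * expR s) =
   2 / m.+1%:R * y ^+ 2 * expR s ^+ m.+1.
  rewrite [_ ^+ m.+1]exprSr yE; move: s (expR s ^+ m) (expR s) (m.+1%:R : R) m0 {yE s0 es1 ens ens0 eyE h1 h2 h3} => s' E1 E2 x x0.
  by field; rewrite gt_eqF.
have -> : expR s ^+ m.+1 = expR y by rewrite -expRM_natl -yE.
have h4 := sqr_le_expR y0.
have -> : expR (2 * y) = expR y * expR y by rewrite -expRD mulr_natl mulr2n.
have mi : 0 <= 2 / m.+1%:R :> R by rewrite divr_ge0 ?(ltW m0).
have := ler_wpM2l (mulr_ge0 mi (expR_ge0 y)) h4.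
by move: (expR y) (y ^+ 2) (m.+1%:R^-1) => *; lra.
Qed.

(** Write e^{-5c|x|^2} = e^{-4c|x|^2} e^{-y} with y = c|x|^2. Expanding the binomial approximation
    of e^{-y} against e^{-4c|x|^2} gives Gaussians with exponents [b i] between 3c and 4c, all
    admissible; the error e^{2y} still leaves the integrable e^{-2c|x|^2}. *)
Lemma gconv_extend (D Q : set (Cn -> R[i])) f (c : R) : D `<=` (@BUC R n) -> subspace Q ->
  uniform_closed Q -> 0 < c -> (forall b, 0 < b <= 4 * c -> Q (gconv f b)) -> D f ->
  Q (gconv f (5 * c)).
Proof.
move=> DB Qsub Qcl c0 Qb Df; have [M M0 fM] := BUC_bounded (DB _ Df).
apply: Qcl => e e0.
pose G : R := (pi / (2 * c)) ^+ n.
have G0 : 0 <= G by rewrite exprn_ge0// divr_ge0 ?pi_ge0// mulr_ge0// ltW.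
(* Makes the total error M * 8/(m + 1) * G less than e. *)
pose m := Num.truncn (M * (8 * G) / e).
have mlt : M * (8 * G) / e < m.+1%:R by exact: truncnS_gt.
have m0 : 0 < m.+1%:R :> R by rewrite ltr0n.
pose b (i : nat) : R := 4 * c - c * (i%:R / m.+1%:R).
pose a (i : nat) : R := (-1) ^+ i * 2 ^+ (m.+1 - i) * 'C(m.+1, i)%:R.
have b0 (i : 'I_m.+2) : 0 < b i <= 4 * c.
  have i1 : 0 <= (i%:R / m.+1%:R : R) <= 1.
    by rewrite divr_ge0//= ler_pdivrMr// mul1r ler_nat -ltnS.
  by rewrite /b; move: (i%:R / _) i1 => x /andP[x0 x1]; apply/andP; split; nra.
exists (fun z => \sum_(i < m.+2) (a i)%:C * gconv f (b i) z).
  have := @subspace_sum _ _ Q _ (index_enum 'I_m.+2) (fun i => (a i)%:C) (fun i => gconv f (b i)) Qsub (fun i => Qb _ (b0 i)).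
  by congr Q; apply/funext => z; rewrite fct_sumE.
move=> z.
have c5 : 0 < 5 * c by rewrite mulr_gt0.
pose psi (x : Cn) := gaussian (4 * c) x * (2 - expR (c * sqnorm x / m.+1%:R)) ^+ m.+1.
have psiE x : \sum_(i < m.+2) a i * gaussian (b i) x = psi x.
  rewrite /psi exprBn mulr_sumr; apply: eq_bigr => i _.
  rewrite /a /b /gaussian -expRM_natl.
  have -> : expR (- ((4 * c - c * (i%:R / m.+1%:R)) * sqnorm x)) =
    expR (- (4 * c * sqnorm x)) * expR (i%:R * (c * sqnorm x / m.+1%:R)).
    by rewrite -expRD; congr expR; ring.
  by rewrite -mulr_natr; ring.
have gi i : cintble leb (fun x => (a i)%:C * ((gaussian (b i) x)%:C * f (z - x))) \/ (m.+1 < i)%N.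
  have [im|] := ltnP i m.+2; last by right.
  left; apply: cintbleZ; apply: (cintble_gconv z _ fM).
  by have /andP[] := b0 (Ordinal im).
have gi' (i : 'I_m.+2) : cintble leb (fun x => (a i)%:C * ((gaussian (b i) x)%:C * f (z - x))).
  by have [//|] := gi i; rewrite ltnNge -ltnS ltn_ord.
have -> : \sum_(i < m.+2) (a i)%:C * gconv f (b i) z = cint leb (fun x => (psi x)%:C * f (z - x)).
  transitivity (\sum_(i < m.+2) cint leb (fun x => (a i)%:C * ((gaussian (b i) x)%:C * f (z - x)))).
    apply: eq_bigr => i _; rewrite cintZ//; apply: (cintble_gconv z _ fM).
    by have /andP[] := b0 i.
  rewrite -cint_sum//; apply: eq_cint => x; rewrite -psiE rmorph_sum mulr_suml.
  by apply: eq_bigr => i _; rewrite [in RHS]rmorphM /= [LHS]mulrA.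
have psii : cintble leb (fun x => (psi x)%:C * f (z - x)).
  have := cintble_sum (index_enum 'I_m.+2) gi'.
  congr cintble; apply/funext => x; rewrite -psiE rmorph_sum mulr_suml.
  by apply: eq_bigr => i _; rewrite [in RHS]rmorphM /= [LHS]mulrA.
have g5 := cintble_gconv z c5 fM.
rewrite /gconv -cintB//; apply: cint_norm_le_fin; first exact: cintbleB.
have c2 : 0 < 2 * c by rewrite mulr_gt0.
have k0 : 0 <= M * (8 / m.+1%:R) by rewrite mulr_ge0// divr_ge0 ?(ltW m0).
apply: (@le_trans _ _ (\int[leb]_x (M * (8 / m.+1%:R) * gaussian (2 * c) x)%:E)%E).
  apply: ge0_le_integral => //.
  - by move=> x _; rewrite lee_fin normc_ge0.
  - by apply: measurable_enormc; have [] := cintbleB g5 psii.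
  - by apply/measurable_EFinP; apply: measurable_funM => //; exact: measurable_gaussian.
  move=> x _; rewrite lee_fin -mulrBl -rmorphB Normc.normcM normc_real.
  rewrite mulrC -[leRHS]mulrA; apply: ler_pM; rewrite ?normc_ge0//; first by case: fM.
  have -> : gaussian (5 * c) x = gaussian (4 * c) x * expR (- (c * sqnorm x)).
    by rewrite /gaussian -expRD; congr expR; ring.
  rewrite /psi -mulrBr normrM ger0_norm ?gaussian_ge0//.
  have y0 : 0 <= c * sqnorm x by rewrite mulr_ge0 ?sqnorm_ge0 ?(ltW c0).
  apply: le_trans (ler_wpM2l (gaussian_ge0 _ x) (gauss_binomial_le m y0)) _.
  have -> : gaussian (2 * c) x = gaussian (4 * c) x * expR (2 * (c * sqnorm x)).
    by rewrite /gaussian -expRD; congr expR; ring.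
  by rewrite mulrCA.
rewrite ge0_integral_scale//; last 2 first.
- exact: measurable_gaussian.
- by move=> x; exact: gaussian_ge0.
rewrite integral_gaussian// -EFinM lee_fin -/G.
rewrite -mulrA mulrAC mulrA ler_pdivrMr// mulrC -ler_pdivrMl//.
by apply: ltW; move: mlt; congr (_ < _); ring.
Qed.

(** Iterates [gconv_extend], which reaches b from the exponents up to 4b/5. The range (1 + k/4) tau
    grows to (1 + (k+1)/4) tau because 4/5 (1 + (k+1)/4) = 1 + k/5. *)
Lemma gconv_all (D Q : set (Cn -> R[i])) (tau : R) : D `<=` (@BUC R n) -> subspace Q ->
  uniform_closed Q -> 0 < tau -> (forall f b, D f -> 0 < b <= tau -> Q (gconv f b)) ->
  forall f b, D f -> 0 < b -> Q (gconv f b).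
Proof.
move=> DB Qsub Qcl t0 Qb f b Df b0.
have H k : forall b', 0 < b' <= (1 + k%:R / 4) * tau -> Q (gconv f b').
  elim: k => [|k ih] b'; first by rewrite mul0r addr0 mul1r; exact: Qb.
  move=> /andP[b'0 b'le]; have c0 : 0 < b' / 5 by rewrite divr_gt0.
  have -> : b' = 5 * (b' / 5) by rewrite mulrCA divff ?mulr1// pnatr_eq0.
  apply: (gconv_extend DB Qsub Qcl c0 _ Df) => b'' /andP[b''0 b''le].
  apply: ih; rewrite b''0/=; apply: (le_trans b''le).
  have k0 : 0 <= k%:R :> R by rewrite ler0n.
  move: b'le; rewrite -natr1; move: (k%:R) k0 => x x0.
  by nra.
apply: (H (Num.truncn (4 * (b / tau))).+1); rewrite b0/=.
have := truncnS_gt (4 * (b / tau)); set k := _.+1%:R => kP.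
rewrite -ler_pdivrMr//; lra.
Qed.

(** Uniform continuity where |x|^2 < d; elsewhere 2M <= (2M/d) |x|^2. A quadratic bound integrates
    against a Gaussian without splitting the domain. *)
Lemma oscillation_le f (e : R) : BUC f -> 0 < e -> exists2 K, 0 <= K &
  forall z x, normc (f (z - x) - f z) <= e + K * sqnorm x.
Proof.
move=> fB e0; have [M M0 [_ fM]] := BUC_bounded fB.
have [_ /unif_continuousP/(_ e e0)[d d0 dP]] := fB.
exists (2 * M / d); first by rewrite divr_ge0 ?mulr_ge0 ?(ltW d0).
move=> z x; have [xd|dx] := ltP (sqnorm x) d.
  apply: (@le_trans _ _ e); last by rewrite lerDl mulr_ge0 ?sqnorm_ge0 ?divr_ge0 ?mulr_ge0 ?(ltW d0).
  by rewrite ltW// dP// addrC addKr sqnormN.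
apply: le_trans (le_normcB _ _) _; have H1 := fM (z - x); have H2 := fM z.
have : 2 * M <= 2 * M / d * sqnorm x.
  by rewrite -mulrA ler_peMr ?mulr_ge0// mulrC ler_pdivlMr// mul1r.
by move: (normc _) (normc _) H1 H2 => ? ? ? ?; lra.
Qed.

Definition gdens (b : R) z : R := (b / pi) ^+ n * gaussian b z.

Lemma integral_gdens (b : R) : 0 < b -> (\int[leb]_x (gdens b x)%:E = 1)%E.
Proof.
move=> b0; rewrite ge0_integral_scale; last 3 first.
- exact: measurable_gaussian.
- by move=> x; exact: gaussian_ge0.
- by rewrite exprn_ge0// divr_ge0 ?pi_ge0 ?(ltW b0).
rewrite integral_gaussian// -EFinM -exprMn mulrA mulfVK ?divff ?expr1n//.
  by rewrite gt_eqF.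
by rewrite gt_eqF// pi_gt0.
Qed.

Lemma approx_identity f (e : R) : BUC f -> 0 < e -> exists b0, forall b, b0 <= b -> 0 < b -> forall z,
  (\int[leb]_x (gdens b x * normc (f (z - x) - f z))%:E <= e%:E)%E.
Proof.
move=> fB e0; have e2 : 0 < e / 2 by rewrite divr_gt0.
have [K K0 KP] := oscillation_le fB e2.
have [M M0 [mf fM]] := BUC_bounded fB.
(* The second moment contributes 2K 2^n / b, which must not exceed e/2. *)
exists (4 * K * 2 ^+ n / e) => b bb b0 z.
have bp : 0 <= (b / pi) ^+ n by rewrite exprn_ge0// divr_ge0 ?pi_ge0 ?(ltW b0).
have b2 : 0 < b / 2 by rewrite divr_gt0.
have mgd : measurable_fun setT (gdens b) by apply: measurable_funM => //; exact: measurable_gaussian.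
have mg2 : measurable_fun setT (@gaussian R n (b / 2)) by exact: measurable_gaussian.
have k0 : 0 <= 2 * K / b * (b / pi) ^+ n by rewrite mulr_ge0// divr_ge0 ?mulr_ge0 ?(ltW b0).
apply: (@le_trans _ _ (\int[leb]_x ((e / 2 * gdens b x)%:E + (2 * K / b * (b / pi) ^+ n * gaussian (b / 2) x)%:E))%E).
  apply: ge0_le_integral => //.
  - by move=> x _; rewrite lee_fin mulr_ge0 ?normc_ge0// mulr_ge0 ?gaussian_ge0.
  - apply/measurable_EFinP; apply: measurable_funM => //; apply: measurable_normc.
    by apply: cmeasB; [exact: cmeas_reflect|exact: cmeas_cst].
  - by apply: emeasurable_funD; apply/measurable_EFinP; apply: measurable_funM.
  move=> x _; rewrite -EFinD lee_fin /gdens.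
  (* y <= e^y at y = b|x|^2/2: half of the Gaussian absorbs the factor |x|^2. *)
  have gg : gaussian b x * sqnorm x <= 2 / b * gaussian (b / 2) x.
    have -> : gaussian b x = gaussian (b / 2) x * expR (- (b / 2 * sqnorm x)).
      by rewrite /gaussian -expRD; congr expR; rewrite {1}(splitr b); ring.
    rewrite -mulrA mulrC ler_wpM2r ?gaussian_ge0//.
    rewrite expRN mulrC ler_pdivrMr ?expR_gt0// mulrC -ler_pdivrMr ?divr_gt0//.
    rewrite invf_div mulrC; apply: le_trans (expR_ge1Dx _).
    by rewrite ler_wpDl.
  have := ler_wpM2l (gaussian_ge0 b x) (KP z x).
  move=> H; have := ler_wpM2l bp H; have := ler_wpM2l K0 gg => H2 H3.
  have := ler_wpM2l bp H2; move: H3.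
  by move: ((b / pi) ^+ n) (gaussian b x) (normc _) (sqnorm x) (gaussian _ x) (b^-1) => *; lra.
rewrite ge0_integralD//; last 4 first.
- by move=> x _; rewrite lee_fin !mulr_ge0 ?gaussian_ge0 ?invr_ge0 ?(ltW e0).
- by apply/measurable_EFinP; apply: measurable_funM.
- by move=> x _; rewrite lee_fin mulr_ge0 ?gaussian_ge0.
- by apply/measurable_EFinP; apply: measurable_funM.
rewrite ge0_integral_scale ?(ltW e2)//; last by move=> x; rewrite mulr_ge0 ?gaussian_ge0.
rewrite integral_gdens// mule1 ge0_integral_scale//; last by move=> x; exact: gaussian_ge0.
rewrite integral_gaussian// -EFinM -EFinD lee_fin.
have -> : 2 * K / b * (b / pi) ^+ n * (pi / (b / 2)) ^+ n = 2 * K * 2 ^+ n / b.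
  rewrite -mulrA -exprMn (_ : b / pi * (pi / (b / 2)) = 2); first by rewrite mulrAC.
  by have := pi_gt0 R; move: (pi : R) => x x0; field; rewrite !gt_eqF.
rewrite [leRHS]splitr lerD2l ler_pdivrMr//.
move: bb; rewrite ler_pdivrMr// => bb.
by move: bb; move: (2 ^+ n) => x; lra.
Qed.

Lemma gdens_ge0 (b : R) x : 0 < b -> 0 <= gdens b x.
Proof.
by move=> b0; rewrite mulr_ge0 ?gaussian_ge0// exprn_ge0// divr_ge0 ?pi_ge0 ?(ltW b0).
Qed.

Lemma cintble_gdens (b : R) : 0 < b -> cintble leb (fun x : Cn => (gdens b x)%:C).
Proof.
move=> b0; have := cintbleZ ((b / pi) ^+ n)%:C (cintble_gaussian b0).
by congr cintble; apply/funext => x; rewrite -rmorphM.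
Qed.

Lemma gdens_convE f (b M : R) z : 0 < b -> cbounded f M ->
  cint leb (fun x => (gdens b x)%:C * f (z - x)) = ((b / pi) ^+ n)%:C * gconv f b z.
Proof.
move=> b0 fM; rewrite /gconv -cintZ; last exact: cintble_gconv fM.
by apply: eq_cint => x; rewrite /gdens rmorphM /=; ring.
Qed.

Lemma gdens_dist_le f (b M e : R) z : 0 < b -> cbounded f M ->
  (\int[leb]_x (gdens b x * normc (f (z - x) - f z))%:E <= e%:E)%E ->
  normc (cint leb (fun x => (gdens b x)%:C * f (z - x)) - f z) <= e.
Proof.
move=> b0 fM fe; have gdi := cintble_gdens b0; have [mf fb] := fM.
have g1 : cint leb (fun x => (gdens b x)%:C) = 1.
  by rewrite cintE /Rintegral /= integral0 integral_gdens.
have dM : cbounded (fun x : Cn => f (z - x) - f z) (M + M).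
  split; first by apply: cmeasB; [exact: cmeas_reflect|exact: cmeas_cst].
  by move=> x; apply: le_trans (le_normcB _ _) _; rewrite lerD.
have gfi := cintble_bounded gdi (cbounded_reflect z fM).
have -> : cint leb (fun x => (gdens b x)%:C * f (z - x)) - f z =
    cint leb (fun x => (gdens b x)%:C * (f (z - x) - f z)).
  rewrite -[f z in LHS]mulr1 -g1 -cintZ// -cintB//; last exact: cintbleZ.
  by apply: eq_cint => x; ring.
apply: cint_norm_le_fin; first exact: cintble_bounded gdi dM.
apply: le_trans fe; rewrite le_eqVlt; apply/orP; left; apply/eqP.
apply: eq_integral => x _; congr EFin; rewrite Normc.normcM normc_real ger0_norm//.
exact: gdens_ge0.
Qed.

Lemma gconv_dense (D Q : set (Cn -> R[i])) (tau : R) : D `<=` (@BUC R n) -> subspace Q ->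
  uniform_closed Q -> 0 < tau -> (forall f b, D f -> 0 < b <= tau -> Q (gconv f b)) ->
  D `<=` Q.
Proof.
move=> DB Qsub Qcl t0 Qb f Df; have Qall := gconv_all DB Qsub Qcl t0 Qb.
have fB := DB _ Df; have [M M0 fM] := BUC_bounded fB.
apply: Qcl => e e0; have [b0 b0P] := approx_identity fB e0.
pose b := Num.max b0 1.
have bb : b0 <= b by rewrite le_max lexx.
have bpos : 0 < b by rewrite lt_max ltr01 orbT.
exists (fun z => ((b / pi) ^+ n)%:C * gconv f b z).
  have [Q0 Qlin] := Qsub; have := Qlin ((b / pi) ^+ n)%:C _ _ (Qall _ _ Df bpos) Q0.
  by rewrite addr0.
move=> z; rewrite -normcN opprB -(gdens_convE z bpos fM).
exact: gdens_dist_le bpos fM (b0P b bb bpos z).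
Qed.

End Convolution.

(** * Products of Toeplitz operators *)

Section IteratedIntegral.
Variable R : realType.
Context d1 d2 (T1 : measurableType d1) (T2 : measurableType d2).
Variables (m1 : {sigma_finite_measure set T1 -> \bar R})
          (m2 : {sigma_finite_measure set T2 -> \bar R}).
Variable f : T1 * T2 -> R[i].

Lemma cintble_cint2 : cintble (m1 \x m2)%E f ->
  cintble m2 (fun y => cint m1 (fun x => f (x, y))).
Proof.
move=> fi; split; first exact: cmeas_cint2 fi.
have [mf fin] := fi; have mn := measurable_enormc mf.
apply: le_lt_trans fin; rewrite fubini_tonelli2//; last first.
  by move=> x; rewrite lee_fin normc_ge0.
apply: ge0_le_integral => //.
- by move=> y _; rewrite lee_fin normc_ge0.
- by apply: measurable_enormc; exact: cmeas_cint2 fi.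
- by apply: measurable_fun_fubini_tonelli_G => // x; rewrite lee_fin normc_ge0.
move=> y _; rewrite /fubini_G.
have [lt|] := ltP (\int[m1]_x (normc (f (x, y)))%:E)%E +oo%E.
  apply: cint_norm_le; split => //.
  by apply: (cmeas_comp mf); exact: measurable_pair2.
by rewrite leye_eq => /eqP ->; rewrite leey.
Qed.

End IteratedIntegral.

Section SquareMeasure.
Variables (R : realType) (n : nat).
Local Notation Cn := ('rV[R[i]]_n).
Local Notation leb := (lebesgue_Cn R n).

(** A name for the product measure that carries its sigma-finite structure, so that Fubini applies
    on C^n x (C^n x C^n). *)
Definition leb2 : set (Cn * Cn) -> \bar R := (leb \x leb)%E.
HB.instance Definition _ := Measure.on leb2.
HB.instance Definition _ := Measure_isSigmaFinite.Build _ _ _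
  leb2 (@product_sigma_finite _ _ _ _ R _ _).

Lemma reflect2_mpreserving (v : Cn) :
  mpreserving leb2 (fun xy : Cn * Cn => (v - xy.1, v - xy.2)).
Proof.
have [mr rP] := @reflect_mpreserving R n v.
have mphi : measurable_fun setT (fun xy : Cn * Cn => (v - xy.1, v - xy.2)).
  by apply/measurable_fun_pairP; split; apply: (measurableT_comp mr).
split => // f mf f0.
rewrite /leb2 fubini_tonelli1//; last first.
  exact: (measurableT_comp mf mphi).
rewrite fubini_tonelli1//.
rewrite /fubini_F /=.
under eq_integral => x _.
  rewrite (rP (fun y => f (v - x, y))); last 2 first.
  - by apply: (measurableT_comp mf); exact: measurable_pair1.
  - by [].
  over.
rewrite (rP (fun x => \int[leb]_y f (x, y))%E)//.
- exact: measurable_fun_fubini_tonelli_F.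
- by move=> x; exact: integral_ge0.
Qed.

End SquareMeasure.

Section ToeplitzProduct.
Variables (R : realType) (n : nat) (p t : {posnum R}).
Local Notation Cn := ('rV[R[i]]_n).
Local Notation leb := (lebesgue_Cn R n).
Local Notation P := (p%:num).
Local Notation T := (t%:num).
Implicit Types (f g h U : Cn -> R[i]) (z w v x y : Cn).
Hypothesis p1 : 1 < P.

(** The kernel of P_t adds 1/t to the coefficient c and w/t to the antiholomorphic part a';
    [gaussian_shift] with the coefficient c + 1/t then evaluates U at the displayed point a. *)
Lemma proj_cexp (c : R) (a' q : Cn) (k : R[i]) U w : 0 <= c ->
  [/\ cmeas U, (wint p t U < +oo)%E & Hol U] ->
  let a := ((c + T^-1)^-1)%:C *: ((T^-1)%:C *: w + a') in
  proj t (fun v => cexp (- (c%:C * cdot v v) + cdot a' v + cdot v q + k) * U v) w =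
  (kcst n t * (pi / (c + T^-1)) ^+ n)%:C * (cexp (cdot a q + k) * U a).
Proof.
move=> c0 [mU Ufin hU] a.
have T0 : 0 < T by [].
have c'0 : 0 < c + T^-1 by rewrite ltr_wpDl// invr_gt0.
have mcd : cmeas (fun v : Cn => - (c%:C * cdot v v) + cdot a' v + cdot v q + k).
  apply: cmeasD; last exact: cmeas_cst.
  apply: cmeasD; last by apply: cmeas_cdot.
  apply: cmeasD; last by apply: cmeas_cdot.
  by apply: cmeasN; apply: cmeasZ; apply: cmeas_cdot.
rewrite projE; last by apply: cmeasM => //; exact: cmeas_cexp.
have expo v : kern t w v * (cexp (- (c%:C * cdot v v) + cdot a' v + cdot v q + k) * U v) =
    ((kcst n t)%:C * cexp k) * (cexp (- ((c + T^-1)%:C * cdot v v) + (c + T^-1)%:C * cdot a v + cdot v q) * U v).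
  rewrite /kern gauss_densityE rmorphM /= gaussian_cexp.
  transitivity ((kcst n t)%:C * (cexp (- ((T^-1)%:C * cdot v v)) * (cexp (cdot w v / T%:C) *
     (cexp (- (c%:C * cdot v v) + cdot a' v + cdot v q + k) * U v)))); first by ring.
  rewrite !cexpDM; set e1 := cexp _.
  transitivity ((kcst n t)%:C * (cexp k * (cexp (- ((c + T^-1)%:C * cdot v v) + (c + T^-1)%:C * cdot a v + cdot v q) * U v))); last by ring.
  rewrite cexpDM /e1; congr (_ * (cexp _ * _)).
  rewrite /a cdotZl cdotDl cdotZl.
  rewrite [in RHS]mulrA -[in RHS]rmorphM mulfV ?gt_eqF// rmorph1 mul1r.
  rewrite rmorphD /= -fmorphV /=; ring.
pose E v := cexp (- (c%:C * cdot v v) + cdot a' v + cdot v q + k).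
have mE : cmeas E by exact: cmeas_cexp.
have ki : cintble leb (fun v => (kern t w v * E v) * U v).
  apply: (@cintble_weighted R n p t (ltW p1) U _
    (kcst n t * expR (Re k)) T^-1 (l1norm w / T + (l1norm a' + l1norm q)) (half_lt_invT t)) => //.
    by apply: cmeasM => //; apply: cmeas_kern => //; exact: measurable_cst.
  move=> v; rewrite Normc.normcM.
  have E_le : normc (E v) <= expR (Re k) * expR ((l1norm a' + l1norm q) * l1norm v).
    rewrite /E normc_cexp -expRD ler_expR !ReD ReN cdot_self -rmorphM /=.
    have H1 := le_trans (ler_norm _) (le_trans (Re_le_normc _) (normc_cdot_le a' v)).
    have H2 := le_trans (ler_norm _) (le_trans (Re_le_normc _) (normc_cdot_le v q)).
    have H3 := mulr_ge0 c0 (sqnorm_ge0 v).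
    move: H1 H2 H3; rewrite [l1norm v * _]mulrC mulrDl.
    by move: (Re (cdot a' v)) (Re (cdot v q)) (c * _) (l1norm a' * _) (l1norm q * _) => *; lra.
  have := ler_pM (normc_ge0 _) (normc_ge0 _) (normc_kern_le t w v) E_le.
  move/le_trans; apply; rewrite le_eqVlt; apply/orP; left; apply/eqP.
  rewrite [(l1norm w / T + _) * _]mulrDl expRD; ring.
rewrite (eq_cint _ expo) cintZ; last first.
  have k0 : (kcst n t)%:C * cexp k != 0.
    by rewrite mulf_neq0// ?cexp_neq0// fmorph_eq0 gt_eqF// kcst_gt0.
  have := cintbleZ ((kcst n t)%:C * cexp k)^-1 ki.
  congr cintble; apply/funext => v; rewrite -[in LHS]mulrA.
  by rewrite expo [LHS]mulrA mulVf// mul1r.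
rewrite gaussian_shift//; last first.
  have k0 : (kcst n t)%:C * cexp k != 0.
    by rewrite mulf_neq0// ?cexp_neq0// fmorph_eq0 gt_eqF// kcst_gt0.
  have := cintbleZ ((kcst n t)%:C * cexp k)^-1 ki.
  congr cintble; apply/funext => v; rewrite -[in LHS]mulrA.
  by rewrite expo [LHS]mulrA mulVf// mul1r.
rewrite rmorphM /=.
transitivity ((kcst n t)%:C * ((pi / (c + T^-1)) ^+ n)%:C * (cexp k * (cexp (cdot a q) * U a))).
  by ring.
by rewrite cexpDM [k + _]addrC.
Qed.

(** Fubini under the projection: an integral of symbols can be taken outside. The bound C, uniform
    in v, combines with the integrability of [kern] times V into joint integrability. *)
Lemma proj_cint d (X : measurableType d) (m : {sigma_finite_measure set X -> \bar R})
    (k : Cn * X -> R[i]) (C : R) V z :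
  cmeas k -> (forall v, (\int[m]_(x in [set: X]) (normc (k (v, x)))%:E <= C%:E)%E) ->
  cmeas (fun v => cint m (fun x : X => k (v, x))) -> cmeas V -> (wint p t V < +oo)%E ->
  cintble m (fun x : X => proj t (fun v => k (v, x) * V v) z) /\
  proj t (fun v => cint m (fun x : X => k (v, x)) * V v) z =
  cint m (fun x : X => proj t (fun v => k (v, x) * V v) z).
Proof.
move=> mk kC mck mV Vfin; have ki := cintble_kern p1 z mV Vfin.
pose Phi (vx : Cn * X) := kern t z vx.1 * V vx.1 * k vx.
have mfst : measurable_fun setT (@fst Cn X) by exact: measurable_fst.
have mkV : cmeas (fun v => kern t z v * V v) by case: ki.
have mPhi : cmeas Phi by apply: cmeasM => //; exact: (cmeas_comp mkV mfst).
have mkx (x : X) : cmeas (fun v => k (v, x)) by apply: (cmeas_comp mk); exact: measurable_pair2.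
have mkv v : cmeas (fun x : X => k (v, x)) by apply: (cmeas_comp mk); exact: measurable_pair1.
have kvi v : cintble m (fun x : X => k (v, x)).
  by split => //; apply: le_lt_trans (kC v) _; rewrite ltry.
have C0 : 0 <= C.
  by rewrite -lee_fin; apply: le_trans (kC 0); apply: integral_ge0 => x _; rewrite lee_fin normc_ge0.
have Phii : cintble (leb \x m)%E Phi.
  apply: cintble_prod => //; have [_ fin] := ki.
  apply: (@le_lt_trans _ _ (\int[leb]_v (C * normc (kern t z v * V v))%:E)%E); last first.
    rewrite ge0_integral_scale//; last 2 first.
    - exact: measurable_normc.
    - by move=> v; exact: normc_ge0.
    by rewrite lte_mul_pinfty ?lee_fin.
  apply: ge0_le_integral => //.
  - by move=> v _; apply: integral_ge0 => x _; rewrite lee_fin normc_ge0.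
  - apply: (@measurable_fun_fubini_tonelli_F _ _ _ _ _ _ (fun vx => (normc (Phi vx))%:E)) => //.
      exact: measurable_enormc.
    by move=> x; rewrite lee_fin normc_ge0.
  - apply/measurable_EFinP; apply: measurable_funM; first exact: measurable_cst.
    exact: measurable_normc.
  move=> v _.
  under eq_integral do rewrite Normc.normcM.
  rewrite (@ge0_integral_scale _ _ _ m (normc (kern t z v * V v)) (fun x : X => normc (k (v, x)))) ?normc_ge0//; last first.
  - by move=> x; exact: normc_ge0.
  - exact: measurable_normc.
  rewrite [C * _]mulrC [leRHS]EFinM; apply: lee_wpmul2l; first by rewrite lee_fin normc_ge0.
  exact: kC.
have PhiE (x : X) : proj t (fun v => k (v, x) * V v) z = cint leb (fun v => Phi (v, x)).
  rewrite projE; last exact: cmeasM.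
  by apply: eq_cint => v; rewrite /Phi /= -[RHS]mulrA [V v * _]mulrC.
have PhiF : (fun x : X => proj t (fun v => k (v, x) * V v) z) = (fun x : X => cint leb (fun v => Phi (v, x))).
  exact: funext.
rewrite PhiF; split; first exact: cintble_cint2.
rewrite projE; last exact: cmeasM.
rewrite -cint_fubini//; apply: eq_cint => v.
rewrite /Phi /= cintZ//; ring.
Qed.

Lemma gconvE f (b : R) M v : cbounded f M ->
  gconv f b v = cint leb (fun x => (gaussian b (v - x))%:C * f x).
Proof.
move=> [mf _]; have [mr _] := @reflect_mpreserving R n v.
rewrite -(cint_mpreserving (reflect_mpreserving v)).
  by apply: eq_cint => x; rewrite subKr.
by apply: cmeasM => //; apply: cmeas_real; apply: (measurableT_comp (@measurable_gaussian R n b)).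
Qed.

Lemma gaussian_subE (b : R) v x : (gaussian b (v - x))%:C =
  cexp (- (b%:C * cdot v v) + cdot (b%:C *: x) v + cdot v (b%:C *: x) + - (b%:C * cdot x x)).
Proof.
by rewrite gaussian_cexp cdotZl cdotZrr !cdotDl !cdotDr !cdotNl !cdotNr; congr cexp; ring.
Qed.

(* The symbol of the product of two Toeplitz operators whose symbols are the
   Gaussians [gaussian b1] and [gaussian b2] centred at [v - x] and [v - y]. *)
Definition pkern (b1 b2 : R) (x y : Cn) : R[i] :=
  cexp (- (b1%:C * cdot x x) - b2%:C * cdot y y - (T * b1 * b2)%:C * cdot y x).

(** Since t b1 <= 1 and t b2 <= 1, the coefficient t b1 b2 is at most b1 and at most b2; as |Re <y,
    x>| <= (|x|^2 + |y|^2)/2, the cross term uses up at most half of each square. *)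
Lemma normc_pkern_le (b1 b2 : R) x y : 0 < b1 <= T^-1 -> 0 < b2 <= T^-1 ->
  normc (pkern b1 b2 x y) <= gaussian (b1 / 2) x * gaussian (b2 / 2) y.
Proof.
move=> /andP[b10 b1T] /andP[b20 b2T]; rewrite /pkern normc_cexp /gaussian -expRD ler_expR.
rewrite !ReD !ReN !cdot_self -!rmorphM /=.
have -> : Re ((T * b1 * b2)%:C * cdot y x) = T * b1 * b2 * Re (cdot y x).
  by rewrite ReM /= mul0r subr0.
have T0 : 0 < T by [].
have h1 : T * b1 <= 1 by rewrite mulrC -ler_pdivlMr// mul1r.
have h2 : T * b2 <= 1 by rewrite mulrC -ler_pdivlMr// mul1r.
have H := Re_cdot_ge y x.
have k0 : 0 <= T * b1 * b2 by rewrite !mulr_ge0 ?(ltW b10) ?(ltW b20).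
have H' := ler_wpM2l k0 H.
have a1 : T * b1 * b2 <= b2 by rewrite ler_piMl// ltW.
have a2 : T * b1 * b2 <= b1 by rewrite mulrAC ler_piMl// ltW.
have c1 := ler_wpM2r (sqnorm_ge0 y) a1; have c2 := ler_wpM2r (sqnorm_ge0 x) a2.
move: H' c1 c2; move: (T * b1 * b2) (Re _) (sqnorm x) (sqnorm y) => K r s1 s2; lra.
Qed.

Lemma proj_gaussian (b : R) x U w : 0 <= b ->
  [/\ cmeas U, (wint p t U < +oo)%E & Hol U] ->
  let a := ((b + T^-1)^-1)%:C *: ((T^-1)%:C *: w + b%:C *: x) in
  proj t (fun v => (gaussian b (v - x))%:C * U v) w =
  (kcst n t * (pi / (b + T^-1)) ^+ n)%:C * (cexp (cdot a (b%:C *: x) - b%:C * cdot x x) * U a).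
Proof.
move=> b0 HU a; rewrite -(@proj_cexp b (b%:C *: x) (b%:C *: x) (- (b%:C * cdot x x)) U w b0 HU).
by congr (proj t _ w); apply/funext => v; rewrite gaussian_subE.
Qed.

(** Read from right to left: the two Gaussian symbols, applied successively, act as the single
    symbol [pkern]. Both sides are instances of [proj_cexp]; constants, evaluation points and
    exponents then agree by rational identities in b1, b2 and t. *)
Lemma proj_pkern (b1 b2 : R) x y U z : 0 <= b1 -> 0 <= b2 ->
  [/\ cmeas U, (wint p t U < +oo)%E & Hol U] ->
  let a := ((b1 + T^-1)^-1)%:C *: ((T^-1)%:C *: z + b1%:C *: x) in
  proj t (fun v => pkern b1 b2 (v - x) (v - y) * U v) z =
  (kcst n t * (pi / (b1 + T^-1)) ^+ n)%:C * (cexp (cdot a (b1%:C *: x) - b1%:C * cdot x x) *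
    proj t (fun v => (gaussian b2 (v - y))%:C * U v) a).
Proof.
move=> b10 b20 HU a; apply/esym.
have T0 : 0 < T by [].
(* The exponent of [pkern] at (v - x, v - y), sorted: [c] belongs to |v|^2, [a'] to the part
   antiholomorphic in v, [q] to the holomorphic part, and [k] is the constant. *)
pose c : R := b1 + b2 + T * b1 * b2.
have c0 : 0 <= c by rewrite /c !addr_ge0// !mulr_ge0// ltW.
pose a' : Cn := b1%:C *: x + (b2 + T * b1 * b2)%:C *: y.
pose q : Cn := (b1 + T * b1 * b2)%:C *: x + b2%:C *: y.
pose k : R[i] := - (b1%:C * cdot x x) - b2%:C * cdot y y - (T * b1 * b2)%:C * cdot y x.
have -> : (fun v => pkern b1 b2 (v - x) (v - y) * U v) =
    (fun v => cexp (- (c%:C * cdot v v) + cdot a' v + cdot v q + k) * U v).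
  apply/funext => v; congr (cexp _ * _); rewrite /a' /q /k /c.
  rewrite !cdotDl !cdotDr !cdotNl !cdotNr !cdotZl !cdotZrr !rmorphD /=; ring.
rewrite (proj_gaussian y a b20 HU) (proj_cexp a' q k z c0 HU).
set a2 := _ *: (_ + b2%:C *: y); set a3 := _ *: (_ + a').
have d1 : 0 < b1 + T^-1 by rewrite ltr_wpDl// invr_gt0.
have d2 : 0 < b2 + T^-1 by rewrite ltr_wpDl// invr_gt0.
(* The factorization that the coefficient t b1 b2 of the cross term is made for: it matches the
   product of the two normalizing constants. *)
have c'E : c + T^-1 = T * (b1 + T^-1) * (b2 + T^-1).
  by rewrite /c; field; rewrite gt_eqF.
have nT : T != 0 by rewrite gt_eqF.
have n1 : b1 * T + 1 != 0 by rewrite gt_eqF// ltr_wpDl// mulr_ge0// ltW.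
have n2 : b2 * T + 1 != 0 by rewrite gt_eqF// ltr_wpDl// mulr_ge0// ltW.
pose A : R := (T * (b1 + T^-1) * (b2 + T^-1))^-1.
have aE : a = ((b1 + T^-1)^-1 * T^-1)%:C *: z + ((b1 + T^-1)^-1 * b1)%:C *: x.
  by rewrite /a scalerDr !scalerA -!rmorphM.
have a3E : a3 = (A * T^-1)%:C *: z + (A * b1)%:C *: x + (A * (b2 + T * b1 * b2))%:C *: y.
  by rewrite /a3 /a' c'E !scalerDr !scalerA -!rmorphM addrA.
have a23 : a2 = a3.
  rewrite a3E /a2 aE !scalerDr !scalerA -!rmorphM /A.
  have k1 : (b2 + T^-1)^-1 * T^-1 * ((b1 + T^-1)^-1 * T^-1) = (T * (b1 + T^-1) * (b2 + T^-1))^-1 * T^-1.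
    by field; rewrite ?nT ?n1 ?n2.
  have k2 : (b2 + T^-1)^-1 * T^-1 * ((b1 + T^-1)^-1 * b1) = (T * (b1 + T^-1) * (b2 + T^-1))^-1 * b1.
    by field; rewrite ?nT ?n1 ?n2.
  have k3 : (b2 + T^-1)^-1 * b2 = (T * (b1 + T^-1) * (b2 + T^-1))^-1 * (b2 + T * b1 * b2).
    by field; rewrite ?nT ?n1 ?n2.
  by rewrite k1 k2 k3.
rewrite a23.
have -> : kcst n t * (pi / (c + T^-1)) ^+ n = (kcst n t * (pi / (b1 + T^-1)) ^+ n) * (kcst n t * (pi / (b2 + T^-1)) ^+ n).
  rewrite mulrACA -exprMn -mulrA; congr (_ * _); rewrite /kcst -exprVn -exprMn; congr (_ ^+ _).
  rewrite c'E; move: (b1 + _) (b2 + _) d1 d2 (pi_gt0 R) => r1 r2 r10 r20.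
  move: (pi : R) (T : R) T0 => r3 r4 r40 r30; field; rewrite !gt_eqF//.
rewrite rmorphM /=; transitivity ((kcst n t * (pi / (b1 + T^-1)) ^+ n)%:C * (kcst n t * (pi / (b2 + T^-1)) ^+ n)%:C *
  (cexp (cdot a (b1%:C *: x) - b1%:C * cdot x x) * (cexp (cdot a3 (b2%:C *: y) - b2%:C * cdot y y) * U a3))).
  by ring.
rewrite cexpDM; congr (_ * (cexp _ * _)); first by rewrite -rmorphM.
have E1 : ((b1 + T * b1 * b2)%:C * (A * T^-1)%:C = b1%:C * ((b1 + T^-1)^-1 * T^-1)%:C).
  by rewrite -!rmorphM; congr (_%:C); rewrite /A; field; rewrite ?nT ?n1 ?n2.
have E2 : ((b1 + T * b1 * b2)%:C * (A * b1)%:C = b1%:C * ((b1 + T^-1)^-1 * b1)%:C).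
  by rewrite -!rmorphM; congr (_%:C); rewrite /A; field; rewrite ?nT ?n1 ?n2.
have E3 : ((b1 + T * b1 * b2)%:C * (A * (b2 + T * b1 * b2))%:C = (T * b1 * b2)%:C).
  by rewrite -!rmorphM; congr (_%:C); rewrite /A; field; rewrite ?nT ?n1 ?n2.
rewrite /q /k aE a3E !cdotDl !cdotDr !cdotZrr !cdotZl.
move: E1 E2 E3.
move: ((b1 + T * b1 * b2)%:C) ((A * T^-1)%:C) ((A * b1)%:C) ((A * (b2 + T * b1 * b2))%:C) (((b1 + T^-1)^-1 * T^-1)%:C) (((b1 + T^-1)^-1 * b1)%:C) ((T * b1 * b2)%:C) => k1 k2 k3 k4 k5 k6 k7 E1 E2 E3.
apply/eqP; rewrite -subr_eq0; apply/eqP.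
transitivity ((b1%:C * k5 - k1 * k2) * cdot z x + (b1%:C * k6 - k1 * k3) * cdot x x + (k7 - k1 * k4) * cdot y x).
  by ring.
by rewrite E1 E2 E3 !subrr !mul0r !addr0.
Qed.

Lemma projZ (c : R[i]) h z : cmeas h -> (wint p t h < +oo)%E ->
  proj t (fun v => c * h v) z = c * proj t h z.
Proof.
move=> mh hfin; rewrite !projE//; last exact: cmeasZ.
rewrite -cintZ; last exact: (cintble_kern p1).
by apply: eq_cint => v; ring.
Qed.

Lemma cbounded_gaussian (b : R) x : 0 <= b -> cbounded (fun v => (gaussian b (v - x))%:C) 1.
Proof.
move=> b0; split.
  by apply: cmeas_real; apply: (measurableT_comp (@measurable_gaussian R n b)); exact: measurable_shift.
move=> v; rewrite normc_real ger0_norm ?gaussian_ge0// /gaussian -expR0 ler_expR oppr_le0.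
by rewrite mulr_ge0// sqnorm_ge0.
Qed.

Lemma cmeas_pkern (b1 b2 : R) d (X : measurableType d) (F G : X -> Cn) :
  measurable_fun setT F -> measurable_fun setT G -> cmeas (fun x : X => pkern b1 b2 (F x) (G x)).
Proof.
move=> mF mG; apply: cmeas_cexp; apply: cmeasB; last by apply: cmeasZ; exact: cmeas_cdot.
by apply: cmeasB; [apply: cmeasN|]; apply: cmeasZ; exact: cmeas_cdot.
Qed.

Lemma cbounded_pkern (b1 b2 : R) x y : 0 < b1 <= T^-1 -> 0 < b2 <= T^-1 ->
  cbounded (fun v => pkern b1 b2 (v - x) (v - y)) 1.
Proof.
move=> h1 h2; split; first by apply: cmeas_pkern; exact: measurable_shift.
move=> v; apply: le_trans (normc_pkern_le _ _ h1 h2) _.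
move: h1 h2 => /andP[h1 _] /andP[h2 _].
have le1 (b : R) (w : Cn) : 0 < b -> gaussian (b / 2) w <= 1.
  move=> b0; rewrite /gaussian -expR0 ler_expR oppr_le0 mulr_ge0 ?sqnorm_ge0//.
  by rewrite divr_ge0// ltW.
by have := ler_pM (gaussian_ge0 _ _) (gaussian_ge0 _ _) (le1 b1 (v - x) h1) (le1 b2 (v - y) h2); rewrite mulr1.
Qed.

Lemma cintble_pkern (b1 b2 : R) : 0 < b1 <= T^-1 -> 0 < b2 <= T^-1 ->
  cintble (@leb2 R n) (fun xy => pkern b1 b2 xy.1 xy.2).
Proof.
move=> h1 h2; have mpk : cmeas (fun xy : Cn * Cn => pkern b1 b2 xy.1 xy.2).
  by apply: cmeas_pkern; [exact: measurable_fst|exact: measurable_snd].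
apply: cintble_prod => //.
have /andP[b10 _] := h1; have /andP[b20 _] := h2.
have d1 : 0 < b1 / 2 by rewrite divr_gt0.
have d2 : 0 < b2 / 2 by rewrite divr_gt0.
apply: (@le_lt_trans _ _ (\int[leb]_x ((pi / (b2 / 2)) ^+ n * gaussian (b1 / 2) x)%:E)%E); last first.
  have k0 : 0 <= (pi / (b2 / 2)) ^+ n by rewrite exprn_ge0// divr_ge0 ?pi_ge0 ?(ltW d2).
  rewrite ge0_integral_scale//; last 2 first.
  - exact: measurable_gaussian.
  - by move=> w; exact: gaussian_ge0.
  by rewrite integral_gaussian// -EFinM ltry.
apply: ge0_le_integral => //.
- by move=> x _; apply: integral_ge0 => y _; rewrite lee_fin normc_ge0.
- apply: (@measurable_fun_fubini_tonelli_F _ _ _ _ _ _ (fun xy : Cn * Cn => (normc (pkern b1 b2 xy.1 xy.2))%:E)) => //.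
    exact: measurable_enormc.
  by move=> x; rewrite lee_fin normc_ge0.
- by apply/measurable_EFinP; apply: measurable_funM => //; exact: measurable_gaussian.
move=> x _; apply: (@le_trans _ _ (\int[leb]_y (gaussian (b1 / 2) x * gaussian (b2 / 2) y)%:E)%E).
  apply: ge0_le_integral => //.
  - by move=> y _; rewrite lee_fin normc_ge0.
  - by apply: measurable_enormc; apply: (cmeas_comp mpk); exact: measurable_pair1.
  - by apply/measurable_EFinP; apply: measurable_funM => //; exact: measurable_gaussian.
  by move=> y _; rewrite lee_fin normc_pkern_le.
rewrite ge0_integral_scale ?gaussian_ge0//; last 2 first.
- exact: measurable_gaussian.
- by move=> w; exact: gaussian_ge0.
by rewrite integral_gaussian// -EFinM mulrC.
Qed.

Definition pconv (b1 b2 : R) f g v : R[i] :=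
  cint (@leb2 R n) (fun xy => pkern b1 b2 xy.1 xy.2 * (f (v - xy.1) * g (v - xy.2))).

Lemma pconvE (b1 b2 : R) f g v : cmeas f -> cmeas g -> pconv b1 b2 f g v =
  cint (@leb2 R n) (fun xy => pkern b1 b2 (v - xy.1) (v - xy.2) * (f xy.1 * g xy.2)).
Proof.
move=> mf mg; rewrite -(cint_mpreserving (reflect2_mpreserving v)).
  by apply: eq_cint => xy /=; rewrite !subKr.
have [mr _] := @reflect_mpreserving R n v.
apply: cmeasM; first by apply: cmeas_pkern; apply: (measurableT_comp mr).
by apply: cmeasM; [apply: (cmeas_comp mf)|apply: (cmeas_comp mg)].
Qed.

(** [proj_cint] pulls the integrals over x, over y and over (x, y) out of the three projections, and
    [proj_pkern] identifies the integrands for each x and y. *)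
Lemma toeplitz_gconv_mul (b1 b2 : R) f g (M1 M2 M3 M4 M5 : R) (u : fock n p t) :
  0 < b1 <= T^-1 -> 0 < b2 <= T^-1 -> cbounded f M1 -> cbounded g M2 ->
  cbounded (gconv f b1) M3 -> cbounded (gconv g b2) M4 -> cbounded (pconv b1 b2 f g) M5 ->
  toeplitz (gconv f b1) (toeplitz (gconv g b2) u) = toeplitz (pconv b1 b2 f g) u.
Proof.
move=> h1 h2 fM gM FM GM hM.
have /andP[b10 _] := h1; have /andP[b20 _] := h2.
apply: val_inj; apply/funext => z /=.
set V := toeplitz (gconv g b2) u.
rewrite (toeplitz_val p1 V FM) (toeplitz_val p1 u hM).
have [mV Vfin hV] := fock_valP V; have [mu ufin hu] := fock_valP u.
have [mf fb] := fM; have [mg gb] := gM.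
have mfst2 : measurable_fun setT (@fst Cn Cn) by exact: measurable_fst.
have msnd2 : measurable_fun setT (@snd Cn Cn) by exact: measurable_snd.
have kE (b : R) (f' : Cn -> R[i]) (M : R) : 0 < b -> cbounded f' M ->
    cmeas (fun vx : Cn * Cn => (gaussian b (vx.1 - vx.2))%:C * f' vx.2) /\
    (forall v, (\int[leb]_x (normc ((gaussian b (v - x))%:C * f' x))%:E <= (M * (pi / b) ^+ n)%:E)%E).
  move=> b0 [mf' fb']; split.
    apply: cmeasM; last exact: (cmeas_comp mf').
    apply: cmeas_real; apply: (measurableT_comp (@measurable_gaussian R n b)).
    exact: measurable_CnB.
  move=> v; have M0 : 0 <= M by exact: le_trans (normc_ge0 _) (fb' 0).
  apply: (@le_trans _ _ (\int[leb]_x (M * gaussian b (v - x))%:E)%E).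
    have mgv : measurable_fun setT (fun x => gaussian b (v - x)).
      apply: (measurableT_comp (@measurable_gaussian R n b)).
      by case: (@reflect_mpreserving R n v).
    apply: ge0_le_integral => //.
    - by move=> x _; rewrite lee_fin normc_ge0.
    - by apply: measurable_enormc; apply: cmeasM => //; exact: cmeas_real.
    - by apply/measurable_EFinP; apply: measurable_funM.
    move=> x _; rewrite lee_fin Normc.normcM normc_real ger0_norm ?gaussian_ge0//.
    by rewrite mulrC ler_wpM2r ?gaussian_ge0.
  have mg0 := @measurable_gaussian R n b.
  rewrite (integral_mpreserving (reflect_mpreserving v) (f := fun x => (M * gaussian b x)%:E)); last first.
    by apply/measurable_EFinP; apply: measurable_funM.
  by rewrite ge0_integral_scale// ?integral_gaussian// => x; exact: gaussian_ge0.
have [mk1 kM1] := kE _ _ _ b10 fM; have [mk2 kM2] := kE _ _ _ b20 gM.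
have PF : proj t (fun v => gconv f b1 v * V v) z =
    cint leb (fun x => proj t (fun v => (gaussian b1 (v - x))%:C * f x * V v) z).
  have Fg : gconv f b1 = fun v => cint leb (fun x => (gaussian b1 (v - x))%:C * f x).
    by apply/funext => v; exact: gconvE fM.
  have cF := FM.1; rewrite Fg in cF *.
  by have [_] := proj_cint z mk1 kM1 cF mV Vfin.
rewrite PF.
have PG w : cintble leb (fun y => proj t (fun v => (gaussian b2 (v - y))%:C * g y * u v) w) /\
    proj t (fun v => gconv g b2 v * u v) w =
    cint leb (fun y => proj t (fun v => (gaussian b2 (v - y))%:C * g y * u v) w).
  have Gg : gconv g b2 = fun v => cint leb (fun y => (gaussian b2 (v - y))%:C * g y).
    by apply/funext => v; exact: gconvE gM.
  have cG := GM.1; rewrite Gg in cG *.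
  exact: (proj_cint w mk2 kM2 cG mu ufin).
have Hh : pconv b1 b2 f g = fun v => cint (@leb2 R n) (fun xy => pkern b1 b2 (v - xy.1) (v - xy.2) * (f xy.1 * g xy.2)).
  by apply/funext => v; exact: pconvE mf mg.
have pki := cintble_pkern h1 h2.
pose K := fine (\int[@leb2 R n]_xy (normc (pkern b1 b2 xy.1 xy.2))%:E)%E.
have KE : (\int[@leb2 R n]_xy (normc (pkern b1 b2 xy.1 xy.2))%:E = K%:E)%E.
  rewrite fineK// ge0_fin_numE; first by case: pki.
  by apply: integral_ge0 => xy _; rewrite lee_fin normc_ge0.
pose k3 (vx : Cn * (Cn * Cn)) : R[i] := pkern b1 b2 (vx.1 - vx.2.1) (vx.1 - vx.2.2) * (f vx.2.1 * g vx.2.2).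
have m21 : measurable_fun setT (fun vx : Cn * (Cn * Cn) => vx.2.1).
  by apply: (measurableT_comp mfst2); exact: measurable_snd.
have m22 : measurable_fun setT (fun vx : Cn * (Cn * Cn) => vx.2.2).
  by apply: (measurableT_comp msnd2); exact: measurable_snd.
have mk3 : cmeas k3.
  apply: cmeasM; first by apply: cmeas_pkern; apply: measurable_CnB => //; exact: measurable_fst.
  by apply: cmeasM; [apply: (cmeas_comp mf m21)|apply: (cmeas_comp mg m22)].
have M10 : 0 <= M1 by exact: le_trans (normc_ge0 _) (fb 0).
have M20 : 0 <= M2 by exact: le_trans (normc_ge0 _) (gb 0).
have mnpk : measurable_fun setT (fun xy : Cn * Cn => normc (pkern b1 b2 xy.1 xy.2)).
  by apply: measurable_normc; case: pki.
have kM3 v : (\int[@leb2 R n]_xy (normc (k3 (v, xy)))%:E <= (M1 * M2 * K)%:E)%E.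
  have [mr2 _] := @reflect2_mpreserving R n v.
  apply: (@le_trans _ _ (\int[@leb2 R n]_xy (M1 * M2 * normc (pkern b1 b2 (v - xy.1) (v - xy.2)))%:E)%E).
    have mn : measurable_fun setT (fun xy : Cn * Cn => normc (pkern b1 b2 (v - xy.1) (v - xy.2))).
      exact: (measurableT_comp mnpk mr2).
    apply: ge0_le_integral => //.
    - by move=> xy _; rewrite lee_fin normc_ge0.
    - by apply: measurable_enormc; apply: (cmeas_comp mk3); exact: measurable_pair1.
    - by apply/measurable_EFinP; apply: measurable_funM.
    move=> xy _; rewrite lee_fin Normc.normcM mulrC ler_wpM2r ?normc_ge0//.
    by rewrite Normc.normcM ler_pM ?normc_ge0.
  rewrite (integral_mpreserving (reflect2_mpreserving v)
    (f := fun xy : Cn * Cn => (M1 * M2 * normc (pkern b1 b2 xy.1 xy.2))%:E)); last first.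
    by apply/measurable_EFinP; apply: measurable_funM.
  rewrite ge0_integral_scale ?mulr_ge0//; last by move=> xy; exact: normc_ge0.
  by rewrite KE.
have [PHi PH] : cintble (@leb2 R n) (fun xy => proj t (fun v => k3 (v, xy) * u v) z) /\
    proj t (fun v => pconv b1 b2 f g v * u v) z =
    cint (@leb2 R n) (fun xy => proj t (fun v => k3 (v, xy) * u v) z).
  have cH := hM.1; rewrite Hh in cH *.
  exact: (proj_cint z mk3 kM3 cH mu ufin).
rewrite PH.
rewrite -[RHS](cint_fubini1 (m1 := leb) (m2 := leb)
  (f := fun xy : Cn * Cn => proj t (fun v => pkern b1 b2 (v - xy.1) (v - xy.2) * (f xy.1 * g xy.2) * u v) z) PHi).
apply: eq_cint => x /=.
have gu1 (b : R) (w : Cn) (U : fock n p t) : 0 <= b ->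
    cmeas (fun v => (gaussian b (v - w))%:C * U v) /\ (wint p t (fun v => (gaussian b (v - w))%:C * U v)%R < +oo)%E.
  move=> b'0; have [mU Ufin _] := fock_valP U; have gb1 := cbounded_gaussian w b'0.
  by split; [apply: cmeasM => //; case: gb1|exact: wint_mul_lty gb1 mU Ufin].
have pku y : cmeas (fun v => pkern b1 b2 (v - x) (v - y) * u v) /\
    (wint p t (fun v => pkern b1 b2 (v - x) (v - y) * u v)%R < +oo)%E.
  have gb1 := cbounded_pkern x y h1 h2.
  by split; [apply: cmeasM => //; case: gb1|exact: wint_mul_lty gb1 mu ufin].
have e1 : (fun v => (gaussian b1 (v - x))%:C * f x * V v) = (fun v => f x * ((gaussian b1 (v - x))%:C * V v)).
  by apply/funext => v; ring.
have [gV1 gV2] := gu1 _ x V (ltW b10).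
rewrite e1 (projZ (f x) z gV1 gV2).
rewrite (proj_gaussian x z (ltW b10) (fock_valP V)).
set a := _ *: (_ + _); set C1 := (kcst n t * _)%:C; set C2 := cexp _.
have Va : V a = proj t (fun v => gconv g b2 v * u v) a by rewrite /V (toeplitz_val p1 _ GM).
have [PGi PGe] := PG a.
rewrite [V a]Va PGe.
transitivity (f x * C1 * C2 * cint leb (fun x0 => proj t (fun v => (gaussian b2 (v - x0))%:C * g x0 * u v) a)).
  by ring.
rewrite -(cintZ _ PGi); apply: eq_cint => y.
have e2 : (fun v => (gaussian b2 (v - y))%:C * g y * u v) = (fun v => g y * ((gaussian b2 (v - y))%:C * u v)).
  by apply/funext => v; ring.
have e3 : (fun v => pkern b1 b2 (v - x) (v - y) * (f x * g y) * u v) = (fun v => f x * g y * (pkern b1 b2 (v - x) (v - y) * u v)).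
  by apply/funext => v; ring.
have [gu1' gu2'] := gu1 _ y u (ltW b20); have [pku1 pku2] := pku y.
rewrite e2 e3 (projZ (g y) a gu1' gu2') (projZ (f x * g y) z pku1 pku2) (proj_pkern x y z (ltW b10) (ltW b20) (fock_valP u)) -/a -/C1 -/C2.
ring.
Qed.

End ToeplitzProduct.

(** * Closed spans of Toeplitz operators *)

Section OperatorNorm.
Variables (R : realType) (V : lmodType R[i]) (N : V -> R).
Hypotheses (N_ge0 : forall x, 0 <= N x)
  (NZ : forall (a : R[i]) x, N (a *: x) = normc a * N x)
  (ND : forall x y, N (x + y) <= N x + N y).
Implicit Types (A B : V -> V) (S : set (V -> V)).
Local Notation bop := (bounded_operator N).
Local Notation opn := (opnorm N).

Lemma seminorm0 : N 0 = 0.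
Proof. by rewrite -(scale0r 0) NZ Normc.normc0 mul0r. Qed.

Lemma opnorm_le A (C : R) : 0 <= C -> (forall x, N (A x) <= C * N x) -> opn A <= C.
Proof.
move=> C0 AC; apply: ge_sup.
  by exists (N (A 0)); exists 0 => //=; rewrite seminorm0.
move=> _ [x /= x1 <-]; apply: le_trans (AC x) _.
by rewrite -[leRHS]mulr1 ler_wpM2l.
Qed.

Lemma opnorm_has_sup A : bop A -> has_sup [set N (A x) | x in [set x | N x <= 1]].
Proof.
move=> [_ [M MP]]; split.
  by exists (N (A 0)); exists 0 => //=; rewrite seminorm0.
exists `|M| => _ [x /= x1 <-]; apply: le_trans (MP x) _.
rewrite -[leRHS]mulr1; apply: le_trans (ler_wpM2l (normr_ge0 M) x1).
by rewrite ler_wpM2r// ler_norm.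
Qed.

Lemma opnorm_ge0 A : bop A -> 0 <= opn A.
Proof.
move=> bA; apply: le_trans (N_ge0 (A 0)) _.
apply: ub_le_sup; first by case: (opnorm_has_sup bA).
by exists 0 => //=; rewrite seminorm0.
Qed.

Lemma opnorm_bound A x : bop A -> N (A x) <= opn A * N x.
Proof.
move=> bA; have [lA [M MP]] := bA.
(* A vector with N x = 0 cannot be normalized; any bound M already forces N (A x) <= 0. *)
have [x0|x0] := eqVneq (N x) 0; first by have := MP x; rewrite x0 !mulr0.
have xp : 0 < N x by rewrite lt_def x0 N_ge0.
have AZ (a : R[i]) y : A (a *: y) = a *: A y.
  have A0 : A 0 = 0.
    have := lA 1 0 0; rewrite scaler0 addr0 scale1r => /eqP.
    by rewrite -subr_eq subrr eq_sym => /eqP.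
  by rewrite -[a *: y]addr0 lA A0 addr0.
rewrite -ler_pdivrMr// mulrC.
have -> : (N x)^-1 * N (A x) = N (A ((N x)^-1%:C *: x)).
  by rewrite AZ NZ normc_real ger0_norm// invr_ge0.
apply: ub_le_sup; first by case: (opnorm_has_sup bA).
by exists ((N x)^-1%:C *: x) => //=; rewrite NZ normc_real ger0_norm ?invr_ge0// mulVf.
Qed.

Lemma fct_linE (a : R[i]) A B x : (a *: A + B) x = a *: A x + B x. Proof. by []. Qed.

Lemma linear_subE A x y : linear A -> A (x - y) = A x - A y.
Proof. by move=> lA; rewrite addrC -scaleN1r lA scaleN1r addrC. Qed.

Lemma bounded_lin (a : R[i]) A B : bop A -> bop B -> bop (a *: A + B).
Proof.
move=> bA bB; have [lA _] := bA; have [lB _] := bB; split.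
  move=> c x y; rewrite !fct_linE lA lB.
  by rewrite !scalerDr !scalerA [a * c]mulrC addrACA.
exists (normc a * opn A + opn B) => x.
rewrite fct_linE.
apply: le_trans (ND _ _) _; rewrite NZ mulrDl -mulrA.
by rewrite lerD ?ler_wpM2l ?normc_ge0 ?opnorm_bound.
Qed.

Lemma bounded_comp A B : bop A -> bop B -> bop (A \o B).
Proof.
move=> bA bB; have [lA _] := bA; have [lB _] := bB; split.
  by move=> c x y /=; rewrite lB lA.
exists (opn A * opn B) => x /=; apply: le_trans (opnorm_bound _ bA) _.
by rewrite -mulrA ler_wpM2l ?opnorm_ge0// opnorm_bound.
Qed.

Lemma boundedB A B : bop A -> bop B -> bop (A - B).
Proof. by move=> bA bB; rewrite addrC -scaleN1r; exact: bounded_lin. Qed.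

Lemma opnorm_lin_le (a : R[i]) A B : bop A -> bop B ->
  opn (a *: A + B) <= normc a * opn A + opn B.
Proof.
move=> bA bB; apply: opnorm_le.
  by rewrite addr_ge0 ?mulr_ge0 ?normc_ge0 ?opnorm_ge0.
move=> x; rewrite fct_linE.
apply: le_trans (ND _ _) _; rewrite NZ mulrDl -mulrA.
by rewrite lerD ?ler_wpM2l ?normc_ge0 ?opnorm_bound.
Qed.

Lemma opnormD_le A B : bop A -> bop B -> opn (A + B) <= opn A + opn B.
Proof.
by move=> bA bB; have := opnorm_lin_le 1 bA bB; rewrite scale1r Normc.normc1 mul1r.
Qed.

Lemma opnorm_comp_le A B : bop A -> bop B -> opn (A \o B) <= opn A * opn B.
Proof.
move=> bA bB; apply: opnorm_le; first by rewrite mulr_ge0 ?opnorm_ge0.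
move=> x /=; apply: le_trans (opnorm_bound _ bA) _.
by rewrite -mulrA ler_wpM2l ?opnorm_ge0// opnorm_bound.
Qed.

Lemma subset_norm_closure S : S `<=` bop -> S `<=` norm_closure opn bop S.
Proof.
move=> Sb A SA; split; first exact: Sb.
move=> e e0; exists A => //; rewrite subrr.
apply: le_lt_trans e0; apply: opnorm_le => // x.
by rewrite [X in N X]/(0 : V) seminorm0 mul0r.
Qed.

Lemma norm_closure_subspace S : S `<=` bop -> subspace S ->
  subspace (norm_closure opn bop S).
Proof.
move=> Sb [S0 Slin]; split; first exact: subset_norm_closure.
move=> a A B [bA AP] [bB BP]; split; first exact: bounded_lin.
move=> e e0.
have k0 : 0 < 2 * (normc a + 1) by rewrite mulr_gt0// ltr_wpDl// normc_ge0.
have e1 : 0 < e / (2 * (normc a + 1)) by rewrite divr_gt0.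
have e2 : 0 < e / 2 by rewrite divr_gt0.
have [A' SA' A'e] := AP _ e1; have [B' SB' B'e] := BP _ e2.
exists (a *: A' + B'); first exact: Slin.
have -> : a *: A + B - (a *: A' + B') = a *: (A - A') + (B - B').
  by rewrite scalerBr opprD addrACA.
have bA' := Sb _ SA'; have bB' := Sb _ SB'.
apply: le_lt_trans (opnorm_lin_le a (boundedB bA bA') (boundedB bB bB')) _.
rewrite [ltRHS]splitr ler_ltD//.
apply: le_trans (ler_wpM2l (normc_ge0 a) (ltW A'e)) _.
rewrite mulrA ler_pdivrMr// mulrC.
have := normc_ge0 a; have := e0; move: (normc a) => x ? ?; nra.
Qed.

Lemma norm_closure_closed S : S `<=` bop ->
  norm_closed opn bop (norm_closure opn bop S).
Proof.
move=> Sb A [bA AP]; split => // e e0.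
have e2 : 0 < e / 2 by rewrite divr_gt0.
have [B [bB BP] ABe] := AP _ e2; have [C SC BCe] := BP _ e2.
exists C => //; have -> : A - C = (A - B) + (B - C) by rewrite addrA subrK.
have bC := Sb _ SC.
apply: le_lt_trans (opnormD_le (boundedB bA bB) (boundedB bB bC)) _.
by rewrite [ltRHS]splitr ltrD.
Qed.

(** AB - A'B' = (A - A') B + A' (B - B'). The tolerance for B' involves the norm of A', so A' is
    chosen first. *)
Lemma norm_closure_comp S1 S2 S3 : S1 `<=` bop -> S2 `<=` bop -> S3 `<=` bop ->
  (forall A B, S1 A -> S2 B -> norm_closure opn bop S3 (A \o B)) ->
  forall A B, norm_closure opn bop S1 A -> norm_closure opn bop S2 B ->
  norm_closure opn bop S3 (A \o B).
Proof.
move=> S1b S2b S3b H A B [bA AP] [bB BP]; apply: norm_closure_closed => //.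
split; first exact: bounded_comp.
move=> e e0; have nB := opnorm_ge0 bB.
pose d := e / (2 * (opn B + 1)).
have d0 : 0 < d by rewrite divr_gt0// mulr_gt0// ltr_wpDl.
have [A' SA' A'e] := AP _ d0; have bA' := S1b _ SA'; have nA' := opnorm_ge0 bA'.
pose d' := e / (2 * (opn A' + 1)).
have d'0 : 0 < d' by rewrite divr_gt0// mulr_gt0// ltr_wpDl.
have [B' SB' B'e] := BP _ d'0; have bB' := S2b _ SB'.
exists (A' \o B'); first exact: H.
have -> : (A \o B) - (A' \o B') = ((A - A') \o B) + (A' \o (B - B')).
  apply/funext => x; have [lA' _] := bA'.
  suff : A (B x) - A' (B' x) = A (B x) - A' (B x) + A' (B x - B' x) by [].
  by rewrite (linear_subE _ _ lA') addrA subrK.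
apply: le_lt_trans (opnormD_le (bounded_comp (boundedB bA bA') bB) (bounded_comp bA' (boundedB bB bB'))) _.
have h1 := opnorm_comp_le (boundedB bA bA') bB.
have h2 := opnorm_comp_le bA' (boundedB bB bB').
have g1 : opn (A - A') * opn B <= d * opn B by rewrite ler_wpM2r// ltW.
have g2 : opn A' * opn (B - B') <= opn A' * d' by rewrite ler_wpM2l// ltW.
have i1 : d * opn B < e / 2.
  rewrite /d mulrAC ltr_pdivrMr ?mulr_gt0// ?ltr_wpDl//.
  by move: (opn B) nB => x x0; nra.
have i2 : opn A' * d' < e / 2.
  rewrite /d' mulrA ltr_pdivrMr ?mulr_gt0// ?ltr_wpDl//.
  by move: (opn A') nA' => x x0; nra.
rewrite [ltRHS]splitr; apply: ltrD.
  exact: le_lt_trans h1 (le_lt_trans g1 i1).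
exact: le_lt_trans h2 (le_lt_trans g2 i2).
Qed.

End OperatorNorm.

(** * Toeplitz operators with symbols in a closed space *)

Section ToeplitzAlgebra.
Variables (R : realType) (n : nat) (p t : {posnum R}).
Local Notation Cn := ('rV[R[i]]_n).
Local Notation leb := (lebesgue_Cn R n).
Local Notation P := (p%:num).
Local Notation T := (t%:num).
Local Notation N := (@fock_norm R n p t).
Local Notation bop := (bounded_operator N).
Local Notation opn := (opnorm N).
Local Notation toep := (@toeplitz R n p t).
Implicit Types (f g h : Cn -> R[i]) (z w v x y : Cn) (D : set (Cn -> R[i])).
Hypothesis p1 : 1 < P.

Let N_ge0 := @fock_norm_ge0 R n p t.
Let NZ := @fock_normZ R n p t.
Let ND (u v : fock n p t) : N (u + v) <= N u + N v. Proof. by apply: fock_normD; exact: ltW. Qed.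

Lemma cbounded_lin (a : R[i]) f g (M1 M2 : R) : cbounded f M1 -> cbounded g M2 ->
  cbounded (a *: f + g) (normc a * M1 + M2).
Proof.
move=> [mf fM] [mg gM]; split; first by apply: cmeasD => //; exact: cmeasZ.
move=> z; rewrite [X in normc X](_ : _ = a * f z + g z)//.
apply: le_trans (le_normcD _ _) _; rewrite Normc.normcM.
by rewrite lerD// ler_wpM2l ?normc_ge0.
Qed.

Lemma proj_lin (a : R[i]) f g z : cmeas f -> (wint p t f < +oo)%E ->
  cmeas g -> (wint p t g < +oo)%E ->
  proj t (fun v => a * f v + g v) z = a * proj t f z + proj t g z.
Proof.
move=> mf ff mg gf; rewrite !projE//; last by apply: cmeasD => //; exact: cmeasZ.
have fi := cintble_kern p1 z mf ff; have gi := cintble_kern p1 z mg gf.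
rewrite -cintZ// -cintD//; last exact: cintbleZ.
by apply: eq_cint => v; ring.
Qed.

Lemma fock_linE (a : R[i]) (u v : fock n p t) z : (a *: u + v) z = a * u z + v z.
Proof. by []. Qed.

Lemma fock_ext (u v : fock n p t) : (forall z, u z = v z) -> u = v.
Proof. by move=> uv; apply: val_inj; apply/funext. Qed.

Lemma toeplitz_apply f (M : R) (u : fock n p t) z : cbounded f M ->
  toep f u z = proj t (fun v => f v * u v) z.
Proof. by move=> fM; rewrite (toeplitz_val p1 u fM). Qed.

Lemma toeplitz_linear f (M : R) : cbounded f M -> linear (toep f).
Proof.
move=> fM a u v; apply: fock_ext => z.
have [mu uf _] := fock_valP u; have [mv vf _] := fock_valP v; have [mf _] := fM.
apply: (etrans (toeplitz_apply _ _ fM)).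
have eu := toeplitz_apply u z fM; have ev := toeplitz_apply v z fM.
rewrite [RHS]fock_linE eu ev -proj_lin.
- by congr (proj t _ z); apply/funext => w; rewrite fock_linE; ring.
- exact: cmeasM mf mu.
- exact: wint_mul_lty fM mu uf.
- exact: cmeasM mf mv.
- exact: wint_mul_lty fM mv vf.
Qed.

Lemma toeplitz_symbol_lin (a : R[i]) f g (M1 M2 : R) : cbounded f M1 -> cbounded g M2 ->
  toep (a *: f + g) = a *: toep f + toep g.
Proof.
move=> fM gM; apply/funext => u; apply: fock_ext => z.
apply: (etrans (toeplitz_apply _ _ (cbounded_lin a fM gM))).
have [mu uf _] := fock_valP u; have [mf _] := fM; have [mg _] := gM.
have eu := toeplitz_apply u z fM; have ev := toeplitz_apply u z gM.
rewrite [RHS]fock_linE eu ev -proj_lin.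
- by congr (proj t _ z); apply/funext => w; rewrite [X in X * _](_ : _ = a * f w + g w)//; ring.
- exact: cmeasM mf mu.
- exact: wint_mul_lty fM mu uf.
- exact: cmeasM mg mu.
- exact: wint_mul_lty gM mu uf.
Qed.

Lemma toeplitz0 : toep 0 = 0.
Proof.
have c0 : cbounded (0 : Cn -> R[i]) 0.
  by split => [|z]; [exact: cmeas_cst|rewrite [X in normc X](_ : _ = 0)// Normc.normc0].
have := toeplitz_symbol_lin (-1) c0 c0.
by rewrite !scaleN1r oppr0 addr0 addNr.
Qed.

Lemma toeplitz_bounded f (M : R) : cbounded f M -> bop (toep f).
Proof.
move=> fM; split; first exact: toeplitz_linear fM.
by exists (2 ^+ n * M) => u; exact: toeplitz_norm.
Qed.

Lemma opnorm_toeplitz f (M : R) : cbounded f M -> opn (toep f) <= 2 ^+ n * M.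
Proof.
move=> fM; apply: opnorm_le => //; last by move=> u; exact: toeplitz_norm.
by case: fM => _ fM; rewrite mulr_ge0// ?exprn_ge0//; exact: le_trans (normc_ge0 (f 0)) (fM 0).
Qed.

Lemma toeplitz_ops_bounded D : D `<=` (@BUC R n) -> toeplitz_ops p t D `<=` bop.
Proof. by move=> DB _ [f Df <-]; have [M _ fM] := BUC_bounded (DB _ Df); exact: toeplitz_bounded fM. Qed.

Lemma toeplitz_ops_subspace D : D `<=` (@BUC R n) -> subspace D ->
  subspace (toeplitz_ops p t D).
Proof.
move=> DB [D0 Dlin]; split; first by exists 0 => //; exact: toeplitz0.
move=> a _ _ [f Df <-] [g Dg <-].
have [M1 _ fM] := BUC_bounded (DB _ Df); have [M2 _ gM] := BUC_bounded (DB _ Dg).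
by exists (a *: f + g); [exact: Dlin|exact: toeplitz_symbol_lin fM gM].
Qed.

(** The operator depends linearly on its symbol, so symbols from a subspace already give a subspace
    of operators and [span] adds nothing. *)
Lemma toeplitz_linE D : D `<=` (@BUC R n) -> subspace D ->
  toeplitz_lin p t D = norm_closure opn bop (toeplitz_ops p t D).
Proof.
move=> DB Dsub; rewrite /toeplitz_lin; congr norm_closure.
apply/seteqP; split; last exact: sub_gen_smallest.
by apply: smallest_sub => //; exact: toeplitz_ops_subspace.
Qed.

Section closed.
Variable J : set (Cn -> R[i]).
Hypotheses (JB : J `<=` (@BUC R n)) (Jsub : subspace J).
Local Notation L := (toeplitz_lin p t J).

Lemma toeplitz_lin_bounded : L `<=` bop. Proof. by move=> A []. Qed.

Lemma toeplitz_lin_subspace : subspace L.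
Proof.
rewrite (toeplitz_linE JB Jsub); apply: (norm_closure_subspace N_ge0 NZ ND).
  exact: toeplitz_ops_bounded JB.
exact: toeplitz_ops_subspace JB Jsub.
Qed.

Lemma toeplitz_lin_closed : norm_closed opn bop L.
Proof. by rewrite (toeplitz_linE JB Jsub); exact: (norm_closure_closed N_ge0 NZ ND (toeplitz_ops_bounded JB)). Qed.

Lemma toeplitz_ops_lin : toeplitz_ops p t J `<=` L.
Proof. by rewrite (toeplitz_linE JB Jsub); exact: (subset_norm_closure NZ (toeplitz_ops_bounded JB)). Qed.

(** Provides the set Q for [gconv_dense]: to prove that T_f B lies in L for all f in D, it suffices
    to treat Gaussian averages of f. *)
Lemma toeplitz_lin_left D B : closed_subspace_BUC D -> bop B ->
  subspace [set f | D f /\ L (toep f \o B)] /\ uniform_closed [set f | D f /\ L (toep f \o B)].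
Proof.
move=> Dcl bB; have [DB Dsub _] := Dcl; have [L0 Llin] := toeplitz_lin_subspace.
have [D0 Dlin] := Dsub; split.
  split; first by split; [exact: D0|rewrite toeplitz0; exact: L0].
  move=> a f g [Df Lf] [Dg Lg]; split; first exact: Dlin.
  have [M1 _ fM] := BUC_bounded (DB _ Df); have [M2 _ gM] := BUC_bounded (DB _ Dg).
  by rewrite (toeplitz_symbol_lin a fM gM); exact: (Llin a _ _ Lf Lg).
move=> h hP.
have Dh : D h.
  apply: (closed_subspace_uniform_closed Dcl) => e e0.
  by have [y [Dy _] hy] := hP e e0; exists y.
split; first exact: Dh.
have [M _ hM] := BUC_bounded (DB _ Dh); have bh := toeplitz_bounded hM.
apply: toeplitz_lin_closed; split; first exact: (bounded_comp N_ge0 NZ).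
move=> e e0; have nB := opnorm_ge0 N_ge0 NZ bB.
pose d := e / (2 ^+ n * (opn B + 1)).
have k0 : 0 < 2 ^+ n * (opn B + 1) by rewrite mulr_gt0 ?exprn_gt0// ltr_wpDl.
have d0 : 0 < d by rewrite divr_gt0.
have [y [Dy Ly] hy] := hP d d0; exists (toep y \o B); first exact: Ly.
have [M' _ yM] := BUC_bounded (DB _ Dy).
have hyd : cbounded (-1 *: y + h) d.
  split; first by case: (cbounded_lin (-1) yM hM).
  by move=> z; rewrite [X in normc X](_ : _ = -1 * y z + h z)// mulN1r addrC.
have -> : (toep h \o B) - (toep y \o B) = toep (-1 *: y + h) \o B.
  by rewrite (toeplitz_symbol_lin _ yM hM) scaleN1r addrC.
apply: le_lt_trans (opnorm_comp_le N_ge0 NZ (toeplitz_bounded hyd) bB) _.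
apply: le_lt_trans (ler_wpM2r nB (opnorm_toeplitz hyd)) _.
rewrite /d [2 ^+ n * _]mulrC -mulrA mulrAC ltr_pdivrMr// ltr_pM2l//.
by rewrite ltr_pM2l ?exprn_gt0// ltrDl.
Qed.

(** The counterpart for the right factor; here linearity of B makes the set a subspace. *)
Lemma toeplitz_lin_right D B : closed_subspace_BUC D -> bop B ->
  subspace [set f | D f /\ L (B \o toep f)] /\ uniform_closed [set f | D f /\ L (B \o toep f)].
Proof.
move=> Dcl bB; have [DB Dsub _] := Dcl; have [L0 Llin] := toeplitz_lin_subspace.
have [D0 Dlin] := Dsub; have [lB _] := bB.
have B0 : B 0 = 0 by have := linear_subE 0 0 lB; rewrite !subrr.
split.
  split.
    split; first exact: D0.
    have -> : B \o toep 0 = 0 by rewrite toeplitz0; apply/funext => u; exact: B0.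
    exact: L0.
  move=> a f g [Df Lf] [Dg Lg]; split; first exact: Dlin.
  have [M1 _ fM] := BUC_bounded (DB _ Df); have [M2 _ gM] := BUC_bounded (DB _ Dg).
  rewrite (toeplitz_symbol_lin a fM gM).
  have -> : B \o (a *: toep f + toep g) = a *: (B \o toep f) + (B \o toep g).
    by apply/funext => u; rewrite /= fct_linE lB.
  exact: (Llin a _ _ Lf Lg).
move=> h hP.
have Dh : D h.
  apply: (closed_subspace_uniform_closed Dcl) => e e0.
  by have [y [Dy _] hy] := hP e e0; exists y.
split; first exact: Dh.
have [M _ hM] := BUC_bounded (DB _ Dh); have bh := toeplitz_bounded hM.
apply: toeplitz_lin_closed; split; first exact: (bounded_comp N_ge0 NZ).
move=> e e0; have nB := opnorm_ge0 N_ge0 NZ bB.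
pose d := e / (2 ^+ n * (opn B + 1)).
have k0 : 0 < 2 ^+ n * (opn B + 1) by rewrite mulr_gt0 ?exprn_gt0// ltr_wpDl.
have d0 : 0 < d by rewrite divr_gt0.
have [y [Dy Ly] hy] := hP d d0; exists (B \o toep y); first exact: Ly.
have [M' _ yM] := BUC_bounded (DB _ Dy).
have hyd : cbounded (-1 *: y + h) d.
  split; first by case: (cbounded_lin (-1) yM hM).
  by move=> z; rewrite [X in normc X](_ : _ = -1 * y z + h z)// mulN1r addrC.
have -> : (B \o toep h) - (B \o toep y) = B \o toep (-1 *: y + h).
  rewrite (toeplitz_symbol_lin _ yM hM); apply/funext => u.
  by rewrite /= fct_linE lB scaleN1r addrC.
apply: le_lt_trans (opnorm_comp_le N_ge0 NZ bB (toeplitz_bounded hyd)) _.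
rewrite mulrC; apply: le_lt_trans (ler_wpM2r nB (opnorm_toeplitz hyd)) _.
rewrite /d [2 ^+ n * _]mulrC -mulrA mulrAC ltr_pdivrMr// ltr_pM2l//.
by rewrite ltr_pM2l ?exprn_gt0// ltrDl.
Qed.

End closed.

Lemma pconv_mem (D1 D2 J : set (Cn -> R[i])) f g (b1 b2 : R) : D1 `<=` (@BUC R n) -> D2 `<=` (@BUC R n) ->
  closed_subspace_BUC J -> translation_invariant D1 -> translation_invariant D2 ->
  (forall f g, D1 f -> D2 g -> J (f \* g)) -> 0 < b1 <= T^-1 -> 0 < b2 <= T^-1 ->
  D1 f -> D2 g -> J (pconv t b1 b2 f g).
Proof.
move=> D1B D2B Jcl tr1 tr2 H h1 h2 Df Dg; have [JB Jsub _] := Jcl.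
have [M1 M10 [mf fM]] := BUC_bounded (D1B _ Df); have [M2 M20 [mg gM]] := BUC_bounded (D2B _ Dg).
have := integral_mem (M := M1 * M2) Jsub (closed_subspace_uniform_closed Jcl) (@cintble_pkern R n t b1 b2 h1 h2)
  (F := fun (xy : Cn * Cn) z => f (z - xy.1) * g (z - xy.2)).
apply.
- by move=> xy; exact: (H _ _ (tr1 _ xy.1 Df) (tr2 _ xy.2 Dg)).
- by move=> xy z; rewrite Normc.normcM ler_pM ?normc_ge0.
- move=> z; have [mr _] := @reflect_mpreserving R n z.
  apply: cmeasM; [apply: (cmeas_comp mf)|apply: (cmeas_comp mg)]; apply: (measurableT_comp mr).
    exact: measurable_fst.
  exact: measurable_snd.
- by apply: finely_covered_shift2; [exact: D1B|exact: D2B].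
Qed.

(** After reduction to single Toeplitz operators the density argument runs twice: in f with g fixed,
    then in g with f already replaced by a Gaussian average. What remains are products of two
    averages, settled by [toeplitz_gconv_mul]. *)
Lemma toeplitz_comp_mem (D1 D2 J : set (Cn -> R[i])) : closed_subspace_BUC D1 ->
  closed_subspace_BUC D2 -> closed_subspace_BUC J ->
  translation_invariant D1 -> translation_invariant D2 ->
  (forall f g, D1 f -> D2 g -> J (f \* g)) ->
  forall A B, toeplitz_lin p t D1 A -> toeplitz_lin p t D2 B -> toeplitz_lin p t J (A \o B).
Proof.
move=> D1cl D2cl Jcl tr1 tr2 H.
have [D1B D1sub _] := D1cl; have [D2B D2sub _] := D2cl; have [JB Jsub _] := Jcl.
rewrite (toeplitz_linE D1B D1sub) (toeplitz_linE D2B D2sub).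
have JE := toeplitz_linE JB Jsub; rewrite JE.
apply: (norm_closure_comp N_ge0 NZ ND (toeplitz_ops_bounded D1B) (toeplitz_ops_bounded D2B) (toeplitz_ops_bounded JB)).
move=> _ _ [f Df <-] [g Dg <-]; rewrite -JE.
have Ti : 0 < T^-1 by rewrite invr_gt0.
have [M2 _ gM] := BUC_bounded (D2B _ Dg).
have [Q1 Q2] := toeplitz_lin_left JB Jsub D1cl (toeplitz_bounded gM).
suff /(_ f Df)[] : D1 `<=` [set f | D1 f /\ toeplitz_lin p t J (toep f \o toep g)] by [].
apply: (gconv_dense D1B Q1 Q2 Ti) => {Df Q1 Q2}f b1 Df h1.
have /andP[b10 _] := h1.
have Dfb := gconv_mem D1cl tr1 b10 Df; split => //.
have [M3 _ FM] := BUC_bounded (D1B _ Dfb).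
have [Q1 Q2] := toeplitz_lin_right JB Jsub D2cl (toeplitz_bounded FM).
suff /(_ g Dg)[] : D2 `<=` [set g | D2 g /\ toeplitz_lin p t J (toep (gconv f b1) \o toep g)] by [].
apply: (gconv_dense D2B Q1 Q2 Ti) => {Dg gM Q1 Q2}g b2 Dg h2.
have /andP[b20 _] := h2.
have Dgb := gconv_mem D2cl tr2 b20 Dg; split => //.
have [M4 _ GM] := BUC_bounded (D2B _ Dgb).
have [M1 _ fM] := BUC_bounded (D1B _ Df); have [M2' _ gM] := BUC_bounded (D2B _ Dg).
have Jh := pconv_mem D1B D2B Jcl tr1 tr2 H h1 h2 Df Dg.
have [M5 _ hM] := BUC_bounded (JB _ Jh).
apply: (toeplitz_ops_lin JB Jsub); exists (pconv t b1 b2 f g) => //.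
by apply/funext => u /=; rewrite (toeplitz_gconv_mul p1 u h1 h2 fM gM FM GM hM).
Qed.

Lemma toeplitz_lin_subalgebra J : closed_subspace_BUC J -> translation_invariant J ->
  (forall f g, J f -> J g -> J (f \* g)) ->
  closed_subalgebra N (toeplitz_lin p t J).
Proof.
move=> Jcl tr H; have [JB Jsub _] := Jcl; split.
- exact: toeplitz_lin_bounded.
- exact: toeplitz_lin_subspace.
- exact: toeplitz_comp_mem.
- exact: toeplitz_lin_closed.
Qed.

Lemma toeplitz_lin_sub_closed D (X : set (fock n p t -> fock n p t)) :
  closed_subalgebra N X -> toeplitz_ops p t D `<=` X -> toeplitz_lin p t D `<=` X.
Proof.
move=> [Xb Xsub _ Xcl] DX A [bA AP]; apply: Xcl; split => // e e0.
have [B sB Be] := AP e e0; exists B => //.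
exact: (sB X).
Qed.

Lemma toeplitz_lin_alg J : closed_subspace_BUC J -> translation_invariant J ->
  (forall f g, J f -> J g -> J (f \* g)) ->
  toeplitz_lin p t J = toeplitz_alg p t J.
Proof.
move=> Jcl tr H; have [JB Jsub _] := Jcl; apply/seteqP; split.
  by move=> A LA X [Xalg XD]; exact: (toeplitz_lin_sub_closed Xalg XD).
apply: smallest_sub; first exact: toeplitz_lin_subalgebra.
exact: toeplitz_ops_lin.
Qed.

(** Pointwise multiplication commutes, so products in either order stay in I and [toeplitz_comp_mem]
    applies on both sides. *)
Lemma toeplitz_lin_ideal I D : closed_subspace_BUC I -> closed_subspace_BUC D ->
  translation_invariant I -> translation_invariant D -> ideal_fun I D ->
  two_sided_ideal (toeplitz_lin p t I) (toeplitz_lin p t D).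
Proof.
move=> Icl Dcl trI trD [ID Isub Iid]; have [IB _ _] := Icl; have [DB Dsub _] := Dcl.
have sub : toeplitz_lin p t I `<=` toeplitz_lin p t D.
  rewrite !toeplitz_linE// => A [bA AP]; split => // e e0.
  have [_ [f If <-] fe] := AP e e0; exists (toep f) => //.
  by exists f => //; exact: ID.
have Lsub := toeplitz_lin_subspace IB Isub.
have Iid' f g : I f -> D g -> I (f \* g).
  move=> If Dg; have := Iid _ _ Dg If; congr I; apply/funext => z /=; exact: mulrC.
split; split; [exact: sub|exact: Lsub| |exact: sub|exact: Lsub|].
  exact: (toeplitz_comp_mem Dcl Icl Icl trD trI Iid).
move=> S U DS IU; exact: (toeplitz_comp_mem Icl Dcl Icl trI trD Iid' IU DS).
Qed.

End ToeplitzAlgebra.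

(** * Adjoints *)

Section Adjoint.
Variables (R : realType) (n : nat) (t : {posnum R}).
Local Notation Cn := ('rV[R[i]]_n).
Local Notation leb := (lebesgue_Cn R n).
Local Notation T := (t%:num).
Local Notation N := (@fock_norm R n pos2 t).
Local Notation bop := (bounded_operator N).
Local Notation opn := (opnorm N).
Local Notation toep := (@toeplitz R n pos2 t).
Local Notation dot := (@fock_dot R n t).
Implicit Types (f g h : Cn -> R[i]) (z w : Cn) (u v : fock n pos2 t).

Lemma pos2_gt1 : 1 < (@pos2 R)%:num. Proof. by rewrite /= ltr1n. Qed.

Let p1 := pos2_gt1.

Let N_ge0 := @fock_norm_ge0 R n pos2 t.
Let NZ := @fock_normZ R n pos2 t.
Let ND u v : N (u + v) <= N u + N v. Proof. by apply: fock_normD; exact: ltW. Qed.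

Definition wabs f z : R := normc (f z) * wt t z.

Lemma wabs_ge0 f z : 0 <= wabs f z.
Proof. by rewrite mulr_ge0 ?normc_ge0 ?wt_ge0. Qed.

Lemma measurable_wabs f : cmeas f -> measurable_fun setT (wabs f).
Proof.
by move=> mf; apply: measurable_funM; [exact: measurable_normc|exact: measurable_gaussian].
Qed.

Lemma wint2E f : (wint pos2 t f = \int[leb]_z (wabs f z ^+ 2)%:E)%E.
Proof. by apply: eq_integral => z _; rewrite -powR_mulrn ?wabs_ge0. Qed.

Lemma fock_norm_sqr u : ((kcst n t)%:E * \int[leb]_z (wabs u z ^+ 2)%:E = (N u ^+ 2)%:E)%E.
Proof.
rewrite -wint2E wint_norm -EFinM; congr EFin.
rewrite -powR_mulrn ?fock_norm_ge0//.
have -> : fock_cst n pos2 t = kcst n t.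
  rewrite /fock_cst /kcst; congr (_ ^- _); congr (_ * _).
  by rewrite /= mulrC mulKf.
by rewrite mulrC mulfVK// gt_eqF// kcst_gt0.
Qed.

Lemma gauss_density_wt z : gauss_density t z = kcst n t * (wt t z * wt t z).
Proof.
rewrite gauss_densityE /wt /gaussian -expRD; congr (_ * expR _).
have T0 : T != 0 by rewrite gt_eqF.
by move: (sqnorm z) (T : R) T0 => s r r0; field.
Qed.

(** The form [fock_dot] on arbitrary functions: a product f u need not be holomorphic and leaves the
    Fock space. *)
Definition sesq h f : R[i] :=
  cint leb (fun z => (gauss_density t z)%:C * (h z * (f z)^*%R)).

Lemma fock_dotE u v : dot u v = sesq u v.
Proof.
have [mu _ _] := fock_valP u; have [mv _ _] := fock_valP v.
rewrite /fock_dot cintegral_gauss; last first.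
  by apply: cmeasM => //; exact: cmeas_conj.
by [].
Qed.

Lemma cmeas_dens : cmeas (fun z => (@gauss_density R n t z)%:C).
Proof. by apply: cmeas_real; exact: measurable_gauss_density. Qed.

Lemma normc_dens h f z :
  normc ((gauss_density t z)%:C * (h z * (f z)^*%R)) = kcst n t * (wabs h z * wabs f z).
Proof.
rewrite !Normc.normcM normc_conj normc_real ger0_norm ?gauss_density_ge0// gauss_density_wt /wabs.
ring.
Qed.

(** Young's inequality with a free weight l; integrated, it serves as Cauchy-Schwarz once l is
    adapted to the situation. *)
Lemma mul_le_sqr (a b l : R) : 0 < l -> a * b <= (l * a ^+ 2 + l^-1 * b ^+ 2) / 2.
Proof.
move=> l0; have h := sqr_ge0 (l * a - b).
have li : 0 < l^-1 by rewrite invr_gt0.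
have := mulr_ge0 (ltW li) h.
have -> : l^-1 * (l * a - b) ^+ 2 = l * a ^+ 2 + l^-1 * b ^+ 2 - 2 * (a * b).
  by field; rewrite gt_eqF.
by move=> ?; lra.
Qed.

Lemma integral_young h f (l : R) : 0 < l -> cmeas h -> cmeas f ->
  (\int[leb]_z (normc ((gauss_density t z)%:C * (h z * (f z)^*%R)))%:E <=
   (l / 2)%:E * ((kcst n t)%:E * \int[leb]_z (wabs h z ^+ 2)%:E) +
   (l^-1 / 2)%:E * ((kcst n t)%:E * \int[leb]_z (wabs f z ^+ 2)%:E))%E.
Proof.
move=> l0 mh mf.
have mh2 : measurable_fun setT (fun z => wabs h z ^+ 2).
  by apply: measurable_funX; exact: measurable_wabs.
have mf2 : measurable_fun setT (fun z => wabs f z ^+ 2).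
  by apply: measurable_funX; exact: measurable_wabs.
have k0 := ltW (kcst_gt0 n t).
have l2 : 0 <= l / 2 by rewrite divr_ge0// ltW.
have li2 : 0 <= l^-1 / 2 by rewrite divr_ge0// invr_ge0 ltW.
have E (c : R) (q : Cn -> R) : 0 <= c -> measurable_fun setT q -> (forall z, 0 <= q z) ->
    (c%:E * ((kcst n t)%:E * \int[leb]_z (q z)%:E) = \int[leb]_z (c * (kcst n t * q z))%:E)%E.
  move=> c0 mq q0; rewrite -ge0_integral_scale// -ge0_integral_scale//.
    exact: measurable_funM.
  by move=> z; rewrite mulr_ge0.
rewrite !E//; try by move=> z; rewrite sqr_ge0.
rewrite -ge0_integralD//; last 4 first.
- by move=> z _; rewrite lee_fin; apply: mulr_ge0 => //; apply: mulr_ge0 => //; exact: sqr_ge0.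
- by apply/measurable_EFinP; apply: measurable_funM => //; exact: measurable_funM.
- by move=> z _; rewrite lee_fin; apply: mulr_ge0 => //; apply: mulr_ge0 => //; exact: sqr_ge0.
- by apply/measurable_EFinP; apply: measurable_funM => //; exact: measurable_funM.
apply: ge0_le_integral => //.
- by move=> z _; rewrite lee_fin normc_ge0.
- by apply: measurable_enormc; apply: cmeasM; [exact: cmeas_dens|apply: cmeasM => //; exact: cmeas_conj].
- apply: emeasurable_funD; apply/measurable_EFinP; apply: measurable_funM => //; exact: measurable_funM.
move=> z _; rewrite normc_dens -EFinD lee_fin.
have := ler_wpM2l k0 (mul_le_sqr (wabs h z) (wabs f z) l0).
move: (kcst n t) (wabs h z) (wabs f z) (l^-1) => k a b li; nra.
Qed.

Lemma cintble_sesq h f : cmeas h -> (wint pos2 t h < +oo)%E -> cmeas f ->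
  (wint pos2 t f < +oo)%E ->
  cintble leb (fun z => (gauss_density t z)%:C * (h z * (f z)^*%R)).
Proof.
move=> mh hf mf ff; split.
  by apply: cmeasM; [exact: cmeas_dens|apply: cmeasM => //; exact: cmeas_conj].
have l1 : 0 < 1 :> R by [].
apply: le_lt_trans (integral_young l1 mh mf) _; rewrite -!wint2E.
have k0 := ltW (kcst_gt0 n t).
have lty (c : R) (x : \bar R) : 0 <= c -> (x < +oo)%E -> (c%:E * x < +oo)%E.
  by move=> c0 xoo; rewrite lte_mul_pinfty// lee_fin.
have h1 : 0 <= 1 / 2 :> R by rewrite divr_ge0.
have h2 : 0 <= 1^-1 / 2 :> R by rewrite invr1.
exact: lte_add_pinfty (lty _ _ h1 (lty _ _ k0 hf)) (lty _ _ h2 (lty _ _ k0 ff)).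
Qed.

Lemma normc_dot_le u v (l : R) : 0 < l ->
  normc (dot u v) <= (l * N u ^+ 2 + l^-1 * N v ^+ 2) / 2.
Proof.
move=> l0; have [mu uf _] := fock_valP u; have [mv vf _] := fock_valP v.
rewrite fock_dotE; apply: cint_norm_le_fin; first exact: cintble_sesq.
apply: le_trans (integral_young l0 mu mv) _.
rewrite !fock_norm_sqr -!EFinM -EFinD lee_fin.
by move: (N u ^+ 2) (N v ^+ 2) (l^-1) => a b c; lra.
Qed.

Lemma fock_norm_dot u : N u ^+ 2 <= normc (dot u u).
Proof.
have [mu uf _] := fock_valP u.
apply: le_trans (le_trans (ler_norm _) (Re_le_normc _)).
rewrite fock_dotE Re_cint /Rintegral.
have -> : (\int[leb]_z ((Re \o (fun z0 => (gauss_density t z0)%:C * (u z0 * (u z0)^*%R))) z)%:E =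
           \int[leb]_z (kcst n t * wabs u z ^+ 2)%:E)%E.
  apply: eq_integral => z _; congr EFin => /=.
  rewrite Re_mulr ReM Re_conj Im_conj mulrN opprK -!expr2 -normc_sqr gauss_density_wt /wabs; ring.
rewrite ge0_integral_scale//; last 3 first.
- by apply: measurable_funX; exact: measurable_wabs.
- by move=> z; exact: sqr_ge0.
- exact: ltW (kcst_gt0 n t).
by rewrite fock_norm_sqr.
Qed.

(** N(By)^2 is at most |<ABy, y>|. With the weight l = C^-2, Young bounds this by (N(By)^2 + C^2
    N(y)^2)/2, and the first term is absorbed on the left. *)
Lemma adjoint_bound A B (C : R) : 0 < C -> (forall x, N (A x) <= C * N x) -> adjoint dot A B ->
  forall y, N (B y) <= C * N y.
Proof.
move=> C0 AC AB y.
have l0 : 0 < C ^- 2 by rewrite invr_gt0 exprn_gt0.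
have H1 := normc_dot_le (A (B y)) y l0.
have H2 := fock_norm_dot (B y); rewrite -AB in H2.
have H3 : N (A (B y)) ^+ 2 <= C ^+ 2 * N (B y) ^+ 2.
  by rewrite -exprMn lerXn2r ?nnegrE ?N_ge0 ?mulr_ge0 ?N_ge0 ?(ltW C0).
have H4 := ler_wpM2l (ltW l0) H3.
rewrite mulKf ?gt_eqF ?exprn_gt0// in H4.
rewrite invrK in H1.
have H5 : N (B y) ^+ 2 <= (C * N y) ^+ 2.
  by rewrite exprMn; move: H1 H2 H4; move: (normc _) (N (B y) ^+ 2) (N y ^+ 2) (C ^- 2 * _) => *; lra.
by rewrite -ler_sqr ?nnegrE ?N_ge0// mulr_ge0 ?N_ge0// ltW.
Qed.

End Adjoint.

(** * P_t as an orthogonal projection *)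

Section ToeplitzAdjoint.
Variables (R : realType) (n : nat) (t : {posnum R}).
Local Notation Cn := ('rV[R[i]]_n).
Local Notation leb := (lebesgue_Cn R n).
Local Notation T := (t%:num).
Local Notation N := (@fock_norm R n pos2 t).
Local Notation bop := (bounded_operator N).
Local Notation opn := (opnorm N).
Local Notation toep := (@toeplitz R n pos2 t).
Local Notation dot := (@fock_dot R n t).
Implicit Types (f g h : Cn -> R[i]) (z w : Cn) (u v : fock n pos2 t).

Let p1 := @pos2_gt1 R.

Let N_ge0 := @fock_norm_ge0 R n pos2 t.
Let NZ := @fock_normZ R n pos2 t.
Let ND u v : N (u + v) <= N u + N v. Proof. by apply: fock_normD; exact: ltW. Qed.

Lemma kern_conj z w : (gauss_density t z)%:C * kern t z w = (gauss_density t w)%:C * (kern t w z)^*%R.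
Proof.
have rc (a : R) : (a%:C)^*%R = a%:C by rewrite conjcE /= oppr0.
have E : (cdot w z / T%:C)^*%R = cdot z w / T%:C.
  by rewrite rmorphM /= cdot_conj fmorphV /= rc.
rewrite /kern; move: (rc (gauss_density t z)); move: ((gauss_density t z)%:C) ((gauss_density t w)%:C) => a b ra.
have -> : (a * cexp (cdot w z / T%:C))^*%R = a^*%R * cexp (cdot z w / T%:C).
  by rewrite rmorphM /= cexp_conj E.
rewrite ra; ring.
Qed.

(** P_t is symmetric and fixes u: Fubini exchanges the integrals, Hermitian symmetry of the kernel
    reverses its arguments, and [proj_id] recovers u. *)
Lemma sesq_proj h u : cmeas h -> (wint pos2 t h < +oo)%E ->
  sesq t (proj t h) u = sesq t h u.
Proof.
move=> mh hf; have [mu uf hu] := fock_valP u.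
pose Phi (zw : Cn * Cn) := (gauss_density t zw.1)%:C * kern t zw.1 zw.2 * (h zw.2 * (u zw.1)^*%R).
have mfst : measurable_fun setT (@fst Cn Cn) by exact: measurable_fst.
have msnd : measurable_fun setT (@snd Cn Cn) by exact: measurable_snd.
have mPhi : cmeas Phi.
  apply: cmeasM; first apply: cmeasM.
  - exact: (cmeas_comp (@cmeas_dens R n t) mfst).
  - exact: cmeas_kern.
  apply: cmeasM; first exact: (cmeas_comp mh msnd).
  exact: (cmeas_comp (cmeas_conj mu) mfst).
(* Majorants for Fubini: ab <= a^2 + b^2 separates h(w) from u(z), and each term is integrable
   because [ukern (z - w)] has mass 1 in either variable. *)
pose F1 (zw : Cn * Cn) : R[i] := (ukern t (zw.1 - zw.2) * wabs t h zw.2 ^+ 2)%:C.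
pose F2 (zw : Cn * Cn) : R[i] := (ukern t (zw.1 - zw.2) * wabs t u zw.1 ^+ 2)%:C.
have muk : measurable_fun setT (fun zw : Cn * Cn => ukern t (zw.1 - zw.2)).
  by apply: (measurableT_comp (@measurable_ukern R n t)); exact: measurable_CnB.
have mwh : measurable_fun setT (fun z => wabs t h z ^+ 2) by apply: measurable_funX; exact: measurable_wabs.
have mwu : measurable_fun setT (fun z => wabs t u z ^+ 2) by apply: measurable_funX; exact: measurable_wabs.
have F1i : cintble (leb \x leb)%E F1.
  apply: cintble_prod2.
    by apply: cmeas_real; apply: measurable_funM => //; exact: (measurableT_comp mwh msnd).
  rewrite (_ : (\int[leb]_w _)%E = wint pos2 t h)//.
  rewrite wint2E; apply: eq_integral => w _.
  under eq_integral => z _.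
    rewrite normc_real ger0_norm/=; last by rewrite mulr_ge0 ?sqr_ge0 ?ukern_ge0.
    rewrite mulrC; over.
  rewrite (@ge0_integral_scale _ _ _ leb (wabs t h w ^+ 2) (fun z => ukern t (z - w))); last 3 first.
  - by apply: (measurableT_comp (@measurable_ukern R n t)); exact: measurable_shift.
  - by move=> z; exact: ukern_ge0.
  - exact: sqr_ge0.
  by rewrite integral_ukern_shift2 mule1.
have F2i : cintble (leb \x leb)%E F2.
  apply: cintble_prod.
    by apply: cmeas_real; apply: measurable_funM => //; exact: (measurableT_comp mwu mfst).
  rewrite (_ : (\int[leb]_w _)%E = wint pos2 t u)//.
  rewrite wint2E; apply: eq_integral => z _.
  under eq_integral => w _.
    rewrite normc_real ger0_norm/=; last by rewrite mulr_ge0 ?sqr_ge0 ?ukern_ge0.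
    rewrite mulrC; over.
  rewrite (@ge0_integral_scale _ _ _ leb (wabs t u z ^+ 2) (fun w => ukern t (z - w))); last 3 first.
  - exact: measurable_ukern_shift.
  - by move=> w; exact: ukern_ge0.
  - exact: sqr_ge0.
  by rewrite integral_ukern_shift mule1.
have k0 := kcst_gt0 n t.
have nE (a : R) (k b c : R[i]) : 0 <= a ->
    normc (a%:C * k * (b * c^*%R)) = a * normc k * (normc b * normc c).
  by move=> a0; rewrite !Normc.normcM normc_conj normc_real ger0_norm.
have Phii : cintble (leb \x leb)%E Phi.
  apply: (le_cintble mPhi (cintbleZ (kcst n t * 2 ^+ n)%:C (cintbleD F1i F2i))) => -[z w].
  have -> : (kcst n t * 2 ^+ n)%:C * (F1 (z, w) + F2 (z, w)) =
    (kcst n t * 2 ^+ n * (ukern t (z - w) * wabs t h w ^+ 2 + ukern t (z - w) * wabs t u z ^+ 2))%:C.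
    by rewrite [RHS]rmorphM rmorphD.
  have -> : Phi (z, w) = (gauss_density t z)%:C * kern t z w * (h w * (u z)^*%R) by [].
  rewrite normc_real.
  have uk0 := ukern_ge0 t (z - w).
  have e0 : 0 <= kcst n t * 2 ^+ n * (ukern t (z - w) * wabs t h w ^+ 2 + ukern t (z - w) * wabs t u z ^+ 2).
    by rewrite mulr_ge0 ?mulr_ge0 ?(ltW k0) ?exprn_ge0// addr_ge0// mulr_ge0// sqr_ge0.
  rewrite (ger0_norm e0) nE ?gauss_density_ge0//.
  rewrite gauss_density_wt.
  have -> : kcst n t * (wt t z * wt t z) * normc (kern t z w) * (normc (h w) * normc (u z)) =
     kcst n t * (normc (kern t z w) * wt t z) * (wt t z * (normc (h w) * normc (u z))) by ring.
  rewrite normc_kern_wt.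
  have -> : kcst n t * (kcst n t * gaussian (2 * T)^-1 (z - w) * wt t w) * (wt t z * (normc (h w) * normc (u z))) =
    kcst n t * (kcst n t * gaussian (2 * T)^-1 (z - w)) * (wabs t h w * wabs t u z) by rewrite /wabs; ring.
  have -> : kcst n t * gaussian (2 * T)^-1 (z - w) = 2 ^+ n * ukern t (z - w).
    by rewrite /ukern mulVKf// gt_eqF// exprn_gt0.
  have c0 : 0 <= kcst n t * 2 ^+ n * ukern t (z - w).
    by apply: mulr_ge0 => //; apply: mulr_ge0; rewrite ?exprn_ge0// ltW.
  have ab : wabs t h w * wabs t u z <= wabs t h w ^+ 2 + wabs t u z ^+ 2.
    have := wabs_ge0 t h w; have := wabs_ge0 t u z.
    by move: (wabs t h w) (wabs t u z) => a b ? ?; nra.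
  have := ler_wpM2l c0 ab.
  by move: (kcst n t) (2 ^+ n) (ukern t (z - w)) (wabs t h w) (wabs t u z) => *; lra.
transitivity (cint leb (fun z => cint leb (fun w => Phi (z, w)))).
  apply: eq_cint => z; have ki := cintble_kern p1 z mh hf.
  rewrite projE// /Phi /=.
  transitivity ((gauss_density t z)%:C * (u z)^*%R * cint leb (fun w => kern t z w * h w)); first by ring.
  by rewrite -cintZ//; apply: eq_cint => w; ring.
rewrite (cint_fubini Phii); apply: eq_cint => w.
have ki := cintble_kern p1 w mu uf.
have -> : (u w)^*%R = cint leb (fun z => (kern t w z * u z)^*%R).
  by rewrite cint_conj// -projE// (proj_id p1 mu uf hu).
transitivity ((gauss_density t w)%:C * h w * cint leb (fun z => (kern t w z * u z)^*%R)); last by ring.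
rewrite -cintZ; last exact: cintble_conj.
apply: eq_cint => z; rewrite /Phi /= kern_conj rmorphM /=; ring.
Qed.

End ToeplitzAdjoint.

(** * Adjoints of Toeplitz operators and the generated C^* algebra *)

Section CstarAlgebra.
Variables (R : realType) (n : nat) (t : {posnum R}).
Local Notation Cn := ('rV[R[i]]_n).
Local Notation leb := (lebesgue_Cn R n).
Local Notation T := (t%:num).
Local Notation N := (@fock_norm R n pos2 t).
Local Notation bop := (bounded_operator N).
Local Notation opn := (opnorm N).
Local Notation toep := (@toeplitz R n pos2 t).
Local Notation dot := (@fock_dot R n t).
Implicit Types (f g h : Cn -> R[i]) (z w : Cn) (u v : fock n pos2 t).

Let p1 := @pos2_gt1 R.

Let N_ge0 := @fock_norm_ge0 R n pos2 t.
Let NZ := @fock_normZ R n pos2 t.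
Let ND u v : N (u + v) <= N u + N v. Proof. by apply: fock_normD; exact: ltW. Qed.

Lemma sesq_conj h f : cmeas h -> (wint pos2 t h < +oo)%E -> cmeas f ->
  (wint pos2 t f < +oo)%E -> sesq t h f = (sesq t f h)^*%R.
Proof.
move=> mh hf mf ff; rewrite -cint_conj; last exact: cintble_sesq.
have E (a : R) (b c : R[i]) : a%:C * (b * c^*%R) = (a%:C * (c * b^*%R))^*%R.
  have rc : (a%:C)^*%R = a%:C by rewrite conjcE /= oppr0.
  move: rc; move: a%:C => a' rc.
  by rewrite !rmorphM /= conjCK rc [b * _]mulrC.
by apply: eq_cint => z; exact: E.
Qed.

Lemma cbounded_conj f (M : R) : cbounded f M -> cbounded (fun z => (f z)^*%R) M.
Proof.
by move=> [mf fM]; split => [|z]; [exact: cmeas_conj|rewrite normc_conj].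
Qed.

Lemma toeplitz_adjoint f (M : R) : cbounded f M ->
  adjoint dot (toep f) (toep (fun z => (f z)^*%R)).
Proof.
move=> fM u v; have cM := cbounded_conj fM.
have [mu uf hu] := fock_valP u; have [mv vf hv] := fock_valP v.
have [mf _] := fM; have [mcf _] := cM.
have ufi := wint_mul_lty fM mu uf; have vfi := wint_mul_lty cM mv vf.
have mfu := cmeasM mf mu; have mfv := cmeasM mcf mv.
rewrite !fock_dotE (toeplitz_val p1 u fM) (toeplitz_val p1 v cM) (sesq_proj v mfu ufi).
have [mw wf _] := fock_valP (toep (fun z => (f z)^*%R) v).
rewrite (toeplitz_val p1 v cM) in mw wf.
rewrite (sesq_conj mu uf mw wf) (sesq_proj u mfv vfi) -(sesq_conj mu uf mfv vfi).
apply: eq_cint => z; congr (_ * _).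
by rewrite rmorphM /= conjCK; ring.
Qed.

Lemma fock_dotBl u v (x : fock n pos2 t) : dot (u - v) x = dot u x - dot v x.
Proof.
have [mu uf hu] := fock_valP u; have [mv vf hv] := fock_valP v; have [mx xf hx] := fock_valP x.
rewrite !fock_dotE -cintB; try exact: cintble_sesq.
by apply: eq_cint => z; rewrite -mulrBr -mulrBl.
Qed.

Lemma fock_dotBr u v (x : fock n pos2 t) : dot x (u - v) = dot x u - dot x v.
Proof.
have [mu uf hu] := fock_valP u; have [mv vf hv] := fock_valP v; have [mx xf hx] := fock_valP x.
rewrite !fock_dotE -cintB; try exact: cintble_sesq.
by apply: eq_cint => z; rewrite -mulrBr -mulrBr -rmorphB.
Qed.

Lemma adjointB A A' B B' : adjoint dot A B -> adjoint dot A' B' ->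
  adjoint dot (A - A') (B - B').
Proof.
move=> AB AB' u v.
have -> : (A - A') u = A u - A' u by [].
have -> : (B - B') v = B v - B' v by [].
by rewrite fock_dotBl fock_dotBr AB AB'.
Qed.

(** If T_f is within e/2 of A, then B - T_g, with g the conjugate of f, is the adjoint of A - T_f,
    and [adjoint_bound] transfers the estimate. *)
Lemma toeplitz_lin_adjoint D : D `<=` (@BUC R n) -> subspace D ->
  (forall f, D f -> D (fun z => (f z)^*%R)) ->
  forall A B, toeplitz_lin pos2 t D A -> bop B -> adjoint dot A B ->
  toeplitz_lin pos2 t D B.
Proof.
move=> DB Dsub Dc A B; rewrite (toeplitz_linE t p1 DB Dsub) => -[bA AP] bB AB.
split => // e e0; have e2 : 0 < e / 2 by rewrite divr_gt0.
have [_ [f Df <-] fe] := AP _ e2.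
have [M _ fM] := BUC_bounded (DB _ Df).
exists (toep (fun z => (f z)^*%R)); first by exists (fun z => (f z)^*%R) => //; exact: Dc.
have bf := toeplitz_bounded t p1 fM.
have H := adjoint_bound e2 _ (adjointB AB (toeplitz_adjoint fM)).
apply: (@le_lt_trans _ _ (e / 2)); last by rewrite ltr_pdivrMr// ltr_pMr// ltr1n.
apply: (opnorm_le NZ (ltW e2)); apply: H => u.
apply: le_trans (opnorm_bound N_ge0 NZ u (boundedB N_ge0 NZ ND bA bf)) _.
by rewrite ler_wpM2r ?N_ge0// ltW.
Qed.

Lemma toeplitz_lin_Cstar (D : set (Cn -> R[i])) : Cstar_algebra_fun D -> translation_invariant D ->
  toeplitz_lin pos2 t D = toeplitz_Cstar t D.
Proof.
move=> [Dcl Dm Dc] tr; have [DB Dsub _] := Dcl; apply/seteqP; split.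
  move=> A LA X [[Xalg _] XD]; exact: (toeplitz_lin_sub_closed Xalg XD).
apply: smallest_sub; last exact: (toeplitz_ops_lin p1 DB Dsub).
split; first exact: (toeplitz_lin_subalgebra t p1 Dcl tr Dm).
exact: (toeplitz_lin_adjoint DB Dsub Dc).
Qed.

End CstarAlgebra.

(** * The Berezin transform *)

Section Berezin.
Variables (R : realType) (n : nat) (p t : {posnum R}).
Local Notation Cn := ('rV[R[i]]_n).
Local Notation leb := (lebesgue_Cn R n).
Local Notation P := (p%:num).
Local Notation T := (t%:num).
Local Notation N := (@fock_norm R n p t).
Local Notation bop := (bounded_operator N).
Local Notation opn := (opnorm N).
Local Notation toep := (@toeplitz R n p t).
Implicit Types (f g h : Cn -> R[i]) (z w v : Cn) (D : set (Cn -> R[i])).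
Hypothesis p1 : 1 < P.

Let N_ge0 := @fock_norm_ge0 R n p t.
Let NZ := @fock_normZ R n p t.
Let ND (u v : fock n p t) : N (u + v) <= N u + N v.
Proof. by apply: fock_normD; exact: ltW. Qed.
Let T0 : 0 < T. Proof. by []. Qed.

(** The reproducing kernel e^{<w, z>/t} as a function of w, with 1/t moved inside the form so that
    [Hol_cexp_cdot] applies. *)
Definition kfun z w : R[i] := cexp (cdot w ((T^-1)%:C *: z)).

Lemma normc_kfun z w : normc (kfun z w) = expR (Re (cdot w z) / T).
Proof. by rewrite normc_cexp cdotZrr Re_mulr mulrC. Qed.

(** Completing the square: the weighted kernel is a translate of the weight, so the norm of the
    kernel at z is governed by the factor 1/[wt t z]. *)
Lemma normc_kfun_wt z w : normc (kfun z w) * wt t w = (wt t z)^-1 * wt t (w - z).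
Proof.
rewrite normc_kfun /wt /gaussian -expRN -!expRD; congr expR.
rewrite sqnormB; move: (sqnorm w) (sqnorm z) (Re (cdot w z)) => a b c.
have nT : T != 0 by rewrite gt_eqF.
by move: (T : R) nT => r nr; field.
Qed.

Lemma cmeas_kfun z : cmeas (kfun z).
Proof. by apply: Hol_cmeas; exact: Hol_cexp_cdot. Qed.

Lemma wint_kfun z : (wint p t (kfun z) = (((wt t z)^-1) `^ P)%:E * \int[leb]_w (wt t w `^ P)%:E)%E.
Proof.
have mwt : measurable_fun setT (fun w : Cn => wt t w `^ P).
  by apply: (measurableT_comp (measurable_powR _)); exact: measurable_gaussian.
rewrite -ge0_integral_scale//; last 2 first.
- by move=> w; exact: powR_ge0.
- exact: powR_ge0.
rewrite -(integral_mpreserving (affine1_mpreserving (- z)) (f := fun w : Cn => ((wt t z)^-1 `^ P * wt t w `^ P)%:E)); last first.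
  by apply/measurable_EFinP; apply: measurable_funM.
apply: eq_integral => w _; congr EFin; rewrite normc_kfun_wt powRM ?invr_ge0 ?wt_ge0//.
Qed.

Lemma wt_powR_lty : (\int[leb]_w (wt t w `^ P)%:E < +oo)%E.
Proof.
under eq_integral do rewrite wt_powR mulrC mulrN.
by apply: integral_gaussian_lty; rewrite invr_gt0.
Qed.

Lemma kfun_mem z : kfun z \in fock_pred p t.
Proof.
apply/fock_memP; split; [exact: cmeas_kfun| |exact: Hol_cexp_cdot].
by rewrite wint_kfun lte_mul_pinfty ?lee_fin ?powR_ge0// wt_powR_lty.
Qed.

Definition kfock z : fock n p t := Fock (kfun_mem z).

Lemma kfock_norm z : N (kfock z) <= (wt t z)^-1 * N (kfock 0).
Proof.
apply: fock_norm_le; first by rewrite invr_ge0 wt_ge0.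
rewrite [X in (X <= _)%E]wint_kfun [X in (_ <= _ * X)%E]wint_kfun.
have -> : wt t (0 : Cn) = 1 by rewrite /wt /gaussian sqnorm0 mulr0 oppr0 expR0.
by rewrite invr1 powR1 mul1e.
Qed.

(** Since u = P_t u, [jensen_proj] bounds the weighted value at z by an average of the p-th powers;
    replacing the density [ukern] by its maximum m leaves the norm. *)
Lemma fock_eval_le : exists2 C : R, 0 <= C &
  forall (u : fock n p t) z, normc (u z) * wt t z <= C * N u.
Proof.
have P0 : 0 < P by [].
pose m : R := 2 ^- n * kcst n t.
have m0 : 0 <= m by apply: mulr_ge0; [rewrite invr_ge0 exprn_ge0|exact: ltW (kcst_gt0 n t)].
have fc := fock_cst_gt0 n p t.
pose A : R := (2 ^+ n) `^ P * m / fock_cst n p t.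
have A0 : 0 <= A by rewrite divr_ge0 ?(ltW fc)// mulr_ge0// powR_ge0.
exists (A `^ P^-1); first exact: powR_ge0.
move=> u z; have [mu uf hu] := fock_valP u.
have x0 : 0 <= normc (u z) * wt t z by rewrite mulr_ge0 ?normc_ge0 ?wt_ge0.
have mW : measurable_fun setT (fun w => (normc (u w) * wt t w) `^ P) by exact: measurable_wnorm.
have H : (normc (u z) * wt t z) `^ P <= A * N u `^ P.
  have := jensen_proj p1 z mu uf; rewrite (proj_id p1 mu uf hu) => H.
  rewrite -lee_fin; apply: le_trans H _.
  rewrite /A (_ : (2 ^+ n) `^ P * m / fock_cst n p t * N u `^ P = (2 ^+ n) `^ P * (m * (N u `^ P / fock_cst n p t))); last by ring.
  rewrite EFinM; apply: lee_wpmul2l; first by rewrite lee_fin powR_ge0.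
  rewrite EFinM -wint_norm /wint -ge0_integral_scale//; last by move=> w; exact: powR_ge0.
  apply: ge0_le_integral => //.
  - by move=> w _; rewrite lee_fin mulr_ge0 ?powR_ge0 ?ukern_ge0.
  - by apply/measurable_EFinP; apply: measurable_funM => //; exact: measurable_ukern_shift.
  - by apply/measurable_EFinP; apply: measurable_funM.
  move=> w _; rewrite lee_fin ler_wpM2r ?powR_ge0// /ukern /m ler_wpM2l ?invr_ge0 ?exprn_ge0//.
  rewrite ler_piMr ?(ltW (kcst_gt0 n t))// /gaussian -expR0 ler_expR oppr_le0.
  by rewrite mulr_ge0 ?sqnorm_ge0// invr_ge0 mulr_ge0.
have := ge0_ler_powR (_ : 0 <= P^-1) _ _ H; rewrite invr_ge0 ltW// !nnegrE => /(_ isT (powR_ge0 _ _)).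
rewrite mulr_ge0 ?powR_ge0// => /(_ isT).
by rewrite powRM ?powR_ge0// -!powRrM divff ?gt_eqF// !powRr1.
Qed.

(* The factor [wt t z ^+ 2] normalizes the kernel [kfock z] and evaluation at [z]
   simultaneously. *)
Definition berezin (A : fock n p t -> fock n p t) z : R[i] :=
  (wt t z ^+ 2)%:C * A (kfock z) z.

Lemma berezin_le : exists2 C : R, 0 <= C &
  forall A z, bop A -> normc (berezin A z) <= C * opn A.
Proof.
have [C C0 CP] := fock_eval_le.
exists (C * N (kfock 0)); first by rewrite mulr_ge0.
move=> A z bA; have w0 := wt_gt0 t z.
have -> : normc (berezin A z) = wt t z * (normc (A (kfock z) z) * wt t z).
  rewrite /berezin; move: (A (kfock z) z) => c.
  by rewrite Normc.normcM normc_real ger0_norm ?sqr_ge0//; ring.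
apply: le_trans (ler_wpM2l (ltW w0) (CP _ z)) _.
have H1 := opnorm_bound N_ge0 NZ (kfock z) bA.
have H2 := le_trans H1 (ler_wpM2l (opnorm_ge0 N_ge0 NZ bA) (kfock_norm z)).
have := ler_wpM2l (ltW w0) (ler_wpM2l C0 H2) => /le_trans; apply.
rewrite le_eqVlt; apply/orP; left; apply/eqP.
by move: (wt t z) w0 => x x0; field; rewrite gt_eqF.
Qed.

Lemma berezinB A B z : berezin (A - B) z = berezin A z - berezin B z.
Proof.
rewrite /berezin -mulrBr; congr (_ * _).
Qed.

End Berezin.

(** * Berezin transforms of Toeplitz operators and of their products *)

Section BerezinToeplitz.
Variables (R : realType) (n : nat) (p t : {posnum R}).
Local Notation Cn := ('rV[R[i]]_n).
Local Notation leb := (lebesgue_Cn R n).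
Local Notation P := (p%:num).
Local Notation T := (t%:num).
Local Notation N := (@fock_norm R n p t).
Local Notation bop := (bounded_operator N).
Local Notation opn := (opnorm N).
Local Notation toep := (@toeplitz R n p t).
Implicit Types (f g h : Cn -> R[i]) (z w v : Cn) (D : set (Cn -> R[i])).
Hypothesis p1 : 1 < P.

Let N_ge0 := @fock_norm_ge0 R n p t.
Let NZ := @fock_normZ R n p t.
Let ND (u v : fock n p t) : N (u + v) <= N u + N v.
Proof. by apply: fock_normD; exact: ltW. Qed.
Let T0 : 0 < T. Proof. by []. Qed.

Lemma kcst_gdens z : kcst n t * gaussian T^-1 z = gdens T^-1 z.
Proof.
rewrite /gdens /kcst; congr (_ * _); rewrite -exprVn; congr (_ ^+ _).
by rewrite invfM mulrC.
Qed.

(** The phases of e^{<z, w>/t} and e^{<w, z>/t} cancel, and together with the Gaussian factors they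
    form e^{-|z - w|^2/t}: this is why the Berezin transform of T_f is a convolution. *)
Lemma kern_kfun z w : (wt t z ^+ 2)%:C * (kern t z w * kfun t z w) = (gdens T^-1 (z - w))%:C.
Proof.
have -> : wt t z ^+ 2 = gaussian T^-1 z.
  rewrite /wt /gaussian -expRM_natl; congr expR.
  have nT : T != 0 by rewrite gt_eqF.
  by move: (sqnorm z) (T : R) nT => a r nr; field.
rewrite -kcst_gdens /kern gauss_densityE !rmorphM /= !gaussian_cexp /kfun.
transitivity ((kcst n t)%:C * (cexp (- ((T^-1)%:C * cdot z z)) * (cexp (- ((T^-1)%:C * cdot w w)) *
   (cexp (cdot z w / T%:C) * (cexp (cdot w ((T^-1)%:C *: z)) * 1))))); first by ring.
rewrite !cexpDM mulr1; congr (_ * cexp _).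
rewrite cdotZrr !cdotDl !cdotDr !cdotNl !cdotNr fmorphV /=; ring.
Qed.

Lemma berezin_toeplitz f (M : R) z : cbounded f M ->
  berezin (toep f) z = cint leb (fun x => (gdens T^-1 x)%:C * f (z - x)).
Proof.
move=> fM; have [mf fb] := fM.
have [mk kf _] := fock_valP (kfock p t z).
have [mr _] := @reflect_mpreserving R n z.
have mfk : cmeas (fun w => f w * kfun t z w) by exact: cmeasM mf mk.
have ffk := wint_mul_lty fM mk kf.
rewrite /berezin (toeplitz_apply p1 (kfock p t z) z fM) projE// -cintZ; last exact: (cintble_kern p1 z mfk ffk).
rewrite -(cint_mpreserving (reflect_mpreserving z) (f := fun x => (gdens T^-1 x)%:C * f (z - x))); last first.
  apply: cmeasM; last exact: cmeas_reflect.
  by case: (@cintble_gdens R n T^-1 _); rewrite ?invr_gt0.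
apply: eq_cint => w; have kE : kfock p t z w = kfun t z w by [].
rewrite subKr -kern_kfun kE.
by move: (kern t z w) (kfun t z w) ((wt t z ^+ 2)%:C) (f w) => *; ring.
Qed.

Lemma berezin_toeplitz_mem D f : closed_subspace_BUC D -> translation_invariant D ->
  D f -> D (berezin (toep f)).
Proof.
move=> Dcl tr Df; have [DB Dsub _] := Dcl; have [M _ fM] := BUC_bounded (DB _ Df).
have Ti : 0 < T^-1 by rewrite invr_gt0.
have -> : berezin (toep f) = (fun z => ((T^-1 / pi) ^+ n)%:C * gconv f T^-1 z).
  by apply/funext => z; rewrite (berezin_toeplitz z fM) (gdens_convE z Ti fM).
have [D0 Dlin] := Dsub; have := Dlin ((T^-1 / pi) ^+ n)%:C _ _ (gconv_mem Dcl tr Ti Df) D0.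
by rewrite addr0.
Qed.

Lemma berezin_mem D A : closed_subspace_BUC D -> translation_invariant D ->
  toeplitz_lin p t D A -> D (berezin A).
Proof.
move=> Dcl tr; have [DB Dsub _] := Dcl; rewrite (toeplitz_linE t p1 DB Dsub) => -[bA AP].
have [C C0 CP] := @berezin_le R n p t p1.
apply: (closed_subspace_uniform_closed Dcl) => e e0.
have d0 : 0 < e / (C + 1) by rewrite divr_gt0// ltr_wpDl.
have [_ [f Df <-] fe] := AP _ d0; exists (berezin (toep f)); first exact: berezin_toeplitz_mem.
move=> z; have [M _ fM] := BUC_bounded (DB _ Df).
rewrite -berezinB; apply: le_trans (CP _ z (boundedB N_ge0 NZ ND bA (toeplitz_bounded t p1 fM))) _.
apply: le_trans (ler_wpM2l C0 (ltW fe)) _.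
by rewrite mulrA ler_pdivrMr ?ltr_wpDl// mulrC ler_wpM2l ?(ltW e0)// lerDl.
Qed.

(** The modulus of the integrand is at most M times a Gaussian in v centred at the midpoint (w +
    z)/2; completing the square there leaves e^{|w + z|^2/(4t)}. *)
Lemma toeplitz_kfock_le g (M : R) z w : cbounded g M ->
  normc (toep g (kfock p t z) w) <= M * expR (sqnorm (w + z) / (4 * T)).
Proof.
move=> gM; have [mg gb] := gM; have [mk kf _] := fock_valP (kfock p t z).
have M0 : 0 <= M by exact: le_trans (normc_ge0 _) (gb 0).
have Ti : 0 < T^-1 by rewrite invr_gt0.
have mgk : cmeas (fun v => g v * kfun t z v) by exact: cmeasM mg mk.
have gkf := wint_mul_lty gM mk kf.
have ki := cintble_kern p1 w mgk gkf.
rewrite (toeplitz_apply p1 (kfock p t z) w gM) projE//.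
apply: cint_norm_le_fin => //.
pose s : Cn := (2^-1)%:C *: (w + z).
have mgs : measurable_fun setT (fun v : Cn => gdens T^-1 (v - s)).
  apply: (measurableT_comp (f := gdens T^-1)); last exact: measurable_shift.
  by apply: measurable_funM => //; exact: measurable_gaussian.
apply: (@le_trans _ _ (\int[leb]_v (M * expR (sqnorm (w + z) / (4 * T)) * gdens T^-1 (v - s))%:E)%E).
  apply: ge0_le_integral => //.
  - by move=> v _; rewrite lee_fin normc_ge0.
  - by apply: measurable_enormc; case: ki.
  - by apply/measurable_EFinP; apply: measurable_funM.
  move=> v _; rewrite lee_fin.
  have -> : normc (kern t w v * (g v * kfun t z v)) = normc (g v) * (normc (kern t w v) * normc (kfun t z v)).
    by move: (kern t w v) (g v) (kfun t z v) => a b c; rewrite !Normc.normcM; ring.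
  rewrite -[leRHS]mulrA ler_pM ?normc_ge0 ?mulr_ge0 ?normc_ge0//.
  rewrite normc_kern normc_kfun -kcst_gdens le_eqVlt; apply/orP; left; apply/eqP.
  rewrite -!mulrA [RHS]mulrCA; congr (_ * _).
  rewrite /gaussian -!expRD; congr expR.
  rewrite sqnormB /s sqnormZ cdotZrr Re_mulr cdotDr ReD normc_real ger0_norm ?invr_ge0//.
  have -> : Re (cdot w v) = Re (cdot v w) by rewrite -cdot_conj Re_conj.
  have nT : T != 0 by rewrite gt_eqF.
  move: (sqnorm v) (sqnorm (w + z)) (Re (cdot v w)) (Re (cdot v z)) (T : R) nT => a b c d r nr.
  by field.
have k0 : 0 <= M * expR (sqnorm (w + z) / (4 * T)) by rewrite mulr_ge0 ?expR_ge0.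
rewrite ge0_integral_scale//; last by move=> v; exact: gdens_ge0.
rewrite (integral_mpreserving (affine1_mpreserving (- s)) (f := fun v : Cn => (gdens T^-1 v)%:E)); last first.
  by apply/measurable_EFinP; apply: measurable_funM => //; exact: measurable_gaussian.
by rewrite integral_gdens// mule1.
Qed.

(** With V = T_g K_z, reproduction gives f(z) V(z) = P_t(f(z) V)(z), so the difference is P_t((f -
    f(z)) V)(z) up to the weight. The factors e^{-|z|^2/t}, |[kern]| and e^{|w + z|^2/(4t)} combine
    to e^{-3|z - w|^2/(4t)}, and (4/3)^n is the ratio of the normalizing constants. *)
Lemma berezin_mul_dist f g (M1 M2 : R) z (e : R) : cbounded f M1 -> cbounded g M2 ->
  (\int[leb]_x (gdens (3 / (4 * T)) x * normc (f (z - x) - f z))%:E <= e%:E)%E ->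
  normc (berezin (toep f \o toep g) z - f z * berezin (toep g) z) <= M2 * (4 / 3) ^+ n * e.
Proof.
move=> fM gM fe; have [mf fb] := fM; have [mg gb] := gM.
have M20 : 0 <= M2 by exact: le_trans (normc_ge0 _) (gb 0).
set V := toep g (kfock p t z); have [mV Vf hV] := fock_valP V.
have b0 : 0 < 3 / (4 * T) by rewrite divr_gt0// mulr_gt0.
have dM : cbounded (fun w => f w - f z) (M1 + M1).
  split; first by apply: cmeasB => //; exact: cmeas_cst.
  by move=> w; apply: le_trans (le_normcB _ _) _; rewrite lerD.
have mdV : cmeas (fun w => (f w - f z) * V w) by exact: cmeasM dM.1 mV.
have ki := cintble_kern p1 z mdV (wint_mul_lty dM mV Vf).
have kfi := cintble_kern p1 z (cmeasM mf mV) (wint_mul_lty fM mV Vf).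
have kVi := cintble_kern p1 z mV Vf.
have E : berezin (toep f \o toep g) z - f z * berezin (toep g) z =
    (wt t z ^+ 2)%:C * cint leb (fun w => kern t z w * ((f w - f z) * V w)).
  have E1 : toep f V z = cint leb (fun w => kern t z w * (f w * V w)).
    by rewrite (toeplitz_apply p1 V z fM) projE//; exact: cmeasM.
  have E2 : V z = cint leb (fun w => kern t z w * V w).
    by rewrite -projE// (proj_id p1 mV Vf hV).
  rewrite /berezin [(toep f \o toep g) _]/(toep f V) E1 -/V [in X in _ - X]E2.
  rewrite mulrCA -mulrBr; congr (_ * _).
  rewrite -cintZ// -cintB//; last exact: cintbleZ.
  by apply: eq_cint => w; ring.
rewrite E -cintZ//; apply: cint_norm_le_fin; first exact: cintbleZ.
have mr := (@reflect_mpreserving R n z).1.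
have mgd : measurable_fun setT (fun x : Cn => gdens (3 / (4 * T)) x).
  by apply: measurable_funM => //; exact: measurable_gaussian.
have C0 : 0 <= M2 * (4 / 3) ^+ n by rewrite mulr_ge0// exprn_ge0// divr_ge0.
have mF : measurable_fun setT (fun x : Cn => gdens (3 / (4 * T)) x * normc (f (z - x) - f z)).
  apply: measurable_funM => //; apply: measurable_normc.
  by apply: cmeasB; [exact: cmeas_reflect|exact: cmeas_cst].
have F0 (x : Cn) : 0 <= gdens (3 / (4 * T)) x * normc (f (z - x) - f z).
  by rewrite mulr_ge0 ?normc_ge0// gdens_ge0.
apply: (@le_trans _ _ (\int[leb]_w (M2 * (4 / 3) ^+ n * (gdens (3 / (4 * T)) (z - w) * normc (f (z - (z - w)) - f z)))%:E)%E); last first.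
  rewrite (integral_mpreserving (reflect_mpreserving z)
    (f := fun x : Cn => (M2 * (4 / 3) ^+ n * (gdens (3 / (4 * T)) x * normc (f (z - x) - f z)))%:E)); last first.
    by apply/measurable_EFinP; apply: measurable_funM.
  by rewrite ge0_integral_scale// [leRHS]EFinM; apply: lee_wpmul2l; rewrite ?lee_fin.
apply: ge0_le_integral => //.
- by move=> w _; rewrite lee_fin normc_ge0.
- by apply: measurable_enormc; case: (cintbleZ (wt t z ^+ 2)%:C ki).
- apply/measurable_EFinP; apply: measurable_funM => //; exact: (measurableT_comp mF mr).
move=> w _; rewrite lee_fin subKr.
have -> : normc ((wt t z ^+ 2)%:C * (kern t z w * ((f w - f z) * V w))) =
    wt t z ^+ 2 * (normc (kern t z w)) * normc (V w) * normc (f w - f z).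
  move: (kern t z w) (f w - f z) (V w) => a b c.
  by rewrite !Normc.normcM normc_real ger0_norm ?sqr_ge0//; ring.
rewrite mulrA ler_wpM2r ?normc_ge0//.
have k0 : 0 <= wt t z ^+ 2 * normc (kern t z w) by rewrite mulr_ge0 ?sqr_ge0 ?normc_ge0.
apply: le_trans (ler_wpM2l k0 (toeplitz_kfock_le z w gM)) _.
rewrite le_eqVlt; apply/orP; left; apply/eqP.
rewrite normc_kern /gdens /wt /gaussian /kcst.
transitivity (M2 * (pi * T) ^- n * (expR (- ((2 * T)^-1 * sqnorm z)) ^+ 2 * (expR (- (T^-1 * sqnorm w)) * expR (Re (cdot z w) / T) * expR (sqnorm (w + z) / (4 * T))))).
  by ring.
rewrite -expRM_natl -!expRD.
transitivity (M2 * ((4 / 3) ^+ n * (3 / (4 * T) / pi) ^+ n) * expR (- (3 / (4 * T) * sqnorm (z - w)))); last by ring.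
congr (_ * expR _); last first.
  rewrite sqnormB sqnormD.
  have -> : Re (cdot w z) = Re (cdot z w) by rewrite -cdot_conj Re_conj.
  have nT : T != 0 by rewrite gt_eqF.
  by move: (sqnorm w) (sqnorm z) (Re (cdot z w)) (T : R) nT => a b c r nr; field.
congr (_ * _); rewrite -exprMn -exprVn; congr (_ ^+ _).
have nT : T != 0 by rewrite gt_eqF.
have := pi_gt0 R; move: (pi : R) (T : R) nT => x r nr x0.
by field; rewrite nr gt_eqF.
Qed.

End BerezinToeplitz.

(** * The limit t -> 0: from operators back to symbols *)

Section SmallParameter.
Variables (R : realType) (n : nat).
Local Notation Cn := ('rV[R[i]]_n).
Local Notation leb := (lebesgue_Cn R n).
Implicit Types (f g : Cn -> R[i]) (t : {posnum R}) (D J : set (Cn -> R[i])).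

Let p1 := @pos2_gt1 R.

Lemma small_parameter (b0 c : R) : 0 < c ->
  exists2 r : R, 0 < r & forall T, 0 < T <= r -> b0 <= c / T.
Proof.
move=> c0; have m0 : 0 < Num.max b0 1 by rewrite lt_max ltr01 orbT.
exists (c / Num.max b0 1); first by rewrite divr_gt0.
move=> T /andP[T0 Tr]; apply: (@le_trans _ _ (Num.max b0 1)); first by rewrite le_max lexx.
by rewrite ler_pdivlMr// mulrC -ler_pdivlMr.
Qed.

Lemma berezin_approx f (e : R) : BUC f -> 0 < e ->
  exists2 r : R, 0 < r & forall t, t%:num <= r -> forall z,
    normc (berezin (@toeplitz R n pos2 t f) z - f z) <= e.
Proof.
move=> fB e0; have [M _ fM] := BUC_bounded fB.
have [b0 b0P] := approx_identity fB e0.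
have [r r0 rP] := @small_parameter b0 1 ltr01.
exists r => // t tr z; rewrite (berezin_toeplitz t p1 z fM).
have T0 : 0 < t%:num by [].
have Ti : 0 < t%:num^-1 by rewrite invr_gt0.
apply: gdens_dist_le Ti fM (b0P _ _ Ti z).
by rewrite -div1r; apply: rP; rewrite T0.
Qed.

Lemma berezin_mul_approx f g (e : R) : BUC f -> BUC g -> 0 < e ->
  exists2 r : R, 0 < r & forall t, t%:num <= r -> forall z,
    normc (berezin (@toeplitz R n pos2 t f \o toeplitz g) z - f z * g z) <= e.
Proof.
move=> fB gB e0; have [M1 M10 fM] := BUC_bounded fB; have [M2 M20 gM] := BUC_bounded gB.
pose k : R := M2 * (4 / 3) ^+ n.
have k0 : 0 <= k by rewrite mulr_ge0// exprn_ge0// divr_ge0.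
pose d := e / (2 * (k + 1)).
have d0 : 0 < d by rewrite divr_gt0// mulr_gt0// ltr_wpDl.
pose d' := e / (2 * (M1 + 1)).
have d'0 : 0 < d' by rewrite divr_gt0// mulr_gt0// ltr_wpDl.
have [b0 b0P] := approx_identity fB d0.
have c0 : 0 < 3 / 4 :> R by rewrite divr_gt0.
have [r1 r10 r1P] := small_parameter b0 c0.
have [r2 r20 r2P] := berezin_approx gB d'0.
exists (Num.min r1 r2); first by rewrite lt_min r10.
move=> t; rewrite le_min => /andP[tr1 tr2] z.
have T0 : 0 < t%:num by [].
have b1 : 0 < 3 / (4 * t%:num) by rewrite divr_gt0// mulr_gt0.
have bb : b0 <= 3 / (4 * t%:num).
  by rewrite invfM mulrA; apply: r1P; rewrite T0.
have H1 := berezin_mul_dist p1 fM gM (b0P _ bb b1 z).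
have H2 := r2P t tr2 z.
set A := berezin _ z in H1 *; set B := berezin (toeplitz g) z in H1 H2.
have -> : A - f z * g z = (A - f z * B) + f z * (B - g z) by ring.
apply: le_trans (le_normcD _ _) _; rewrite Normc.normcM [leRHS]splitr; apply: lerD.
  apply: le_trans H1 _; rewrite -/k /d mulrA ler_pdivrMr ?mulr_gt0 ?ltr_wpDl//.
  by clear -k0 e0; nra.
have fz := fM.2 z.
apply: le_trans (ler_pM (normc_ge0 _) (normc_ge0 _) fz H2) _.
rewrite /d' mulrA ler_pdivrMr ?mulr_gt0 ?ltr_wpDl//.
by clear -M10 e0; nra.
Qed.

(** The order of the factors may vary with t. Both orders have Berezin transforms near f g, so t is
    taken below both thresholds before the order is inspected. *)
Lemma symbol_mul_mem J f g : closed_subspace_BUC J -> translation_invariant J ->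
  BUC f -> BUC g ->
  (forall t, toeplitz_lin pos2 t J (toeplitz f \o toeplitz g) \/
             toeplitz_lin pos2 t J (toeplitz g \o toeplitz f)) ->
  J (f \* g).
Proof.
move=> Jcl tr fB gB H; apply: (closed_subspace_uniform_closed Jcl) => e e0.
have [r1 r10 r1P] := berezin_mul_approx fB gB e0.
have [r2 r20 r2P] := berezin_mul_approx gB fB e0.
have r0 : 0 < Num.min r1 r2 by rewrite lt_min r10.
pose t := PosNum r0.
have t1 : t%:num <= r1 by rewrite /= ge_min lexx.
have t2 : t%:num <= r2 by rewrite /= ge_min lexx orbT.
have [L|L] := H t; have By := berezin_mem p1 Jcl tr L.
  exists (berezin (@toeplitz R n pos2 t f \o toeplitz g)) => // z.
  by rewrite -normcN opprB; exact: r1P.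
exists (berezin (@toeplitz R n pos2 t g \o toeplitz f)) => // z.
by rewrite -normcN opprB [(f \* g) z]mulrC; exact: r2P.
Qed.

Lemma symbol_conj_mem J f : closed_subspace_BUC J -> translation_invariant J ->
  BUC f -> (forall t, toeplitz_lin pos2 t J (toeplitz (fun z => (f z)^*%R))) ->
  J (fun z => (f z)^*%R).
Proof.
move=> Jcl tr fB H; apply: (closed_subspace_uniform_closed Jcl) => e e0.
have cB : BUC (fun z => (f z)^*%R).
  have [[M fM] /unif_continuousP uf] := fB; split.
    by exists M => z; rewrite normc_conj.
  apply/unif_continuousP => e' e'0; have [d d0 dP] := uf e' e'0.
  by exists d => // z w zw; rewrite -rmorphB normc_conj dP.
have [r r0 rP] := berezin_approx cB e0.
exists (berezin (@toeplitz R n pos2 (PosNum r0) (fun z => (f z)^*%R))).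
  exact: berezin_mem (H _).
by move=> z; rewrite -normcN opprB; exact: rP.
Qed.

(** Products come from T_f T_g. Conjugates come from the adjoint of T_f, which is the Toeplitz
    operator of the conjugate symbol and lies in the C^* algebra. *)
Lemma Cstar_of_toeplitz D : closed_subspace_BUC D -> translation_invariant D ->
  (forall t, toeplitz_lin pos2 t D = toeplitz_Cstar t D) -> Cstar_algebra_fun D.
Proof.
move=> Dcl tr H; have [DB Dsub _] := Dcl.
have opsD t f : D f -> toeplitz_Cstar t D (toeplitz f).
  by move=> Df X [_ XD]; apply: XD; exists f.
split => // [f g Df Dg|f Df].
  apply: symbol_mul_mem => //; [exact: DB|exact: DB|move=> t; left].
  rewrite H => X [Xstar XD]; have [[_ _ Xc _] _] := Xstar.
  by apply: Xc; apply: XD; [exists f|exists g].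
apply: symbol_conj_mem => //; [exact: DB|move=> t].
have [M _ fM] := BUC_bounded (DB _ Df).
rewrite H => X [Xstar XD]; have [_ Xa] := Xstar.
apply: (Xa _ _ _ _ (toeplitz_adjoint fM)).
  by apply: XD; exists f.
exact: (toeplitz_bounded t p1 (cbounded_conj fM)).
Qed.

Lemma ideal_of_toeplitz I D : closed_subspace_BUC I -> closed_subspace_BUC D ->
  translation_invariant I -> I `<=` D ->
  (forall t, left_ideal (toeplitz_lin pos2 t I) (toeplitz_lin pos2 t D) \/
    right_ideal (toeplitz_lin pos2 t I) (toeplitz_lin pos2 t D)) ->
  ideal_fun I D.
Proof.
move=> Icl Dcl tr ID H; have [IB Isub _] := Icl; have [DB Dsub _] := Dcl.
split => // f g Df Ig; apply: symbol_mul_mem => //; [exact: DB|exact: IB|move=> t].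
have Lf : toeplitz_lin pos2 t D (toeplitz f) by apply: (toeplitz_ops_lin p1 DB Dsub); exists f.
have Lg : toeplitz_lin pos2 t I (toeplitz g) by apply: (toeplitz_ops_lin p1 IB Isub); exists g.
by have [[_ _ L]|[_ _ L]] := H t; [left|right]; exact: L.
Qed.

End SmallParameter.

(** For one-sided ideals the side may depend on t. This is the weakest reading of the condition, and
    it still returns an ideal because [symbol_mul_mem] accepts either order at each t. *)
Theorem theoremB (R : realType) (n : nat) (n_gt0 : (0 < n)%N)
    (D0 : set ('rV[R[i]]_n -> R[i])) :
  closed_subspace_BUC D0 -> translation_invariant D0 -> U_invariant D0 ->
  [/\ (Cstar_algebra_fun D0 <->
        forall t : {posnum R},
          toeplitz_lin pos2 t D0 = toeplitz_Cstar t D0),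
      (Cstar_algebra_fun D0 ->
        forall p t : {posnum R}, 1 < p%:num ->
          toeplitz_lin p t D0 = toeplitz_alg p t D0) &
      (Cstar_algebra_fun D0 ->
        forall I0 : set ('rV[R[i]]_n -> R[i]),
          I0 `<=` D0 -> closed_subspace_BUC I0 -> translation_invariant I0 ->
          [/\ (ideal_fun I0 D0 <->
                forall t : {posnum R},
                  left_ideal (toeplitz_lin pos2 t I0)
                    (toeplitz_lin pos2 t D0) \/
                  right_ideal (toeplitz_lin pos2 t I0)
                    (toeplitz_lin pos2 t D0)),
              (ideal_fun I0 D0 <->
                forall t : {posnum R},
                  two_sided_ideal (toeplitz_lin pos2 t I0)
                    (toeplitz_lin pos2 t D0)) &
              (ideal_fun I0 D0 ->
                forall p t : {posnum R}, 1 < p%:num ->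
                  [/\ toeplitz_lin p t I0 = toeplitz_alg p t I0,
                      norm_closed (fock_opnorm n p t) (fock_operator n p t)
                        (toeplitz_lin p t I0) &
                      two_sided_ideal (toeplitz_lin p t I0)
                        (toeplitz_lin p t D0)])])].
Proof.
move=> Dcl tr _; split.
- split=> [Dstar t|]; first exact: toeplitz_lin_Cstar.
  exact: Cstar_of_toeplitz.
- by move=> [_ Dm _] p t p1; exact: toeplitz_lin_alg.
move=> _ I0 ID Icl trI; have [IB Isub _] := Icl.
have two p t : 1 < p%:num -> ideal_fun I0 D0 ->
    two_sided_ideal (toeplitz_lin p t I0) (toeplitz_lin p t D0).
  by move=> p1; exact: toeplitz_lin_ideal.
have one := ideal_of_toeplitz Icl Dcl trI ID.
split.
- split=> [Iid t|]; last exact: one.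
  by left; have [] := two _ t (@pos2_gt1 R) Iid.
- split=> [Iid t|H]; first exact: two (@pos2_gt1 R) Iid.
  by apply: one => t; left; have [] := H t.
move=> Iid p t p1; split; last exact: two.
  (* An ideal of D0 contained in D0 is itself closed under products, so the algebra statement holds
     for I0. *)
  apply: toeplitz_lin_alg => // f g If Ig.
  by have [_ _ Im] := Iid; exact: Im (ID _ If) Ig.
exact: toeplitz_lin_closed.
Qed.
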